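(* The C*-algebra $C^*(\tilde T_{\vec a}:\vec a\in\mathbb{R}^n)\subset B(L^2(\mathbb{R}^n))$ generated by the operators $\tilde T_{\vec a}$ is equal to the C*-algebra generated by the translation operators on $L^2(\mathbb{R}^n)$ together with the multiplication operators by continuous functions vanishing at infinity. It is $*$-isomorphic to the crossed product $C_0(\mathbb{R}^n)^+\times_\lambda\mathbb{R}^n_d$, where $C_0(\mathbb{R}^n)^+$ is the unitization of $C_0(\mathbb{R}^n)$, $\mathbb{R}^n_d$ is the group $\mathbb{R}^n$ with the discrete topology, and $\lambda$ is the action of $\mathbb{R}^n_d$ on $C_0(\mathbb{R}^n)^+$ by translations.
   Context: Fix $n\ge 1$ and $m>0$, and let $E(\vec p)=\sqrt{|\vec p|^2+m^2}$ for $\vec p\in\mathbb{R}^n$. Let $L^2_r(\mathbb{R}^n)=L^2(\mathbb{R}^n,d\vec p/E(\vec p))$. For $\vec a\in\mathbb{R}^n$ let $T_{\vec a}$ be the bounded translation operator on $L^2_r(\mathbb{R}^n)$, $T_{\vec a}\phi(\vec p)=\phi(\vec p-\vec a)$. The operator $M_{\sqrt E}$ of multiplication by $\sqrt{E}$ is a unitary map from $L^2(\mathbb{R}^n)$ (Lebesgue measure) onto $L^2_r(\mathbb{R}^n)$, and one defines $\tilde T_{\vec a}=M_{\sqrt E}^{-1}T_{\vec a}M_{\sqrt E}\in B(L^2(\mathbb{R}^n))$. Crossed products are full (universal) C*-crossed products. *)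

(* Defs.v *)
From HB Require Import structures.
From mathcomp Require Import all_boot all_order all_algebra.
From mathcomp Require Import generic_quotient ring_quotient sesquilinear complex.
From mathcomp Require Import finmap ring lra.
From mathcomp Require Import all_classical all_reals all_analysis.
From mathcomp Require Import measurable_realfun.

Set Implicit Arguments.
Unset Strict Implicit.
Unset Printing Implicit Defensive.

Import Order.TTheory GRing.Theory Num.Theory.
Import numFieldNormedType.Exports.
Local Open Scope classical_set_scope.
Local Open Scope ring_scope.
Local Open Scope complex_scope.

Fact measure_rV_display : measure_display -> measure_display.
Proof. exact. Qed.

(* The product (= Borel) sigma-algebra, generated by the coordinates. *)
Section measurable_rV.
Context (R : realType) (n : nat).

Let coor (i : 'I_n) (p : 'rV[R]_n) : measurableTypeR R := p ord0 i.

Let rV_set0 : g_sigma_preimage coor set0.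
Proof. exact: sigma_algebra0. Qed.

Let rV_setC A : g_sigma_preimage coor A -> g_sigma_preimage coor (~` A).
Proof. exact: sigma_algebraC. Qed.

Let rV_bigcup (F : (set 'rV[R]_n)^nat) :
  (forall i, g_sigma_preimage coor (F i)) ->
  g_sigma_preimage coor (\bigcup_i (F i)).
Proof. exact: sigma_algebra_bigcup. Qed.

HB.instance Definition _ :=
  @isMeasurable.Build (measure_rV_display default_measure_display)
    'rV[R]_n (g_sigma_preimage coor) rV_set0 rV_setC rV_bigcup.

Lemma measurable_coord (i : 'I_n) :
  measurable_fun [set: 'rV[R]_n] (fun p : 'rV[R]_n => p ord0 i : measurableTypeR R).
Proof.
move=> _ Y mY; rewrite setTI; apply: sub_sigma_algebra => /=.
rewrite -bigcup_seq/=; exists i => /=; first by rewrite mem_index_enum.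
by exists Y => //; rewrite setTI.
Qed.

Lemma measurable_fun_rVP d (T : measurableType d) (f : T -> 'rV[R]_n) :
  (forall i, measurable_fun [set: T] (fun t => f t ord0 i : measurableTypeR R)) ->
  measurable_fun [set: T] f.
Proof.
move=> mf; have sub : g_sigma_preimage (fun i => coor i \o f) `<=` measurable.
  apply: smallest_sub; first exact: sigma_algebra_measurable.
  move=> A; rewrite -bigcup_seq/= => -[i _ [B mB <-]].
  exact: mf.
move=> _ A mA; apply: sub; rewrite g_sigma_preimage_comp.
by exists A.
Qed.
End measurable_rV.

Section lebesgue_rV.
Context (R : realType).

Definition rV_rcons n (vx : 'rV[R]_n * measurableTypeR R) : 'rV[R]_n.+1 :=
  \row_i (if unlift ord_max i is Some j then vx.1 ord0 j else vx.2).

Lemma measurable_rV_rcons n :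
  measurable_fun [set: 'rV[R]_n * measurableTypeR R] (@rV_rcons n).
Proof.
apply: measurable_fun_rVP => i; rewrite /rV_rcons.
case: (unliftP ord_max i) => [j|] ij.
  apply: (eq_measurable_fun (fun vx : 'rV[R]_n * measurableTypeR R =>
    vx.1 ord0 j : measurableTypeR R)).
    by move=> vx _; rewrite mxE ij liftK.
  by apply: (measurableT_comp (measurable_coord j)).
apply: (eq_measurable_fun snd) => //.
by move=> vx _; rewrite mxE ij unlift_none.
Qed.

(* The image of [mu \x lebesgue] under R^n * R ~ R^(n+1). *)
Definition lebesgue_rV_step n (mu : {measure set 'rV[R]_n -> \bar R}) :
    set 'rV[R]_n.+1 -> \bar R :=
  pushforward (mu \x (@lebesgue_measure R))%E (@rV_rcons n).

HB.instance Definition _ n mu := Measure.copy (@lebesgue_rV_step n mu)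
  (measure_function_pushforward__canonical__measure_function_Measure
    (mu \x (@lebesgue_measure R))%E (@measurable_rV_rcons n)).

Fixpoint lebesgue_rV (n : nat) : {measure set 'rV[R]_n -> \bar R} :=
  match n with
  | 0 => dirac (0 : 'rV[R]_0)
  | k.+1 => lebesgue_rV_step (lebesgue_rV k)
  end.
End lebesgue_rV.

(* Inner products are linear in the first variable. *)
HB.mixin Record Lmodule_hasDot (R : realType) H & GRing.Lmodule R[i] H := {
  hdot : {dot H for (@conjc R)}
}.

#[short(type="preHilbertType")]
HB.structure Definition PreHilbert (R : realType) :=
  { H of GRing.Lmodule R[i] H & Lmodule_hasDot R H }.

Definition hnorm (R : realType) (H : preHilbertType R) (u : H) : R :=
  Num.sqrt (complex.Re (hdot u u)).

HB.mixin Record PreHilbert_isComplete (R : realType) H & PreHilbert R H := {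
  hilbert_complete : forall u : nat -> H,
    (forall e : R, 0 < e -> exists N, forall i j, (N <= i)%N -> (N <= j)%N ->
       hnorm (u i - u j) < e) ->
    exists l : H, forall e : R, 0 < e -> exists N, forall i, (N <= i)%N ->
       hnorm (u i - l) < e
}.

#[short(type="hilbertType")]
HB.structure Definition Hilbert (R : realType) :=
  { H of PreHilbert R H & PreHilbert_isComplete R H }.

Section operators.
Context (R : realType) (H : preHilbertType R).
Implicit Types (T S : H -> H) (A : set (H -> H)).

Definition bounded_op T : Prop :=
  linear T /\ exists c : R, forall u, hnorm (T u) <= c * hnorm u.

Definition is_adjoint T S : Prop := forall u v, hdot (T u) v = hdot u (S v).

Definition opnorm T : \bar R :=
  ereal_sup [set (hnorm (T u))%:E | u in [set u | hnorm u <= 1]].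

(* Norm-closed *-subalgebras of B(H). The adjoint is relational: a bounded
   operator has at most one adjoint, and exactly one when H is complete. *)
Record cstar_subalgebra A : Prop := {
  cstar_bounded : forall T, A T -> bounded_op T;
  cstar0 : A 0;
  cstarD : forall T S, A T -> A S -> A (T + S);
  cstarZ : forall (c : R[i]) T, A T -> A (c *: T);
  cstarM : forall T S, A T -> A S -> A (T \o S);
  cstar_adjoint : forall T S, A T -> is_adjoint T S -> A S;
  cstar_closed : forall T, bounded_op T ->
    (forall e : R, 0 < e -> exists2 S, A S & (opnorm (T - S)%R <= e%:E)%E) -> A T
}.

Definition cstar_gen (X : set (H -> H)) : set (H -> H) :=
  smallest cstar_subalgebra X.
End operators.

HB.mixin Record Algebra_hasStar (R : realType) A & GRing.Algebra R[i] A := {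
  star : A -> A;
  starK : involutive star;
  starD : {morph star : a b / a + b};
  starZ : forall (c : R[i]) a, star (c *: a) = c^* *: star a;
  starM : forall a b, star (a * b) = star b * star a
}.

#[short(type="starAlgType")]
HB.structure Definition StarAlg (R : realType) :=
  { A of GRing.Algebra R[i] A & Algebra_hasStar R A }.

Record star_action (R : realType) (G : zmodType) (A : starAlgType R) := StarAction {
  star_act :> G -> {lrmorphism A -> A};
  star_act_star : forall s a, star_act s (star a) = star (star_act s a);
  star_act0 : forall a, star_act 0 a = a;
  star_actD : forall s t a, star_act (s + t) a = star_act s (star_act t a)
}.

Section crossed_product.
Context (R : realType) (G : zmodType) (A : starAlgType R) (alpha : star_action G A).

(* Nondegenerate covariant representations (pi, U), U unitary, of the discrete
   group G acting on the unital algebra A, on arbitrary Hilbert spaces. No norm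
   on A is needed: *-representations of a C*-algebra are contractive. *)
Record covariant_rep := CovariantRep {
  cr_space : hilbertType R;
  cr_pi : A -> cr_space -> cr_space;
  cr_pi_bounded : forall a, bounded_op (cr_pi a);
  cr_pi_linear : linear cr_pi;
  cr_pi1 : cr_pi 1 = id;
  cr_piM : forall a b, cr_pi (a * b) = cr_pi a \o cr_pi b;
  cr_pi_star : forall a, is_adjoint (cr_pi a) (cr_pi (star a));
  cr_U : G -> cr_space -> cr_space;
  cr_U_linear : forall s, linear (cr_U s);
  cr_U_unitary : forall s u v, hdot (cr_U s u) (cr_U s v) = hdot u v;
  cr_U0 : cr_U 0 = id;
  cr_UD : forall s t, cr_U (s + t) = cr_U s \o cr_U t;
  cr_covariant : forall s a, cr_U s \o cr_pi a = cr_pi (alpha s a) \o cr_U s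
}.

Definition op_family := forall rho : covariant_rep, cr_space rho -> cr_space rho.

(* A finitely supported f : G -> A is sent to the family of all its integrated
   forms (pi x| U)(f) = \sum_s pi (f s) U_s; the convolution product and the
   involution of C_c(G, A) become composition and adjoint of operators. *)
Definition universal_rep (f : {fsfun G -> A with 0}) : op_family :=
  fun rho u => \sum_(s <- finsupp f) cr_pi (f s) (cr_U s u).
Arguments universal_rep f rho u : clear implicits.

Definition universal_norm (x : op_family) : \bar R :=
  ereal_sup [set r | exists rho, r = opnorm (x rho)].

(* The full crossed product: [universal_norm (universal_rep f)] is the universal
   norm of f, the supremum of |(pi x| U)(f)| over all covariant representations.
   The completion of C_c(G, A) for this norm is realized as the closure of its
   image in the C*-algebra of uniformly bounded families of operators indexed by
   the covariant representations, with componentwise operations. The index type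
   is a large type, hence predicates instead of [set]. *)
Definition crossed_product (x : op_family) : Prop :=
  (forall rho, bounded_op (x rho)) /\
  forall e : R, 0 < e -> exists f : {fsfun G -> A with 0},
    (universal_norm (fun rho => (x rho - universal_rep f rho)%R) <= e%:E)%E.

(* A bijective *-homomorphism from the crossed product onto B. *)
Definition star_isomorphic_crossed_product (H : preHilbertType R)
    (B : set (H -> H)) : Prop :=
  exists Phi : op_family -> (H -> H),
    [/\ (forall x, crossed_product x -> B (Phi x)),
        (forall x y, crossed_product x -> crossed_product y ->
           Phi x = Phi y -> x = y) &
        (forall T, B T -> exists2 x, crossed_product x & Phi x = T)] /\
    [/\ (forall x y, crossed_product x -> crossed_product y ->
           Phi (fun rho => x rho + y rho) = Phi x + Phi y),
        (forall (c : R[i]) x, crossed_product x ->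
           Phi (fun rho => c *: x rho) = c *: Phi x),
        (forall x y, crossed_product x -> crossed_product y ->
           Phi (fun rho => x rho \o y rho) = Phi x \o Phi y) &
        (forall x y, crossed_product x -> crossed_product y ->
           (forall rho, is_adjoint (x rho) (y rho)) ->
           is_adjoint (Phi x) (Phi y))].
End crossed_product.

Section L2.
Context d (T : measurableType d) (R : realType) (mu : {measure set T -> \bar R}).

Definition L2pred : {pred T -> R[i]} := [pred f |
  ((fun x => complex.Re (f x)) \in Lfun mu 2%:E) &&
  ((fun x => complex.Im (f x)) \in Lfun mu 2%:E)].

Lemma L2pred_submod_closed : submod_closed L2pred.
Proof.
have [L0 LZD] : submod_closed (Lfun mu 2%:E) := Lfun_submod_closed mu (lee1n 2).
have lD f g : f \in Lfun mu 2%:E -> g \in Lfun mu 2%:E -> f + g \in Lfun mu 2%:E.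
  by move=> Lf Lg; rewrite -[f]scale1r; exact: LZD.
have lZ a f : f \in Lfun mu 2%:E -> a *: f \in Lfun mu 2%:E.
  by move=> Lf; rewrite -[_ *: _]addr0; exact: LZD.
split; first by apply/andP; split; exact: L0.
move=> [a b] f g /andP[Rf If] /andP[Rg Ig]; apply/andP; split.
- rewrite (_ : (fun _ => _) = a *: (fun x => complex.Re (f x)) +
    - b *: (fun x => complex.Im (f x)) + (fun x => complex.Re (g x))).
    by apply: (lD) => //; apply: lD; exact: lZ.
  apply/funext => x; rewrite !fctE/=.
  by case: (f x) (g x) => [? ?] [? ?]; rewrite /= /GRing.scale/= mulNr.
- rewrite (_ : (fun _ => _) = a *: (fun x => complex.Im (f x)) +
    b *: (fun x => complex.Re (f x)) + (fun x => complex.Im (g x))).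
    by apply: (lD) => //; apply: lD; exact: lZ.
  apply/funext => x; rewrite !fctE/=.
  by case: (f x) (g x) => [? ?] [? ?]; rewrite /= /GRing.scale/=.
Qed.

HB.instance Definition _ :=
  GRing.isSubmodClosed.Build _ _ L2pred L2pred_submod_closed.

Record L2fun := MkL2fun { L2fun_val :> T -> R[i]; _ : L2fun_val \in L2pred }.
HB.instance Definition _ := [isSub for L2fun_val].
HB.instance Definition _ := [Choice of L2fun by <:].
HB.instance Definition _ := [SubChoice_isSubLmodule of L2fun by <:].

Definition ae_zero : {pred L2fun} :=
  [pred f : L2fun | `[< {ae mu, forall x, f x = 0} >]].

Lemma ae_zero_zmod_closed : zmod_closed ae_zero.
Proof.
split; first by apply/asboolP; apply: aeW.
move=> f g /asboolP f0 /asboolP g0; apply/asboolP.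
by apply: filterS2 f0 g0 => x fx gx; rewrite (_ : (f - g) x = f x - g x)// fx gx subr0.
Qed.
HB.instance Definition _ := GRing.isZmodClosed.Build _ ae_zero ae_zero_zmod_closed.

Definition L2 : Type := Quotient.quot ae_zero.

HB.instance Definition _ := EqQuotient.copy L2 (Quotient.quot ae_zero).
HB.instance Definition _ := GRing.Zmodule.copy L2 (Quotient.quot ae_zero).

Local Open Scope quotient_scope.

Lemma L2_eqP (f g : L2fun) :
  reflect ({ae mu, forall x, f x = g x}) (f == g %[mod L2]).
Proof.
rewrite -Quotient.idealrBE.
apply: (iffP (asboolP _)); apply: filterS => x.
  by rewrite (_ : (f - g) x = f x - g x)// => /subr0_eq.
by rewrite (_ : (f - g) x = f x - g x)// => ->; rewrite subrr.
Qed.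

Lemma L2_repr (f : L2fun) : {ae mu, forall x, f x = repr (\pi_L2 f) x}.
Proof. by apply/L2_eqP; rewrite reprK. Qed.

Lemma L2_piD (f g : L2fun) : \pi_L2 (f + g) = \pi_L2 f + \pi_L2 g.
Proof. by rewrite !piE. Qed.

Definition L2_scale (c : R[i]) (u : L2) : L2 := \pi_L2 (c *: repr u).

Lemma L2_piZ c (f : L2fun) : \pi_L2 (c *: f) = L2_scale c (\pi_L2 f).
Proof.
apply/eqP/L2_eqP; apply: filterS (L2_repr f) => x fx.
by rewrite [LHS](_ : _ = c * f x)// fx.
Qed.

Lemma L2_scaleA a b u : L2_scale a (L2_scale b u) = L2_scale (a * b) u.
Proof. by elim/quotW: u => f; rewrite -(L2_piZ b) -!L2_piZ scalerA. Qed.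
Lemma L2_scale1 : left_id 1 L2_scale.
Proof. by elim/quotW => f; rewrite -L2_piZ scale1r. Qed.
Lemma L2_scaleDr : right_distributive L2_scale +%R.
Proof.
move=> a; elim/quotW => f; elim/quotW => g.
by rewrite -L2_piD -!L2_piZ scalerDr L2_piD.
Qed.
Lemma L2_scaleDl u : {morph L2_scale^~ u : a b / a + b}.
Proof. by move=> a b; elim/quotW: u => f; rewrite -!L2_piZ scalerDl L2_piD. Qed.

HB.instance Definition _ := GRing.Zmodule_isLmodule.Build R[i] L2
  L2_scaleA L2_scale1 L2_scaleDr L2_scaleDl.

Definition cip (f g : T -> R[i]) : R[i] :=
  (\int[mu]_x complex.Re (f x * (g x)^*)) +i*
  (\int[mu]_x complex.Im (f x * (g x)^*)).

Lemma cip_integrable (f g : L2fun) :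
  mu.-integrable [set: T] (EFin \o fun x => complex.Re (f x * (g x)^*)) /\
  mu.-integrable [set: T] (EFin \o fun x => complex.Im (f x * (g x)^*)).
Proof.
have /andP[Rf If] := valP f; have /andP[Rg Ig] := valP g.
have M (a b : T -> R) : a \in Lfun mu 2%:E -> b \in Lfun mu 2%:E ->
  mu.-integrable [set: T] (EFin \o (a \* b)).
  by move=> La Lb; apply/Lfun1_integrable; exact: Lfun2_mul_Lfun1.
split.
  have := integrableD measurableT (M _ _ Rf Rg) (M _ _ If Ig).
  apply: eq_integrable => // x _; rewrite /= -EFinD; congr EFin.
  by case: (f x) (g x) => [a b] [a' b'] /=; rewrite mulrN opprK.
have := integrableB measurableT (M _ _ If Rg) (M _ _ Rf Ig).
apply: eq_integrable => // x _; rewrite /= -EFinB; congr EFin.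
by case: (f x) (g x) => [a b] [a' b'] /=; rewrite mulrN addrC.
Qed.

Lemma cip_ae (f f' g g' : L2fun) :
  {ae mu, forall x, f x = f' x} -> {ae mu, forall x, g x = g' x} ->
  cip f g = cip f' g'.
Proof.
move=> ff' gg'.
have [/integrableP[m1 _] /integrableP[m2 _]] := cip_integrable f g.
have [/integrableP[m1' _] /integrableP[m2' _]] := cip_integrable f' g'.
rewrite /cip /Rintegral; congr (fine _ +i* fine _);
  apply: ae_eq_integral => //;
  by apply: filterS2 ff' gg' => x fx gx _; rewrite /= fx gx.
Qed.

Lemma cip_linear (g : L2fun) a (f f' : L2fun) :
  cip (a *: f + f') g = a * cip f g + cip f' g.
Proof.
have [i1 i2] := cip_integrable f g; have [i1' i2'] := cip_integrable f' g.
case: a => p q; rewrite /cip.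
have iZ c (h : T -> R) : mu.-integrable [set: T] (EFin \o h) ->
    mu.-integrable [set: T] (EFin \o (fun x => c * h x)).
  by move=> ih; exact: (integrableZl measurableT c ih).
have iD (h k : T -> R) : mu.-integrable [set: T] (EFin \o h) ->
    mu.-integrable [set: T] (EFin \o k) ->
    mu.-integrable [set: T] (EFin \o (fun x => h x + k x)).
  by move=> ih ik; exact: (integrableD measurableT ih ik).
rewrite [LHS](_ : _ =
  (\int[mu]_x (p * complex.Re (f x * (g x)^*) + - q * complex.Im (f x * (g x)^*)
              + complex.Re (f' x * (g x)^*))) +i*
  (\int[mu]_x (p * complex.Im (f x * (g x)^*) + q * complex.Re (f x * (g x)^*)
              + complex.Im (f' x * (g x)^*)))).
  rewrite !RintegralD ?RintegralZl//; do ?[exact: iZ | exact: iD].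
  - by congr (_ +i* _) => /=; ring.
  - by apply: (iD); exact: iZ.
  - by apply: (iD); exact: iZ.
congr (_ +i* _); apply: eq_Rintegral => x _;
  rewrite (_ : ((p +i* q) *: f + f') x = (p +i* q) * f x + f' x)//;
  by case: (f x) (f' x) (g x) => [? ?] [? ?] [? ?] /=; ring.
Qed.

Lemma cipC (f g : L2fun) : cip f g = (cip g f)^*.
Proof.
have [i1 i2] := cip_integrable g f.
rewrite /cip /= -[- _]mulN1r -RintegralZl//; congr (_ +i* _);
  apply: eq_Rintegral => x _; case: (f x) (g x) => [? ?] [? ?] /=; ring.
Qed.

Lemma cip_gt0 (f : L2fun) : f \notin ae_zero -> 0 < cip f f.
Proof.
move=> f0.
have E x : f x * (f x)^* = (complex.Re (f x) ^+ 2 + complex.Im (f x) ^+ 2)%:C.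
  by case: (f x) => a b /=; simpc; rewrite !expr2 [b * a]mulrC addNr.
have [iRe _] := cip_integrable f f.
rewrite /cip (@eq_Rintegral _ _ _ _ _ (fun=> 0) (fun x => complex.Im (f x * (f x)^*))); last by move=> x _; rewrite E.
rewrite (_ : \int[mu]_x 0 = 0); last by rewrite /Rintegral integral0.
have ge0 x : (0 <= complex.Re (f x * (f x)^*)).
  by rewrite E/= addr_ge0 ?sqr_ge0.
rewrite ltcE/= eqxx/= lt_neqAle Rintegral_ge0// andbT; apply: contra f0 => /eqP I0.
apply/asboolP.
have /integrableP[mRe _] := iRe.
have : ae_eq mu setT (EFin \o fun x => complex.Re (f x * (f x)^*)) (cst 0%E).
  apply: (ae_eq_integral_abs mu measurableT mRe).1.
  transitivity (\int[mu]_x (complex.Re (f x * (f x)^*))%:E)%E.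
    by apply: eq_integral => x _ /=; rewrite ger0_norm.
  have fin := integrable_fin_num measurableT iRe.
  by rewrite -[LHS](fineK fin) -[fine _]/(Rintegral mu setT _) -I0.
apply: filterS => x /(_ I) /= []; rewrite E/= => /eqP.
rewrite paddr_eq0 ?sqr_ge0// !sqrf_eq0 => /andP[/eqP R0 /eqP J0].
by apply/eqP; rewrite eq_complex R0 J0 !eqxx.
Qed.

Definition L2_dot (u v : L2) : R[i] := cip (repr u) (repr v).

Lemma L2_dot_pi (f g : L2fun) : L2_dot (\pi_L2 f) (\pi_L2 g) = cip f g.
Proof.
apply: cip_ae; first by apply: filterS (L2_repr f) => x ->.
by apply: filterS (L2_repr g) => x ->.
Qed.

Let L2_dot_linear v a u u' : L2_dot (a *: u + u') v = a * L2_dot u v + L2_dot u' v.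
Proof.
elim/quotW: u => f; elim/quotW: u' => f'; elim/quotW: v => g.
rewrite -[a *: _]/(L2_scale a _) -L2_piZ -L2_piD !L2_dot_pi.
exact: cip_linear.
Qed.

Let L2_dotC u v : L2_dot u v = (L2_dot v u)^*.
Proof. exact: cipC. Qed.

Let L2_dot_bilinear :
  bilinear_for *%R ((@conjc R) \; *%R : GRing.Scale.law _ _) L2_dot.
Proof.
split=> [v|u] a x y; first exact: L2_dot_linear.
by rewrite [LHS]L2_dotC L2_dot_linear (L2_dotC u x) (L2_dotC u y) rmorphD rmorphM.
Qed.
HB.instance Definition _ :=
  @bilinear_isBilinear.Build _ _ _ _ _ _ L2_dot L2_dot_bilinear.

Let L2_dot_hermitian u v : L2_dot u v = (-1) ^+ false * (L2_dot v u)^*.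
Proof. by rewrite expr0 mul1r; exact: L2_dotC. Qed.
HB.instance Definition _ :=
  @isHermitianSesquilinear.Build _ _ _ _ L2_dot L2_dot_hermitian.

Let L2_dot_gt0 u : u != 0 -> 0 < L2_dot u u.
Proof.
elim/quotW: u => f f0; rewrite L2_dot_pi; apply: cip_gt0.
apply: contra f0 => /asboolP f0.
have -> : (0 : L2) = \pi_L2 (0 : L2fun) by rewrite piE.
by apply/L2_eqP; apply: filterS f0 => x ->.
Qed.
HB.instance Definition _ := @isDotProduct.Build _ _ L2_dot L2_dot_gt0.

HB.instance Definition _ := @Lmodule_hasDot.Build R L2 (L2_dot : {dot L2 for (@conjc R)}).

(* The class of f, and 0 (never met below) if f is not square-integrable. *)
Definition L2_class (f : T -> R[i]) : L2 := \pi_L2 (insubd (0 : L2fun) f).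
Definition L2_rep (u : L2) : T -> R[i] := repr u.
End L2.


Section L2_operators.
Context (R : realType) (n : nat).
Implicit Types mu nu : {measure set 'rV[R]_n -> \bar R}.

Definition multiplication mu nu (w : 'rV[R]_n -> R[i]) (u : L2 mu) : L2 nu :=
  L2_class nu (fun p => w p * L2_rep u p).

Definition translation mu (a : 'rV[R]_n) (u : L2 mu) : L2 mu :=
  L2_class mu (fun p => L2_rep u (p - a)).
End L2_operators.
Arguments multiplication {R n} mu nu w u.
Arguments translation {R n} mu a u.

Section relativistic.
Context (R : realType) (n : nat) (m : R).

Definition energy (p : 'rV[R]_n) : R :=
  Num.sqrt (\sum_(i < n) p ord0 i ^+ 2 + m ^+ 2).

Lemma measurable_inv_energy :
  measurable_fun [set: 'rV[R]_n] (fun p => (energy p)^-1).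
Proof.
have minv : measurable_fun [set: R] (fun x : R => x^-1).
  rewrite -(setvU [set (0 : R)]); apply/measurable_funU => //.
    exact: measurableC.
  split; last exact: measurable_fun_set1.
  apply: open_continuous_measurable_fun.
    by rewrite openC; exact: (accessible_closed_set1 (hausdorff_accessible (@Rhausdorff R))).
  by move=> x /set_mem/eqP x0; exact: inv_continuous.
apply: (measurableT_comp minv).
apply: (measurableT_comp (continuous_measurable_fun (@sqrt_continuous R))).
apply: measurable_funD => //; apply: measurable_sum => i.
apply: measurable_funX; exact: measurable_coord.
Qed.

Definition relativistic_measure (A : set 'rV[R]_n) : \bar R :=
  (\int[lebesgue_rV R n]_(p in A) (energy p)^-1%:E)%E.

Let relativistic0 : relativistic_measure set0 = 0%E.
Proof. by rewrite /relativistic_measure integral_set0. Qed.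

Let relativistic_ge0 A : (0 <= relativistic_measure A)%E.
Proof.
by apply: integral_ge0 => p _; rewrite lee_fin invr_ge0; exact: sqrtr_ge0.
Qed.

Let relativistic_sigma_additive : semi_sigma_additive relativistic_measure.
Proof.
apply: semi_sigma_additive_nng_induced.
  by apply/measurable_EFinP; exact: measurable_inv_energy.
by move=> p; rewrite lee_fin invr_ge0; exact: sqrtr_ge0.
Qed.

HB.instance Definition _ := isMeasure.Build _ _ _ relativistic_measure
  relativistic0 relativistic_ge0 relativistic_sigma_additive.

Definition dp_over_E : {measure set 'rV[R]_n -> \bar R} := relativistic_measure.

Definition M_sqrtE : L2 (lebesgue_rV R n) -> L2 dp_over_E :=
  multiplication (lebesgue_rV R n) dp_over_E (fun p => (Num.sqrt (energy p))%:C).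

(* The inverse of the unitary M_sqrtE is multiplication by 1 / sqrt E. *)
Definition M_sqrtE_inv : L2 dp_over_E -> L2 (lebesgue_rV R n) :=
  multiplication dp_over_E (lebesgue_rV R n) (fun p => (Num.sqrt (energy p))^-1%:C).

Definition conj_translation (a : 'rV[R]_n) :
    L2 (lebesgue_rV R n) -> L2 (lebesgue_rV R n) :=
  M_sqrtE_inv \o translation dp_over_E a \o M_sqrtE.
End relativistic.

Section C0.
Context (R : realType) (X : topologicalType).
Implicit Types f g : X -> R[i].

Definition vanishes_at_infinity f : Prop :=
  forall e : R, 0 < e -> exists2 K : set X, compact K &
    forall x, ~ K x -> `|f x| < e%:C.

Definition C0_set : set (X -> R[i]) := [set f |
  continuous (f : X -> (R[i] : numFieldType)) /\ vanishes_at_infinity f].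

Definition C0pred : {pred X -> R[i]} := mem C0_set.

Let vanishesP f : vanishes_at_infinity f <->
  forall e : R[i], 0 < e -> exists2 K : set X, compact K &
    forall x, ~ K x -> `|f x| < e.
Proof.
split=> vf e e0; last by apply: vf; rewrite ltcR.
have eE : (complex.Re e)%:C = e by rewrite RRe_real// gtr0_real.
by rewrite -eE; apply: vf; rewrite -ltcR eE.
Qed.

Lemma C0_mul_closed f g : C0_set f -> C0_set g -> C0_set (f \* g).
Proof.
move=> [cf vf] [cg vg]; split; first by move=> x; apply: cvgM; [exact: cf|exact: cg].
apply/vanishesP => e e0; have [K cK Kf] := (vanishesP f).1 vf _ e0.
have [L cL Lg] := (vanishesP g).1 vg _ ltr01.
exists (K `|` L); first exact: compactU.
move=> x /not_orP[/Kf fx /Lg gx]; rewrite /= normrM.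
by rewrite -[e]mulr1; apply: ltr_pM.
Qed.

Lemma C0_conj_closed f : C0_set f -> C0_set (fun x => (f x)^*).
Proof.
move=> [cf vf]; split.
  move=> x; apply/cvgrPdist_lt => /= e e0; near=> y.
  rewrite -rmorphB normcJ; near: y.
  by have /cvgrPdist_lt := cf x; apply.
move=> e /vf[K cK Kf]; exists K => // x /Kf.
by rewrite normcJ.
Unshelve. all: by end_near.
Qed.

Lemma C0_submod_closed : submod_closed C0pred.
Proof.
split.
  apply/mem_set; split; first by move=> x; exact: cvg_cst.
  move=> e e0; exists set0; first exact: compact0.
  by move=> x _; rewrite (_ : (0 : X -> R[i]) x = 0)// normr0 ltcR.
move=> a f g /set_mem[cf vf] /set_mem[cg vg]; apply/mem_set; split.
  move=> x; apply: cvgD; last exact: cg.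
  by apply: cvgM; [exact: cvg_cst|exact: cf].
apply/vanishesP => e e0.
have a0 : 0 < `|a| + 1 by rewrite ltr_wpDl.
have [K cK Kf] := (vanishesP f).1 vf (e / 2 / (`|a| + 1)) ltac:(by rewrite !divr_gt0).
have [L cL Lg] := (vanishesP g).1 vg (e / 2) ltac:(by rewrite divr_gt0).
exists (K `|` L); first exact: compactU.
move=> x /not_orP[/Kf fx /Lg gx].
rewrite (_ : (a *: f + g) x = a * f x + g x)//.
apply: (le_lt_trans (ler_normD _ _)); rewrite normrM [ltRHS]splitr.
apply: ler_ltD => //.
move: fx; rewrite ltr_pdivlMr// => /ltW; apply: le_trans.
by rewrite mulrC ler_wpM2l// lerDl.
Qed.
HB.instance Definition _ :=
  GRing.isSubmodClosed.Build _ _ C0pred C0_submod_closed.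

Record C0 := MkC0 { C0_val :> X -> R[i]; C0_valP : C0_val \in C0pred }.
HB.instance Definition _ := [isSub for C0_val].
HB.instance Definition _ := [Choice of C0 by <:].
HB.instance Definition _ := [SubChoice_isSubLmodule of C0 by <:].

Lemma C0_eqP (f g : C0) : (forall x, f x = g x) -> f = g.
Proof. by move=> fg; apply/val_inj/funext. Qed.

Definition C0_mul (f g : C0) : C0 :=
  MkC0 (mem_set (C0_mul_closed (set_mem (C0_valP f)) (set_mem (C0_valP g)))).

Definition C0_conj (f : C0) : C0 :=
  MkC0 (mem_set (C0_conj_closed (set_mem (C0_valP f)))).

(* The element [(f, c)] is [f + c 1], where 1 is the adjoined unit. *)
Definition C0plus : Type := (C0 * R[i])%type.
HB.instance Definition _ := GRing.Lmodule.copy C0plus (C0 * R[i])%type.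

Definition C0plus_one : C0plus := (0, 1).
Definition C0plus_mul (a b : C0plus) : C0plus :=
  (C0_mul a.1 b.1 + a.2 *: b.1 + b.2 *: a.1, a.2 * b.2).

Let eqC0plus (a b : C0plus) : (forall x, a.1 x = b.1 x) -> a.2 = b.2 -> a = b.
Proof. by case: a b => [f c] [g c'] /= /C0_eqP-> ->. Qed.

Let C0plus_mulE a b x : (C0plus_mul a b).1 x =
  a.1 x * b.1 x + a.2 * b.1 x + b.2 * a.1 x.
Proof. by []. Qed.

Let C0plus_mulA : associative C0plus_mul.
Proof.
move=> a b c; apply: eqC0plus => [x|/=]; last by rewrite mulrA.
by rewrite !C0plus_mulE/=; ring.
Qed.
Let C0plus_mul1 : left_id C0plus_one C0plus_mul.
Proof.
move=> a; apply: eqC0plus => [x|/=]; last by rewrite mul1r.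
by rewrite C0plus_mulE (_ : C0plus_one.1 x = 0)// (_ : C0plus_one.2 = 1)//; ring.
Qed.
Let C0plus_1mul : right_id C0plus_one C0plus_mul.
Proof.
move=> a; apply: eqC0plus => [x|/=]; last by rewrite mulr1.
by rewrite C0plus_mulE (_ : C0plus_one.1 x = 0)// (_ : C0plus_one.2 = 1)//; ring.
Qed.
Let C0plus_mulDl : left_distributive C0plus_mul +%R.
Proof.
move=> a b c; apply: eqC0plus => [x|/=]; last by rewrite mulrDl.
rewrite [RHS](_ : _ = (C0plus_mul a c).1 x + (C0plus_mul b c).1 x)//.
by rewrite !C0plus_mulE (_ : (a + b).1 x = a.1 x + b.1 x)//=; ring.
Qed.
Let C0plus_mulDr : right_distributive C0plus_mul +%R.
Proof.
move=> a b c; apply: eqC0plus => [x|/=]; last by rewrite mulrDr.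
rewrite [RHS](_ : _ = (C0plus_mul a b).1 x + (C0plus_mul a c).1 x)//.
by rewrite !C0plus_mulE (_ : (b + c).1 x = b.1 x + c.1 x)//=; ring.
Qed.
Let C0plus_one_neq0 : C0plus_one != 0.
Proof. by apply/eqP => -[/eqP]; rewrite oner_eq0. Qed.
HB.instance Definition _ := GRing.Zmodule_isNzRing.Build C0plus
  C0plus_mulA C0plus_mul1 C0plus_1mul C0plus_mulDl C0plus_mulDr C0plus_one_neq0.

Let C0plus_scaleAl (c : R[i]) (a b : C0plus) : c *: (a * b) = (c *: a) * b.
Proof.
apply: eqC0plus => [x|/=]; last by rewrite [LHS](_ : _ = c * (a.2 * b.2))// mulrA.
rewrite [LHS](_ : _ = c * (C0plus_mul a b).1 x)//.
rewrite [RHS](_ : _ = (C0plus_mul (c *: a) b).1 x)// !C0plus_mulE.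
rewrite (_ : (c *: a).1 x = c * a.1 x)// (_ : (c *: a).2 = c * a.2)//.
by ring.
Qed.
HB.instance Definition _ :=
  GRing.Lmodule_isLalgebra.Build R[i] C0plus C0plus_scaleAl.

Let C0plus_scaleAr (c : R[i]) (a b : C0plus) : c *: (a * b) = a * (c *: b).
Proof.
apply: eqC0plus => [x|/=]; last by rewrite [LHS](_ : _ = c * (a.2 * b.2))// mulrCA.
rewrite [LHS](_ : _ = c * (C0plus_mul a b).1 x)//.
rewrite [RHS](_ : _ = (C0plus_mul a (c *: b)).1 x)// !C0plus_mulE.
rewrite (_ : (c *: b).1 x = c * b.1 x)// (_ : (c *: b).2 = c * b.2)//.
by ring.
Qed.
HB.instance Definition _ :=
  GRing.Lalgebra_isAlgebra.Build R[i] C0plus C0plus_scaleAr.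

Definition C0plus_star (a : C0plus) : C0plus := (C0_conj a.1, (a.2)^*).

Let C0plus_starK : involutive C0plus_star.
Proof. by move=> a; apply: eqC0plus => [x|]; rewrite /= conjcK. Qed.
Let C0plus_starD : {morph C0plus_star : a b / a + b}.
Proof. by move=> a b; apply: eqC0plus => [x|]; rewrite /= rmorphD. Qed.
Let C0plus_starZ (c : R[i]) a : C0plus_star (c *: a) = c^* *: C0plus_star a.
Proof. by apply: eqC0plus => [x|]; rewrite /= rmorphM. Qed.
Let C0plus_starM (a b : C0plus) :
  C0plus_star (a * b) = C0plus_star b * C0plus_star a.
Proof.
apply: eqC0plus => [x|]; last by rewrite /= rmorphM mulrC.
rewrite [LHS](_ : _ = ((C0plus_mul a b).1 x)^*)// C0plus_mulE.
rewrite [RHS](_ : _ = (C0plus_mul (C0plus_star b) (C0plus_star a)).1 x)//.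
by rewrite C0plus_mulE !rmorphD !rmorphM /=; ring.
Qed.
HB.instance Definition _ := @Algebra_hasStar.Build R C0plus C0plus_star
  C0plus_starK C0plus_starD C0plus_starZ C0plus_starM.
End C0.

Section translation_action.
Context (R : realType) (n : nat).
Local Notation A := (C0plus R 'rV[R]_n).
Implicit Types (s t : 'rV[R]_n).

Lemma C0_shift_closed s (f : 'rV[R]_n -> R[i]) :
  C0_set f -> C0_set (fun p : 'rV[R]_n => f (p - s)).
Proof.
move=> [cf vf].
have cD (t : 'rV[R]_n) : continuous (fun p : 'rV[R]_n => p + t).
  by move=> p; apply: (@continuousD R 'rV[R]_n 'rV[R]_n id (cst t)); [exact: cvg_id|exact: cst_continuous].
split=> [p|e /vf[K cK Kf]].
  exact: (cvg_comp _ _ (cD (- s) p) (cf (p - s))).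
exists ((fun p : 'rV[R]_n => p + s) @` K).
  by apply: continuous_compact => //; apply: continuous_subspaceT; exact: cD.
by move=> p Kp; apply: Kf => Kps; apply: Kp; exists (p - s) => //; rewrite subrK.
Qed.

Definition C0_shift s (f : C0 R 'rV[R]_n) : C0 R 'rV[R]_n :=
  MkC0 (mem_set (C0_shift_closed s (set_mem (C0_valP f)))).

(* Translations act trivially on the adjoined unit. *)
Definition C0plus_shift s (a : A) : A := (C0_shift s a.1, a.2).

Let eqA (a b : A) : (forall x, a.1 x = b.1 x) -> a.2 = b.2 -> a = b.
Proof. by case: a b => [f c] [g c'] /= /C0_eqP-> ->. Qed.

Let shift_linear s : linear (C0plus_shift s).
Proof. by move=> c a b; apply: eqA. Qed.
Let shift_monoid s : monoid_morphism (C0plus_shift s).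
Proof. by split=> [|a b]; apply: eqA. Qed.
HB.instance Definition _ s :=
  GRing.isLinear.Build R[i] A A *:%R (C0plus_shift s) (shift_linear s).
HB.instance Definition _ s :=
  GRing.isMonoidMorphism.Build A A (C0plus_shift s) (shift_monoid s).

Let shift_star s a : C0plus_shift s (star a) = star (C0plus_shift s a).
Proof. exact: eqA. Qed.
Let shift0 a : C0plus_shift 0 a = a.
Proof. by apply: eqA => //= x; rewrite subr0. Qed.
Let shiftD s t a : C0plus_shift (s + t) a = C0plus_shift s (C0plus_shift t a).
Proof. by apply: eqA => //= x; rewrite opprD addrA. Qed.

Definition translation_action : star_action 'rV[R]_n A :=
  @StarAction R _ A (fun s => C0plus_shift s : {lrmorphism A -> A})
    shift_star shift0 shiftD.
End translation_action.

(* Main.v *)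
(* The operator [conj_translation a] is multiplication by a weight w_a, with
   w_a(p)^2 = E(p - a) / E(p), after translation by a. Hence its product with its
   adjoint is multiplication by w_a^2, and the algebra also contains
   w_a^4 = (E(p)^2 - 2 p.a + |a|^2) / E(p)^2. Adding the cases a and -a gives
   1 / E(p)^2, so that w_q^4 - m^2 / E^2 = |p - q|^2 / E(p)^2 is a multiplier in
   the algebra which vanishes only at q. By Stone-Weierstrass the algebra contains
   C_0, in particular 1 / w_a - 1, and hence the translations.

   For the crossed product, evaluate families of operators at the covariant
   representation on L^2. It suffices that this representation is faithful, that
   is, |(pi x U)(f)| <= C for every covariant pair (pi, U) as soon as
   F = \sum_s f_s V_s satisfies |F| <= C on L^2. Testing F on indicators of small
   cubes shows that, at each point p, the matrix B with entries
   B_(a,t)(p) = f_(a - t)(p + a) has norm at most C. So C^2 - B^* B is positive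
   over the unitization and, by a Schur complement induction, stays positive
   under pi. Applied to the vectors U_(-t) u, for t in a Folner sequence
   of the finitely generated abelian group spanned by the support of f, this yields
   |(pi x U)(f) u|^2 <= C^2 |u|^2. *)

Require Import Defs.
From HB Require Import structures.
From mathcomp Require Import all_boot all_order all_algebra.
From mathcomp Require Import complex.
From mathcomp Require Import finmap ring lra.
From mathcomp Require Import all_classical all_reals all_analysis.
From mathcomp Require Import measurable_realfun.

Set Implicit Arguments.
Unset Strict Implicit.
Unset Printing Implicit Defensive.

Import Order.TTheory GRing.Theory Num.Theory.
Import numFieldNormedType.Exports.
Import Normc.
Local Open Scope classical_set_scope.
Local Open Scope ring_scope.
Local Open Scope complex_scope.

(** Domination by the L^2 representation serves twice. It makes evaluation at that representation
    injective on the crossed product, and it makes a sequence of integrated forms converging in norm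
    on L^2 uniformly Cauchy in every covariant representation, so that its limit lifts. The lift
    uses the completeness of all representation spaces; L^2 itself has to be shown complete
    (Riesz-Fischer) to be one of them. The unitization carries neither a norm nor an order here, so
    positivity is known only through values at points. The Schur induction suits this: it asks only
    for an inverse and a square root of each pivot. Both are Lipschitz functions of the values once
    these stay above some [e > 0], which is why [C ^+ 2 + e] stands for [C ^+ 2] until a final
    limit. Points see the adjoined scalar only as a limit at infinity, so the space must be
    noncompact. This is one use of [1 <= n]; the other is a division by n in producing 1 / E^2. Of
    amenability only one consequence enters: the sets of N-fold sums of the support grow
    polynomially in N, hence not geometrically. *)

Section normc.
Context (R : realType).
Implicit Types z w : R[i].

Lemma normc_ge0 z : 0 <= normc z.
Proof. by case: z => a b; exact: sqrtr_ge0. Qed.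

Lemma normc_sqr z : normc z ^+ 2 = complex.Re z ^+ 2 + complex.Im z ^+ 2.
Proof. by case: z => a b; rewrite /= sqr_sqrtr// addr_ge0 ?sqr_ge0. Qed.

Lemma Re_le_normc z : complex.Re z <= normc z.
Proof.
case: z => a b /=; apply: le_trans (ler_norm a) _.
by rewrite -sqrtr_sqr ler_sqrt ?addr_ge0 ?sqr_ge0// lerDl sqr_ge0.
Qed.

Lemma normc_conj z : normc z^* = normc z.
Proof. by case: z => a b /=; rewrite sqrrN. Qed.

Lemma normc_real (a : R) : normc a%:C = `|a|.
Proof. by rewrite /= expr0n addr0 sqrtr_sqr. Qed.
End normc.
#[export] Hint Resolve normc_ge0 : core.

Lemma ler_sqr_ge0 (R : realType) (x y : R) : 0 <= x -> 0 <= y ->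
  (x ^+ 2 <= y ^+ 2) = (x <= y).
Proof. by move=> x0 y0; apply: ler_pXn2r. Qed.

(** * Operators on inner product spaces *)

Section prehilbert.
Context (R : realType) (H : preHilbertType R).
Implicit Types (u v w : H) (c : R[i]) (T S : H -> H).

Lemma hdotDl u v w : hdot (u + v) w = hdot u w + hdot v w.
Proof. exact: linearDl. Qed.
Lemma hdotDr u v w : hdot w (u + v) = hdot w u + hdot w v.
Proof. exact: linearDr. Qed.
Lemma hdotZl c u w : hdot (c *: u) w = c * hdot u w.
Proof. exact: linearZl_LR. Qed.
Lemma hdotZr c u w : hdot w (c *: u) = c^* * hdot w u.
Proof. by rewrite linearZr_LR. Qed.
Lemma hdotC u v : hdot u v = (hdot v u)^*.
Proof. by rewrite (hermC hdot) expr0 mul1r. Qed.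
Lemma hdot0l u : hdot 0 u = 0. Proof. exact: linear0l. Qed.
Lemma hdot0r u : hdot u 0 = 0. Proof. exact: linear0r. Qed.
Lemma hdotNl u v : hdot (- u) v = - hdot u v. Proof. exact: linearNl. Qed.
Lemma hdotNr u v : hdot u (- v) = - hdot u v. Proof. exact: linearNr. Qed.
Lemma hdotBl u v w : hdot (u - v) w = hdot u w - hdot v w.
Proof. by rewrite hdotDl hdotNl. Qed.
Lemma hdotBr u v w : hdot w (u - v) = hdot w u - hdot w v.
Proof. by rewrite hdotDr hdotNr. Qed.
Lemma hdot_suml I (r : seq I) (P : pred I) (F : I -> H) v :
  hdot (\sum_(i <- r | P i) F i) v = \sum_(i <- r | P i) hdot (F i) v.
Proof. by rewrite (big_morph (hdot^~ v) (fun x y => hdotDl x y v) (hdot0l v)). Qed.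
Lemma hdot_sumr I (r : seq I) (P : pred I) (F : I -> H) v :
  hdot v (\sum_(i <- r | P i) F i) = \sum_(i <- r | P i) hdot v (F i).
Proof. by rewrite (big_morph (hdot v) (fun x y => hdotDr x y v) (hdot0r v)). Qed.

Lemma hdot_ge0 u : 0 <= hdot u u.
Proof.
have [->|u0] := eqVneq u 0; first by rewrite hdot0l.
exact/ltW/neq0_dnorm_gt0.
Qed.

Lemma hdotE u : hdot u u = (hnorm u ^+ 2)%:C.
Proof.
have := hdot_ge0 u; rewrite lecE => /andP[/eqP /= I0 R0].
by rewrite sqr_sqrtr//; case: (hdot u u) I0 R0 => a b /= ->.
Qed.

Lemma hnorm_sqr u : hnorm u ^+ 2 = complex.Re (hdot u u).
Proof. by rewrite hdotE. Qed.

Lemma hnorm_ge0 u : 0 <= hnorm u. Proof. exact: sqrtr_ge0. Qed.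
Hint Resolve hnorm_ge0 : core.

Lemma hnorm0 : hnorm (0 : H) = 0.
Proof. by rewrite /hnorm hdot0l sqrtr0. Qed.

Lemma hnorm0_eq0 u : hnorm u = 0 -> u = 0.
Proof.
move=> u0; apply/eqP; apply/negPn/negP => /neq0_dnorm_gt0.
by move=> /(_ _ hdot); rewrite hdotE u0 expr0n/= ltxx.
Qed.

Lemma hnormZ c u : hnorm (c *: u) = normc c * hnorm u.
Proof.
apply: (pexpIrn (n := 2)) => //=; rewrite ?nnegrE ?mulr_ge0 ?normc_ge0//.
rewrite exprMn normc_sqr hnorm_sqr hdotZl hdotZr hdotE.
by case: c => a b /=; ring.
Qed.

Lemma hnormZR (a : R) u : hnorm (a%:C *: u) = `|a| * hnorm u.
Proof. by rewrite hnormZ /= expr0n addr0 sqrtr_sqr. Qed.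

Lemma hnorm_opp u : hnorm (- u) = hnorm u.
Proof. by rewrite /hnorm hdotNl hdotNr opprK. Qed.

Lemma hdistC u v : hnorm (u - v) = hnorm (v - u).
Proof. by rewrite -hnorm_opp opprB. Qed.

Lemma hnorm_sqrD u v : hnorm (u + v) ^+ 2 =
  hnorm u ^+ 2 + hnorm v ^+ 2 + 2 * complex.Re (hdot u v).
Proof.
rewrite !hnorm_sqr hdotDl !hdotDr (hdotC v u).
by case: (hdot u u) (hdot u v) (hdot v v) => [? ?] [? ?] [? ?] /=; ring.
Qed.

Lemma hdot_le u v : normc (hdot u v) <= hnorm u * hnorm v.
Proof.
have [->|v0] := eqVneq v 0; first by rewrite hdot0r normc0 hnorm0 mulr0.
have nv : 0 < hnorm v.
  rewrite lt_neqAle hnorm_ge0 andbT eq_sym.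
  by apply: contra v0 => /eqP/hnorm0_eq0 ->.
rewrite -(@ler_pXn2r _ 2)// ?nnegrE ?normc_ge0 ?mulr_ge0//.
(* This is |v|^2 times the component of [u] orthogonal to [v], scaled to avoid a division; its
   square norm is |v|^2 (|u|^2 |v|^2 - |<u, v>|^2). *)
have := hdot_ge0 ((hnorm v ^+ 2)%:C *: u - hdot u v *: v).
rewrite hdotBl !hdotBr !hdotZl !hdotZr (hdotC v u) !hdotE lecE => /andP[_].
set a := hnorm u ^+ 2; set b := hnorm v ^+ 2.
rewrite normc_sqr exprMn -/a -/b; case: (hdot u v) => x y /=.
rewrite [leRHS](_ : _ = b * (a * b - (x ^+ 2 + y ^+ 2))); last by ring.
by rewrite pmulr_rge0 ?exprn_gt0// subr_ge0.
Qed.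

Lemma ler_hnormD u v : hnorm (u + v) <= hnorm u + hnorm v.
Proof.
rewrite -(@ler_pXn2r _ 2)// ?nnegrE ?addr_ge0// hnorm_sqrD sqrrD.
have := le_trans (Re_le_normc _) (hdot_le u v); lra.
Qed.

Lemma ler_hnormB u v : hnorm (u - v) <= hnorm u + hnorm v.
Proof. by apply: le_trans (ler_hnormD _ _) _; rewrite hnorm_opp. Qed.

Lemma hdist_triangle u v w : hnorm (u - w) <= hnorm (u - v) + hnorm (v - w).
Proof. by apply: le_trans (ler_hnormD _ _); rewrite addrA subrK. Qed.

Lemma hnorm_sum I (r : seq I) (P : pred I) (F : I -> H) :
  hnorm (\sum_(i <- r | P i) F i) <= \sum_(i <- r | P i) hnorm (F i).
Proof.
elim/big_rec2: _ => [|i y x _ yx]; first by rewrite hnorm0.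
by apply: le_trans (ler_hnormD _ _) _; rewrite lerD2l.
Qed.

Lemma linear_op0 T : linear T -> T 0 = 0.
Proof. by move=> lT; have := lT (-1) 0 0; rewrite scaler0 addr0 scaleN1r addNr. Qed.
Lemma linear_opD T : linear T -> {morph T : u v / u + v}.
Proof. by move=> lT u v; have := lT 1 u v; rewrite !scale1r. Qed.
Lemma linear_opZ T : linear T -> forall c u, T (c *: u) = c *: T u.
Proof. by move=> lT c u; have := lT c u 0; rewrite (linear_op0 lT) !addr0. Qed.
Lemma linear_opB T : linear T -> {morph T : u v / u - v}.
Proof.
by move=> lT u v; rewrite linear_opD// -scaleN1r (linear_opZ lT) scaleN1r.
Qed.

Lemma opnorm_leP T (c : R) : linear T -> 0 <= c ->
  (opnorm T <= c%:E)%E <-> forall u, hnorm (T u) <= c * hnorm u.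
Proof.
move=> lT c0; split => [Tc u|Tc].
  have [->|u0] := eqVneq u 0; first by rewrite linear_op0// !hnorm0 mulr0.
  have nu : 0 < hnorm u.
    rewrite lt_neqAle hnorm_ge0 andbT eq_sym.
    by apply: contra u0 => /eqP/hnorm0_eq0 ->.
  have : ((hnorm (T ((hnorm u)^-1%:C *: u)))%:E <= c%:E)%E.
    apply: le_trans Tc; apply: ereal_sup_ubound; exists ((hnorm u)^-1%:C *: u) => //.
    by rewrite /= hnormZR ger0_norm ?invr_ge0// mulVf// gt_eqF.
  rewrite lee_fin (linear_opZ lT) hnormZR ger0_norm ?invr_ge0//.
  by rewrite mulrC ler_pdivrMr.
apply: ge_ereal_sup => _ [u /= u1 <-]; rewrite lee_fin.
by apply: le_trans (Tc u) _; rewrite -[leRHS]mulr1 ler_wpM2l.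
Qed.

Lemma opnormP T (c : R) : linear T -> (opnorm T <= c%:E)%E ->
  forall u, hnorm (T u) <= c * hnorm u.
Proof.
move=> lT Tc; apply/opnorm_leP => //; rewrite -lee_fin; apply: le_trans Tc.
by apply: ereal_sup_ubound; exists 0; rewrite /= ?linear_op0// hnorm0.
Qed.

Lemma bounded_opP T : bounded_op T ->
  exists2 c : R, 0 < c & forall u, hnorm (T u) <= c * hnorm u.
Proof.
move=> [lT [c Tc]]; exists (`|c| + 1); first by rewrite ltr_wpDl.
move=> u; apply: le_trans (Tc u) _; rewrite ler_wpM2r//.
by apply: le_trans (ler_norm c) _; rewrite lerDl.
Qed.

Lemma linearB_op T S : linear T -> linear S -> linear (T - S)%R.
Proof.
move=> lT lS c u v; rewrite !fctE lT lS scalerBr.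
by rewrite opprD addrACA.
Qed.

Lemma bounded_opD T S : bounded_op T -> bounded_op S -> bounded_op (T + S).
Proof.
move=> [lT [c Tc]] [lS [d Sd]]; split.
  by move=> a u v; rewrite !fctE lT lS scalerDr addrACA.
exists (c + d) => u; apply: le_trans (ler_hnormD _ _) _.
by rewrite mulrDl; exact: lerD.
Qed.

Lemma bounded_op_scale c T : bounded_op T -> bounded_op (c *: T).
Proof.
move=> bT; have [lT _] := bT; have [d _ Td] := bounded_opP bT; split.
  move=> a u v; rewrite [LHS](_ : _ = c *: T (a *: u + v))//.
  by rewrite lT scalerDr !scalerA mulrC -scalerA.
exists (normc c * d) => u.
by rewrite [(c *: T) u](_ : _ = c *: T u)// hnormZ -mulrA ler_wpM2l ?normc_ge0.
Qed.

Lemma bounded_op0 : bounded_op (0 : H -> H).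
Proof.
split=> [a u v|]; first by rewrite [LHS](_ : _ = 0)//
  [RHS](_ : _ = a *: 0 + 0)// scaler0 addr0.
by exists 0 => u; rewrite mul0r hnorm0.
Qed.

Lemma bounded_op_comp T S : bounded_op T -> bounded_op S -> bounded_op (T \o S).
Proof.
move=> bT [lS [d Sd]]; have [c c0 Tc] := bounded_opP bT; split.
  by move=> a u v; rewrite /= lS bT.1.
exists (c * d) => u /=; apply: le_trans (Tc _) _.
by rewrite -mulrA ler_wpM2l// ltW.
Qed.

Lemma hdot_inj u v : (forall w, hdot w u = hdot w v) -> u = v.
Proof.
move=> uv; apply/subr0_eq/hnorm0_eq0; apply/eqP.
by rewrite -sqrf_eq0 hnorm_sqr hdotBr uv subrr.
Qed.

(** [is_adjoint] asks neither linearity nor boundedness of [S]; both are inherited from [T]. The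
    bound comes from |S u|^2 = <T (S u), u> <= c |S u| |u|. *)
Lemma adjoint_bound T S (c : R) : linear T ->
  (forall u, hnorm (T u) <= c * hnorm u) -> is_adjoint T S ->
  linear S /\ forall u, hnorm (S u) <= c * hnorm u.
Proof.
move=> lT Tc TS; split => [a u v|u].
  by apply: hdot_inj => w; rewrite hdotDr hdotZr -!TS hdotDr hdotZr.
have [->|u0] := eqVneq (S u) 0.
  rewrite hnorm0; have := Tc u; have := hnorm_ge0 (T u); lra.
have nu : 0 < hnorm (S u).
  rewrite lt_neqAle hnorm_ge0 andbT eq_sym.
  by apply: contra u0 => /eqP/hnorm0_eq0 ->.
rewrite -(ler_pM2r nu) -expr2 hnorm_sqr -TS.
apply: (le_trans (Re_le_normc _)); apply: (le_trans (hdot_le _ _)).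
by rewrite mulrAC ler_wpM2r.
Qed.

Lemma is_adjointC T S : is_adjoint T S -> is_adjoint S T.
Proof. by move=> TS u v; rewrite hdotC -TS -hdotC. Qed.

Lemma is_adjoint_comp T T' S S' : is_adjoint T S -> is_adjoint T' S' ->
  is_adjoint (T \o T') (S' \o S).
Proof. by move=> TS TS' u v /=; rewrite TS TS'. Qed.

Lemma isometry_hnorm T : (forall u v, hdot (T u) (T v) = hdot u v) ->
  forall u, hnorm (T u) = hnorm u.
Proof. by move=> Tu u; rewrite /hnorm Tu. Qed.

(** Polarization: norms determine the real parts of inner products, and replacing [u] by ['i *: u]
    turns imaginary parts into real ones. *)
Lemma linear_isometry_hdot T : linear T -> (forall u, hnorm (T u) = hnorm u) ->
  forall u v, hdot (T u) (T v) = hdot u v.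
Proof.
move=> lT nT.
have E u v : complex.Re (hdot (T u) (T v)) = complex.Re (hdot u v).
  have := hnorm_sqrD (T u) (T v); rewrite -linear_opD// !nT hnorm_sqrD.
  by move/addrI => E2; apply: (mulfI (_ : 2 != 0)); rewrite ?pnatr_eq0.
move=> u v; have := E ('i *: u) v; rewrite linear_opZ// !hdotZl; have := E u v.
case: (hdot (T u) (T v)) (hdot u v) => [a b] [c d] /= ->.
by rewrite !mul0r !mul1r => /addrI/oppr_inj ->.
Qed.
End prehilbert.
#[export] Hint Resolve hnorm_ge0 : core.

(** * Lebesgue measure on row vectors *)

Section translation_invariance.
Context (R : realType).

Lemma measurable_addr (a : R) :
  measurable_fun [set: measurableTypeR R] (fun x => x + a : measurableTypeR R).
Proof. by apply: measurable_funD. Qed.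

Lemma lebesgue_measure_shift (a : R) (A : set (measurableTypeR R)) :
  measurable A -> lebesgue_measure ((fun x => x + a) @^-1` A) = lebesgue_measure A.
Proof.
move=> mA; apply/esym.
apply: (@lebesgue_measure_unique R
  (measure_function_pushforward__canonical__measure_function_Measure
    (@lebesgue_measure R) (measurable_addr a))) => // _ [[x y] _ <-].
rewrite /= /pushforward (_ : _ @^-1` _ = `]x - a, y - a]%classic).
  by rewrite !lebesgue_measure_itv/= !lte_fin ltrD2r -!EFinD opprD opprK addrACA addNr addr0.
apply/seteqP; split => z /=; rewrite !in_itv/= => /andP[? ?]; apply/andP; split; lra.
Qed.

Lemma measurable_rV_addr n (a : 'rV[R]_n) :
  measurable_fun [set: 'rV[R]_n] (fun p : 'rV[R]_n => p + a).
Proof.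
apply: measurable_fun_rVP => i.
apply: (eq_measurable_fun (fun p : 'rV[R]_n => p ord0 i + a ord0 i : measurableTypeR R)).
  by move=> p _; rewrite mxE.
by apply: measurable_funD => //; exact: measurable_coord.
Qed.

Lemma lebesgue_rVS n (A : set 'rV[R]_n.+1) : lebesgue_rV R n.+1 A =
  (\int[lebesgue_rV R n]_v
    lebesgue_measure (fun x => A (rV_rcons (v, x : measurableTypeR R))))%E.
Proof.
apply: eq_integral => v _ /=; congr (lebesgue_measure _).
by apply/funext => x; apply/propext; rewrite /xsection /= inE.
Qed.

(** Invariance of the measure is a hypothesis, so that the lemma can serve in dimension n inside the
    induction that proves invariance in dimension n + 1. *)
Lemma ge0_integral_shift_of n (a : 'rV[R]_n) (f : 'rV[R]_n -> \bar R) :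
  (forall A, measurable A -> lebesgue_rV R n ((fun p => p + a) @^-1` A) =
    lebesgue_rV R n A) ->
  measurable_fun setT f -> (forall p, 0 <= f p)%E ->
  (\int[lebesgue_rV R n]_p f (p + a)%R = \int[lebesgue_rV R n]_p f p)%E.
Proof.
move=> shift mf f0.
pose nu := measure_function_pushforward__canonical__measure_function_Measure
  (lebesgue_rV R n) (measurable_rV_addr a).
rewrite [RHS](@eq_measure_integral _ _ _ setT nu); last by move=> A mA _; rewrite -shift.
by rewrite /= (ge0_integral_pushforward (measurable_rV_addr a)).
Qed.

(** Induction on the dimension, slicing along the last coordinate: the shift of that coordinate
    leaves the measure of each slice unchanged, and the shift of the others is absorbed by the
    integral over the slices. *)
Lemma lebesgue_rV_shift n (a : 'rV[R]_n) (A : set 'rV[R]_n) : measurable A ->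
  lebesgue_rV R n ((fun p => p + a) @^-1` A) = lebesgue_rV R n A.
Proof.
elim: n a A => [|n IH] a A mA.
  congr (lebesgue_rV R 0 _); apply/seteqP.
  by split => p /=; rewrite [p + a]thinmx0 [p]thinmx0.
pose a' : 'rV[R]_n := \row_j a ord0 (lift ord_max j).
have addE v (x : measurableTypeR R) :
    rV_rcons (v, x) + a = rV_rcons (v + a', x + a ord0 ord_max : measurableTypeR R).
  apply/rowP => i; rewrite !mxE; case: unliftP => [j ->|->//].
  by rewrite !mxE.
have mrA : measurable (@rV_rcons R n @^-1` A).
  by rewrite -[_ @^-1` _]setTI; exact: measurable_rV_rcons.
have mS v : measurable (fun x : measurableTypeR R => A (rV_rcons (v, x))).
  have := @measurable_xsection _ _ 'rV[R]_n (measurableTypeR R) _ v mrA.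
  by congr measurable; apply/funext => x; apply/propext; rewrite /xsection /= inE.
rewrite !lebesgue_rVS.
rewrite -(@ge0_integral_shift_of n a' (fun v => lebesgue_measure
    (fun x => A (rV_rcons (v, x : measurableTypeR R)))))//.
- apply: eq_integral => v _.
  rewrite -[RHS](@lebesgue_measure_shift (a ord0 ord_max))//.
  congr (lebesgue_measure _); apply/funext => x /=; rewrite /preimage /=.
  by rewrite addE.
- exact: IH.
- have := @measurable_fun_xsection _ _ 'rV[R]_n (measurableTypeR R) R
    (@lebesgue_measure R) _ mrA.
  apply: eq_measurable_fun => v _ /=; congr (lebesgue_measure _).
  by apply/funext => x; apply/propext; rewrite /xsection /= inE.
Qed.

Lemma ge0_integral_shift n (a : 'rV[R]_n) (f : 'rV[R]_n -> \bar R) :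
  measurable_fun setT f -> (forall p, 0 <= f p)%E ->
  (\int[lebesgue_rV R n]_p f (p + a)%R = \int[lebesgue_rV R n]_p f p)%E.
Proof. by move=> mf f0; apply: ge0_integral_shift_of => // A; exact: lebesgue_rV_shift. Qed.

Lemma ae_shift n (a : 'rV[R]_n) (P : set 'rV[R]_n) :
  {ae lebesgue_rV R n, forall p, P p} ->
  {ae lebesgue_rV R n, forall p, P (p + a)}.
Proof.
move=> [N [mN N0 PN]]; exists ((fun p => p + a) @^-1` N); split.
- by rewrite -[_ @^-1` _]setTI; exact: measurable_rV_addr.
- by rewrite lebesgue_rV_shift.
- by move=> p /= /PN.
Qed.

Definition cube n (x : 'rV[R]_n) (d : R) : set 'rV[R]_n :=
  [set p | forall i, x ord0 i <= p ord0 i < x ord0 i + d].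

Lemma measurable_cube n (x : 'rV[R]_n) d : measurable (cube x d).
Proof.
rewrite (_ : cube x d = \bigcap_(i in [set: 'I_n])
    ((fun p : 'rV[R]_n => p ord0 i : measurableTypeR R) @^-1`
      `[x ord0 i, x ord0 i + d[%classic)); last first.
  apply/seteqP; split => p px i.
    by move=> _; rewrite /= in_itv/=; exact: px.
  by have := px i I; rewrite /= in_itv.
apply: fin_bigcap_measurable => // i _.
by rewrite -[_ @^-1` _]setTI; apply: measurable_coord.
Qed.

Lemma lebesgue_rV_cube n (x : 'rV[R]_n) (d : R) : 0 < d ->
  lebesgue_rV R n (cube x d) = (d ^+ n)%:E.
Proof.
move=> d0; elim: n x => [|n IH] x.
  rewrite /= diracE expr0 (_ : (_ \in _) = true)//.
  by apply/mem_set => -[].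
pose x' : 'rV[R]_n := \row_j x ord0 (lift ord_max j).
transitivity ((lebesgue_rV R n \x (@lebesgue_measure R))%E
    (cube x' d `*` (`[x ord0 ord_max, x ord0 ord_max + d[%classic : set (measurableTypeR R)))).
  congr (_ \x _)%E; apply/seteqP; split => [[v y]|[v y]] /=.
    move=> H; split => [j|].
      by have := H (lift ord_max j); rewrite !mxE liftK.
    by have := H ord_max; rewrite !mxE unlift_none/= in_itv.
  move=> [H1]; rewrite in_itv/= => H2 i; rewrite !mxE.
  case: unliftP => [j|] ->; last exact: H2.
  by have := H1 j; rewrite !mxE.
rewrite product_measure1E//; last exact: measurable_cube.
rewrite IH (_ : _ `[_, _[%classic = d%:E) ?EFinM ?exprSr//.
apply: (eq_trans (lebesgue_measure_itv `[x ord0 ord_max, x ord0 ord_max + d[)).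
rewrite /= lte_fin ltrDl d0 -EFinD addrAC subrr add0r//.
Qed.

End translation_invariance.

Section borel.
Context (R : realType) (n : nat).

(** The sigma-algebra is generated by the coordinates. An open set belongs to it as the union of the
    countably many rational boxes that it contains. *)
Lemma open_measurable_rV (U : set 'rV[R]_n) : open U -> measurable U.
Proof.
move=> oU.
pose box (q : 'rV[rat]_n * rat) : set 'rV[R]_n :=
  [set p | forall i, `|p ord0 i - ratr (q.1 ord0 i)| < ratr q.2].
have mbox q : measurable (box q).
  rewrite (_ : box q = \bigcap_(i in [set: 'I_n])
    ((fun p : 'rV[R]_n => p ord0 i : measurableTypeR R) @^-1`
      `]ratr (q.1 ord0 i) - ratr q.2, ratr (q.1 ord0 i) + ratr q.2[%classic)); last first.
    by apply/seteqP; split => p /= => [px i _|px i]; have := px i; rewrite ?in_itv//= ltr_distl//; apply.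
  apply: fin_bigcap_measurable => // i _.
  by rewrite -[_ @^-1` _]setTI; apply: measurable_coord.
pose D := [set q | box q `<=` U].
rewrite (_ : U = \bigcup_q (if pselect (D q) then box q else set0)).
  apply: countable_bigcupT_measurable => //.
  by move=> q; case: (pselect (D q)) => Dq; [exact: mbox|exact: measurable0].
apply/seteqP; split => [p Up|p [q _]]; last by case: pselect => // Dq bp; exact: (Dq _ bp).
have /nbhs_ballP[e /= e0 peU] := open_nbhs_nbhs (conj oU Up).
have [r] := rat_in_itvoo (divr_gt0 e0 (ltr0n _ 2)).
rewrite in_itv/= => /andP[r0 re].
have near i : exists q : rat, `|p ord0 i - ratr q| < ratr r.
  have : p ord0 i < p ord0 i + ratr r by rewrite ltrDl.
  move=> /rat_in_itvoo[q]; rewrite in_itv/= => /andP[pq qp]; exists q.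
  by rewrite ltr_distl; apply/andP; split; lra.
have [q qP] := choice near.
exists (\row_i q i, r) => //; case: pselect => [_ i|nD]; first by rewrite mxE; exact: qP.
exfalso; apply: nD => z /= zq; apply: peU.
rewrite /ball/= /mx_ball; split => // i j; rewrite (ord1 i) /ball/=.
have := zq j; have := qP j; rewrite mxE !ltr_distl => /andP[? ?] /andP[? ?].
by apply/andP; split; lra.
Qed.

Lemma continuous_measurable_rV (f : 'rV[R]_n -> R) :
  continuous f -> measurable_fun [set: 'rV[R]_n] f.
Proof.
move=> /continuousP cf.
apply: (measurability _ (RGenOpens.measurableE R)) => _ [_ [a [b ->]] <-].
rewrite setTI; apply: open_measurable_rV; apply: cf; exact: interval_open.
Qed.
End borel.

(** * Integrals and null sets for a measure with a density *)

Section density.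
Context d (T : measurableType d) (R : realType) (mu nu : {measure set T -> \bar R}).
Variable g : T -> R.
Hypotheses (mg : measurable_fun [set: T] g) (g0 : forall x, 0 <= g x).
Hypothesis nuE : forall A, measurable A -> (nu A = \int[mu]_(x in A) (g x)%:E)%E.
Local Open Scope ereal_scope.
Import HBNNSimple.

Let indic_density (A : set T) : measurable A ->
  \int[mu]_x (\1_A x * g x)%:E = nu A.
Proof.
move=> mA; rewrite nuE// [RHS]integral_mkcond; apply: eq_integral => x _.
by rewrite patchE indicE; case: (x \in A); rewrite ?mul1r ?mul0r.
Qed.

Let nnsfun_density (h : {nnsfun T >-> R}) :
  \int[nu]_x (h x)%:E = \int[mu]_x (h x * g x)%:E.
Proof.
have mh y : measurable (h @^-1` [set y]) by exact: measurable_sfunP.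
have hE x : h x = (\sum_(y \in range h) y * \1_(h @^-1` [set y]) x)%R.
  exact: fimfunE.
transitivity (\sum_(y \in range h) y%:E * nu (h @^-1` [set y])).
  under eq_integral do rewrite hE -fsumEFin//.
  rewrite ge0_integral_fsum//.
  - apply: eq_fsbigr => y _; rewrite integralZl_indic_nnsfun//.
    by rewrite integral_indic// setIT.
  - by move=> y; apply/measurable_EFinP/measurable_funM.
  - by move=> y x _; exact: nnfun_muleindic_ge0.
under [RHS]eq_integral => x _.
  rewrite hE EFinM -fsumEFin// ge0_mule_fsuml; last first.
    by move=> y; exact: nnfun_muleindic_ge0.
  over.
rewrite ge0_integral_fsum//; first last.
- by move=> y x _; rewrite mule_ge0 ?lee_fin//; exact: nnfun_muleindic_ge0.
- move=> y; apply: emeasurable_funM; apply/measurable_EFinP => //.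
  exact: measurable_funM.
apply: eq_fsbigr => y /set_mem[x _ <-].
rewrite -indic_density// -ge0_integralZl//.
- by apply: eq_integral => z _; rewrite -!EFinM mulrA.
- by apply/measurable_EFinP/measurable_funM.
- by move=> z _; rewrite lee_fin mulr_ge0.
- by rewrite lee_fin.
Qed.

Lemma ge0_integral_density (f : T -> R) : measurable_fun setT f ->
  (forall x, 0 <= f x)%R ->
  \int[nu]_x (f x)%:E = \int[mu]_x (f x * g x)%:E.
Proof.
move=> mf f0.
have mEf : measurable_fun setT (EFin \o f) by exact/measurable_EFinP.
pose h := nnsfun_approx measurableT mEf.
have hf x : (EFin \o h n) x @[n --> \oo] --> (f x)%:E.
  by apply: cvg_nnsfun_approx => // y _; rewrite lee_fin.
have nd x : {homo (fun n => (EFin \o h n) x) : a b / (a <= b)%N >-> a <= b}.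
  by move=> a b ab; rewrite lee_fin; exact/lefP/nd_nnsfun_approx.
transitivity (limn (fun n => \int[nu]_x (h n x)%:E)).
  rewrite -monotone_convergence//.
  - by apply: eq_integral => x _; apply/esym/cvg_lim => //; exact: hf.
  - by move=> n; exact/measurable_EFinP.
  - by move=> n x _; rewrite lee_fin.
  - by move=> x _; exact: nd.
transitivity (limn (fun n => \int[mu]_x (h n x * g x)%:E)).
  by congr (limn _); apply/funext => n; exact: nnsfun_density.
rewrite -monotone_convergence//.
- apply: eq_integral => x _; apply/cvg_lim => //.
  under eq_fun do rewrite EFinM.
  by rewrite EFinM; apply: cvgeZr => //; exact: hf.
- by move=> n; apply/measurable_EFinP/measurable_funM.
- by move=> n x _; rewrite lee_fin mulr_ge0.
- move=> x _ a b ab; rewrite lee_fin ler_wpM2r// -lee_fin; exact: nd.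
Qed.

(** A positive density gives the same null sets: if the integral of [g] over [N] vanishes, then [g]
    vanishes almost everywhere on [N], which leaves [N] null for [mu]. The converse is the integral
    over a null set. *)
Lemma ae_density (P : set T) : (forall x, 0 < g x)%R ->
  {ae nu, forall x, P x} <-> {ae mu, forall x, P x}.
Proof.
move=> g_gt0; split=> -[N [mN N0 PN]]; exists N; split => //.
  have: \int[mu]_(x in N) `|(g x)%:E| = 0.
    rewrite -N0 nuE//; apply: eq_integral => x _; by rewrite gee0_abs// lee_fin.
  move/(ae_eq_integral_abs mu mN); move=> [|A [mA A0 NA]].
    by apply/measurable_EFinP; exact: measurable_funTS.
  apply/eqP; rewrite eq_le measure_ge0 andbT -A0 le_measure ?inE// => x Nx.
  apply: NA => /= /(_ Nx) /eqP; rewrite eqe => /eqP g0x.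
  by have := g_gt0 x; rewrite g0x ltxx.
rewrite nuE//; apply: null_set_integral => //.
  by apply/measurable_EFinP; exact: measurable_funTS.
Qed.
End density.

Lemma measurable_energy (R : realType) n (m : R) :
  measurable_fun [set: 'rV[R]_n] (energy m).
Proof.
apply: (measurableT_comp (continuous_measurable_fun (@sqrt_continuous R))).
apply: measurable_funD => //; apply: measurable_sum => i.
by apply: measurable_funX; exact: measurable_coord.
Qed.

(** * The Hilbert space L2 *)

Section L2_basics.
Context d (T : measurableType d) (R : realType) (mu : {measure set T -> \bar R}).
Implicit Types (f g : T -> R[i]).

(** Put in terms of real and imaginary parts to match [L2pred]. *)
Definition cmeasurable f : Prop :=
  measurable_fun setT (fun x => complex.Re (f x)) /\
  measurable_fun setT (fun x => complex.Im (f x)).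

Lemma cmeasurable_cst (c : R[i]) : cmeasurable (fun=> c).
Proof. by split; exact: measurable_cst. Qed.

Lemma cmeasurable_real (h : T -> R) : measurable_fun setT h ->
  cmeasurable (fun x => (h x)%:C).
Proof. by move=> mh; split => //; exact: measurable_cst. Qed.

Lemma cmeasurableD f g : cmeasurable f -> cmeasurable g ->
  cmeasurable (fun x => f x + g x).
Proof.
move=> [f1 f2] [g1 g2]; split.
  apply: (eq_measurable_fun (fun x => complex.Re (f x) + complex.Re (g x))).
    by move=> x _; case: (f x) (g x) => [? ?] [? ?].
  exact: measurable_funD.
apply: (eq_measurable_fun (fun x => complex.Im (f x) + complex.Im (g x))).
  by move=> x _; case: (f x) (g x) => [? ?] [? ?].
exact: measurable_funD.
Qed.

Lemma cmeasurableM f g : cmeasurable f -> cmeasurable g ->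
  cmeasurable (fun x => f x * g x).
Proof.
move=> [f1 f2] [g1 g2]; split.
  apply: (eq_measurable_fun (fun x => complex.Re (f x) * complex.Re (g x) -
    complex.Im (f x) * complex.Im (g x))).
    by move=> x _; case: (f x) (g x) => [? ?] [? ?].
  by apply: measurable_funB; exact: measurable_funM.
apply: (eq_measurable_fun (fun x => complex.Re (f x) * complex.Im (g x) +
    complex.Im (f x) * complex.Re (g x))).
  by move=> x _; case: (f x) (g x) => [? ?] [? ?].
by apply: measurable_funD; exact: measurable_funM.
Qed.

Lemma cmeasurable_conj f : cmeasurable f -> cmeasurable (fun x => (f x)^*).
Proof.
move=> [f1 f2]; split.
  by apply: eq_measurable_fun f1 => x _; case: (f x).
apply: (eq_measurable_fun (fun x => - complex.Im (f x))).
  by move=> x _; case: (f x).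
exact: measurableT_comp.
Qed.

Lemma measurable_normc2 f : cmeasurable f ->
  measurable_fun setT (fun x => normc (f x) ^+ 2).
Proof.
move=> [f1 f2]; under eq_fun do rewrite normc_sqr.
by apply: measurable_funD; exact: measurable_funX.
Qed.

(** Extended-real valued, hence meaningful before square-integrability is known; norm estimates on
    classes reduce to it. *)
Definition sqnorm f : \bar R := (\int[mu]_x (normc (f x) ^+ 2)%:E)%E.

Lemma sqnorm_ge0 f : (0 <= sqnorm f)%E.
Proof. by apply: integral_ge0 => x _; rewrite lee_fin sqr_ge0. Qed.

Lemma Lfun2P (g : T -> R) : g \in Lfun mu 2%:E <->
  measurable_fun setT g /\ (\int[mu]_x (g x ^+ 2)%:E < +oo)%E.
Proof.
split=> [gL|[mg g2]].
  split; first by have /andP[/set_mem] := gL.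
  have /integrableP[_] := Lfun2_integrable_sqr gL.
  by under eq_integral do rewrite /= ger0_norm ?sqr_ge0//.
apply/andP; split; apply/mem_set => //=.
rewrite /finite_norm unlock /= poweR_lty//.
under eq_integral do rewrite /= powR_mulrn// -normrX ger0_norm ?sqr_ge0//.
exact: g2.
Qed.

Lemma L2predP f : f \in L2pred mu <-> cmeasurable f /\ (sqnorm f < +oo)%E.
Proof.
rewrite /L2pred inE.
have E : cmeasurable f -> (sqnorm f = \int[mu]_x (complex.Re (f x) ^+ 2)%:E +
   \int[mu]_x (complex.Im (f x) ^+ 2)%:E)%E.
  move=> [m1 m2]; rewrite -ge0_integralD//=.
  - by apply: eq_integral => x _; rewrite normc_sqr EFinD.
  - by move=> x _; rewrite lee_fin sqr_ge0.
  - by apply/measurable_EFinP; exact: measurable_funX.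
  - by move=> x _; rewrite lee_fin sqr_ge0.
  - by apply/measurable_EFinP; exact: measurable_funX.
split=> [/andP[/Lfun2P[m1 i1] /Lfun2P[m2 i2]]|[[m1 m2]]].
  by split=> //; rewrite E// lte_add_pinfty.
rewrite E// => i; apply/andP; split; apply/Lfun2P; split => //.
  by apply: le_lt_trans i; rewrite leeDl// integral_ge0// => x _; rewrite lee_fin sqr_ge0.
by apply: le_lt_trans i; rewrite leeDr// integral_ge0// => x _; rewrite lee_fin sqr_ge0.
Qed.

Lemma le_sqnorm (c : R) f g : cmeasurable f -> cmeasurable g ->
  {ae mu, forall x, normc (f x) <= c * normc (g x)} ->
  (sqnorm f <= (c ^+ 2)%:E * sqnorm g)%E.
Proof.
move=> mf mg fg; rewrite /sqnorm -ge0_integralZl//.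
- apply: ae_ge0_le_integral => //.
  + by move=> x _; rewrite lee_fin sqr_ge0.
  + by apply/measurable_EFinP; exact: measurable_normc2.
  + by move=> x _; rewrite -EFinM lee_fin mulr_ge0 ?sqr_ge0.
  + apply/measurable_funeM/measurable_EFinP; exact: measurable_normc2.
  + apply: filterS fg => x fgx _; rewrite -EFinM lee_fin -exprMn.
    by rewrite ler_sqr_ge0 ?normc_ge0// (le_trans _ fgx).
- by apply/measurable_EFinP; exact: measurable_normc2.
- by move=> x _; rewrite lee_fin sqr_ge0.
- by rewrite lee_fin sqr_ge0.
Qed.

Lemma L2pred_dom (c : R) f g : cmeasurable f -> g \in L2pred mu ->
  {ae mu, forall x, normc (f x) <= c * normc (g x)} -> f \in L2pred mu.
Proof.
move=> mf /L2predP[mg g2] fg; apply/L2predP; split => //.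
apply: le_lt_trans (le_sqnorm mf mg fg) _.
by rewrite lte_mul_pinfty// lee_fin sqr_ge0.
Qed.

Lemma L2_rep_pred (u : L2 mu) : L2_rep u \in L2pred mu.
Proof. exact: valP. Qed.

Lemma L2_repM (u : L2 mu) : cmeasurable (L2_rep u).
Proof. by have /L2predP[] := L2_rep_pred u. Qed.

Lemma L2_class_val (F : L2fun mu) : L2_class mu F = \pi_(L2 mu)%qT F.
Proof.
rewrite /L2_class; congr (\pi_(L2 mu)%qT _); apply/val_inj.
by rewrite val_insubd (valP F).
Qed.

Lemma L2_repK (u : L2 mu) : L2_class mu (L2_rep u) = u.
Proof. by rewrite L2_class_val reprK. Qed.

Lemma L2_classE f : f \in L2pred mu ->
  {ae mu, forall x, f x = L2_rep (L2_class mu f) x}.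
Proof.
move=> fL; have := L2_repr (MkL2fun fL).
by rewrite -(L2_class_val (MkL2fun fL)).
Qed.

Lemma eq_L2_class f g : f \in L2pred mu -> g \in L2pred mu ->
  {ae mu, forall x, f x = g x} -> L2_class mu f = L2_class mu g.
Proof.
move=> fL gL fg.
rewrite (L2_class_val (MkL2fun fL)) (L2_class_val (MkL2fun gL)).
by apply/eqP/L2_eqP.
Qed.

Lemma L2_ext (u v : L2 mu) : {ae mu, forall x, L2_rep u x = L2_rep v x} -> u = v.
Proof.
by move=> uv; rewrite -(L2_repK u) -(L2_repK v); apply: eq_L2_class => //; exact: L2_rep_pred.
Qed.

Lemma L2pred_linear (a : R[i]) f g : f \in L2pred mu -> g \in L2pred mu ->
  (fun x => a * f x + g x) \in L2pred mu.
Proof. by case: (L2pred_submod_closed mu) => _; apply. Qed.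

Lemma L2_class_linear (a : R[i]) f g : f \in L2pred mu -> g \in L2pred mu ->
  L2_class mu (fun x => a * f x + g x) = a *: L2_class mu f + L2_class mu g.
Proof.
move=> fL gL; pose F := MkL2fun fL; pose G := MkL2fun gL.
rewrite (L2_class_val F) (L2_class_val G).
rewrite -[a *: _]/(L2_scale a _) -L2_piZ -L2_piD -L2_class_val.
by congr (L2_class mu _).
Qed.

Lemma L2_rep_linear (a : R[i]) (u v : L2 mu) :
  {ae mu, forall x, a * L2_rep u x + L2_rep v x = L2_rep (a *: u + v) x}.
Proof.
have := L2_classE (L2pred_linear a (L2_rep_pred u) (L2_rep_pred v)).
by rewrite L2_class_linear ?L2_repK//; exact: L2_rep_pred.
Qed.

Lemma L2_rep0 : {ae mu, forall x, L2_rep (0 : L2 mu) x = 0}.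
Proof.
have := L2_rep_linear (-1) 0 0; rewrite scaler0 addr0.
by apply: filterS => x <-; rewrite mulN1r addNr.
Qed.

Lemma hdot_cip (u v : L2 mu) : hdot u v = cip mu (L2_rep u) (L2_rep v).
Proof. by []. Qed.

Lemma hdot_class f g : f \in L2pred mu -> g \in L2pred mu ->
  hdot (L2_class mu f) (L2_class mu g) = cip mu f g.
Proof.
move=> fL gL; rewrite (L2_class_val (MkL2fun fL)) (L2_class_val (MkL2fun gL)).
exact: (L2_dot_pi (MkL2fun fL) (MkL2fun gL)).
Qed.

Lemma hnorm_rep (u : L2 mu) : ((hnorm u ^+ 2)%:E = sqnorm (L2_rep u))%E.
Proof.
rewrite hnorm_sqr hdot_cip /cip /=.
have /L2predP[mf fi] := L2_rep_pred u.
have E x : complex.Re (L2_rep u x * (L2_rep u x)^*) = normc (L2_rep u x) ^+ 2.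
  by rewrite normc_sqr; case: (L2_rep u x) => a b /=; ring.
rewrite /Rintegral fineK; last first.
  under eq_integral do rewrite E.
  by rewrite ge0_fin_numE// sqnorm_ge0.
by apply: eq_integral => x _; rewrite E.
Qed.

Lemma hnorm_class f : f \in L2pred mu ->
  ((hnorm (L2_class mu f) ^+ 2)%:E = sqnorm f)%E.
Proof.
move=> fL; rewrite hnorm_rep; apply: ae_eq_integral => //.
- by apply/measurable_EFinP/measurable_normc2; exact: L2_repM.
- by apply/measurable_EFinP/measurable_normc2; have /L2predP[] := fL.
- by apply: filterS (L2_classE fL) => x -> _.
Qed.

Lemma le_hnorm (c : R) (u v : L2 mu) : 0 <= c ->
  {ae mu, forall x, normc (L2_rep u x) <= c * normc (L2_rep v x)} ->
  hnorm u <= c * hnorm v.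
Proof.
move=> c0 /(le_sqnorm (L2_repM u) (L2_repM v)).
rewrite -!hnorm_rep -EFinM lee_fin -exprMn.
by rewrite ler_sqr_ge0 ?mulr_ge0 ?hnorm_ge0.
Qed.
End L2_basics.

(** * Completeness of L2 (Riesz-Fischer) *)

Section riesz_fischer.
Context d (T : measurableType d) (R : realType) (mu : {measure set T -> \bar R}).

Lemma L2_rep_sub (u v : L2 mu) :
  {ae mu, forall x, L2_rep u x - L2_rep v x = L2_rep (u - v) x}.
Proof.
have := L2_rep_linear (-1) v u; rewrite scaleN1r addrC.
by apply: filterS => x <-; rewrite mulN1r addrC.
Qed.

Lemma cmeasurable_rep_sub (u v : L2 mu) :
  cmeasurable (fun x => L2_rep u x - L2_rep v x).
Proof.
have := cmeasurableD (L2_repM u) (cmeasurableM (cmeasurable_cst T (-1)) (L2_repM v)).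
by congr cmeasurable; apply/funext => x; rewrite mulN1r.
Qed.

Lemma sqnorm_rep_sub (u v : L2 mu) :
  sqnorm mu (fun x => L2_rep u x - L2_rep v x) = (hnorm (u - v) ^+ 2)%:E.
Proof.
rewrite hnorm_rep; apply: ae_eq_integral => //.
- by apply/measurable_EFinP/measurable_normc2; exact: cmeasurable_rep_sub.
- by apply/measurable_EFinP/measurable_normc2; exact: L2_repM.
- by apply: filterS (L2_rep_sub u v) => x -> _.
Qed.

Lemma measurable_normc (f : T -> R[i]) : cmeasurable f ->
  measurable_fun setT (fun x => normc (f x)).
Proof.
move=> mf; rewrite (_ : (fun _ => _) = Num.sqrt \o (fun x => normc (f x) ^+ 2)).
  apply: measurableT_comp (measurable_normc2 mf).
  exact: continuous_measurable_fun (@sqrt_continuous R).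
by apply/funext => x /=; rewrite sqrtr_sqr ger0_norm.
Qed.

Section fast.
Variable v : nat -> L2 mu.
Hypothesis vE : forall k, hnorm (v k.+1 - v k) <= 2^-1 ^+ k.

Let h k := L2_rep (v k).
Let g k (x : T) : R := normc (h k.+1 x - h k x).
Let G N (x : T) : R := \sum_(k < N) g k x.

Let mg k : measurable_fun setT (g k).
Proof. by apply: measurable_normc; exact: cmeasurable_rep_sub. Qed.

Let mG N : measurable_fun setT (G N).
Proof. exact: measurable_sum. Qed.

Let gL k : (fun x => (g k x)%:C) \in L2pred mu.
Proof.
apply: (@L2pred_dom _ _ _ _ 1 _ (L2_rep (v k.+1 - v k))).
- exact: cmeasurable_real.
- exact: L2_rep_pred.
- apply: filterS (L2_rep_sub (v k.+1) (v k)) => x <-.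
  by rewrite normc_real mul1r ger0_norm ?normc_ge0.
Qed.

Let hnorm_g k : hnorm (L2_class mu (fun x => (g k x)%:C)) = hnorm (v k.+1 - v k).
Proof.
apply/(pexpIrn (n := 2)) => //; rewrite ?nnegrE ?hnorm_ge0//; apply/EFin_inj.
rewrite hnorm_class// -sqnorm_rep_sub; apply: eq_integral => x _.
by rewrite normc_real ger0_norm ?normc_ge0// /g.
Qed.

Let sumG N : (fun x => (G N x)%:C) \in L2pred mu /\
  L2_class mu (fun x => (G N x)%:C) =
    \sum_(k < N) L2_class mu (fun x => (g k x)%:C).
Proof.
elim: N => [|N [IH1 IH2]].
  have -> : (fun x => (G 0 x)%:C) = (fun=> 0) :> (T -> R[i]).
    by apply/funext => x; rewrite /G big_ord0.
  have L0 : (fun=> 0) \in L2pred mu by case: (L2pred_submod_closed mu).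
  split=> //; rewrite big_ord0; apply: L2_ext.
  by apply: filterS2 (L2_classE L0) (L2_rep0 mu) => x <- ->.
have -> : (fun x => (G N.+1 x)%:C) = (fun x => 1 * (G N x)%:C + (g N x)%:C).
  by apply/funext => x; rewrite /G big_ord_recr/= mul1r rmorphD.
split; first by apply: L2pred_linear.
by rewrite L2_class_linear// IH2 scale1r big_ord_recr.
Qed.

Let geo N : \sum_(k < N) (2^-1 : R) ^+ k <= 2.
Proof.
suff -> : \sum_(k < N) (2^-1 : R) ^+ k = 2 - 2 * 2^-1 ^+ N.
  by rewrite gerBl mulr_ge0// exprn_ge0.
elim: N => [|N IH]; first by rewrite big_ord0 expr0; lra.
rewrite big_ord_recr/= IH exprS; set y := 2^-1 ^+ N; lra.
Qed.

Let intG N : (\int[mu]_x (G N x ^+ 2)%:E <= 4%:E)%E.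
Proof.
have [GL GE] := sumG N.
have -> : (\int[mu]_x (G N x ^+ 2)%:E = sqnorm mu (fun x => (G N x)%:C))%E.
  by apply: eq_integral => x _; rewrite normc_real real_normK// num_real.
rewrite -hnorm_class// lee_fin GE (_ : 4 = 2 ^+ 2) ?ler_sqr_ge0//; last by ring.
apply: le_trans (hnorm_sum _ _ _) _; apply: le_trans (geo N).
by apply: ler_sum => k _; rewrite hnorm_g.
Qed.

Let G_nd x : nondecreasing_seq (G ^~ x).
Proof.
apply/nondecreasing_seqP => N; rewrite /G big_ord_recr/= lerDl /g; exact: normc_ge0.
Qed.
Let G_ge0 N x : 0 <= G N x.
Proof. by apply: sumr_ge0 => k _; exact: normc_ge0. Qed.

Let G_bnd : {ae mu, forall x, has_ubound (range (G ^~ x))}.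
Proof.
pose Phi N x : \bar R := (G N x ^+ 2)%:E.
have mPhi N : measurable_fun setT (Phi N).
  by apply/measurable_EFinP; exact: measurable_funX.
have Phi_nd x : nondecreasing_seq (Phi ^~ x).
  by move=> a b ab; rewrite lee_fin ler_sqr_ge0// G_nd.
have Phi_cvg x : Phi ^~ x @ \oo --> limn (Phi ^~ x).
  exact: ereal_nondecreasing_is_cvgn.
have Phi0 N x : (0 <= Phi N x)%E by rewrite lee_fin sqr_ge0.
have iPhi : (\int[mu]_x limn (Phi ^~ x) <= 4%:E)%E.
  rewrite monotone_convergence//.
  apply: lime_le; last by apply: nearW => N; exact: intG.
  apply: ereal_nondecreasing_is_cvgn => a b ab; apply: ge0_le_integral => //.
  by move=> x _; exact: Phi_nd.
have l0 x : (0 <= limn (Phi ^~ x))%E.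
  by apply: lime_ge; [exact: Phi_cvg|exact: nearW].
have : mu.-integrable setT (fun x => limn (Phi ^~ x)).
  apply/integrableP; split.
    by apply: (@emeasurable_fun_cvg _ _ _ _ Phi).
  under eq_integral do rewrite gee0_abs//.
  by apply: le_lt_trans iPhi _; rewrite ltry.
move=> /(integrable_ae measurableT); apply: filterS => x /(_ I).
(* A bound on the squares bounds [G N x] itself, since g <= 1 + g^2 for g >= 0. *)
move=> lfin; exists (1 + fine (limn (Phi ^~ x))) => _ [N _ <-].
have : (Phi N x <= limn (Phi ^~ x))%E.
  rewrite (cvg_lim _ (ereal_nondecreasing_cvgn (Phi_nd x)))//.
  by apply: ereal_sup_ubound; exists N.
rewrite -[X in (_ <= X)%E](fineK lfin) lee_fin => H.
have := sqr_ge0 (G N x - 1); rewrite sqrrB => H2; have := G_ge0 N x; lra.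
Qed.

Let cvg_part (p : R[i] -> R) x : (forall a b, p (a - b) = p a - p b) ->
  (forall a, `|p a| <= normc a) -> has_ubound (range (G ^~ x)) ->
  cvgn (fun k => p (h k x)).
Proof.
move=> pB ple Gb.
have E k : p (h k x) = p (h 0%N x) + series (fun j => p (h j.+1 x) - p (h j x)) k.
  rewrite /series/= big_mkord; elim: k => [|k IH]; first by rewrite big_ord0 addr0.
  by rewrite big_ord_recr/= addrA -IH addrC subrK.
under eq_fun do rewrite E.
apply: is_cvgD; first exact: is_cvg_cst.
apply: normed_cvg; apply: nondecreasing_is_cvgn.
  by apply: nondecreasing_series => j _ _; exact: normr_ge0.
have [M GM] := Gb; exists M => _ [N _ <-].
apply: le_trans (GM (G N x) _); last by exists N.
rewrite [leLHS](_ : _ = \sum_(0 <= j < N) `|p (h j.+1 x) - p (h j x)|)//.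
rewrite big_mkord; apply: ler_sum => j _.
by rewrite -pB ple.
Qed.

(** The sums [G N] of the absolute increments have norm at most 2, so by monotone convergence they
    are bounded almost everywhere. Where they are bounded, the representatives converge absolutely;
    Fatou's lemma turns this pointwise limit into a limit in norm, with a rate. *)
Lemma fast_cauchy_cvg : exists2 l : L2 mu,
  forall k, hnorm (v k - l) <= 2 * 2^-1 ^+ k & True.
Proof.
have [N [mN N0 GN]] := G_bnd.
have gb x : (~` N) x -> has_ubound (range (G ^~ x)).
  by move=> Nx; apply: contrapT => H; apply: Nx; exact: GN.
(* Setting the representatives to 0 on the null set [N] makes them converge everywhere, so that the
   limit [F] is measurable. *)
pose w k x := if x \in ~` N then h k x else 0.
have mNC : measurable (~` N) by exact: measurableC.
pose F x := limn (fun k => complex.Re (w k x)) +i* limn (fun k => complex.Im (w k x)).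
have wE k x : w k x = if x \in ~` N then h k x else 0 by [].
have cvgRe x : (fun k => complex.Re (w k x)) @ \oo --> complex.Re (F x).
  suff : cvgn (fun k => complex.Re (w k x)) by [].
  have [/set_mem xN|xN] := boolP (x \in ~` N); last first.
    rewrite (_ : (fun k => _) = fun=> 0); first exact: is_cvg_cst.
    by apply/funext => k; rewrite wE (negbTE xN).
  rewrite (_ : (fun k => _) = fun k => complex.Re (h k x)); last first.
    by apply/funext => k; rewrite wE mem_set.
  apply: (cvg_part (p := @complex.Re R)) => //; last exact: gb.
  - by move=> [? ?] [? ?].
  - move=> a; rewrite -lecR; exact: normc_ge_Re.
have cvgIm x : (fun k => complex.Im (w k x)) @ \oo --> complex.Im (F x).
  suff : cvgn (fun k => complex.Im (w k x)) by [].
  have [/set_mem xN|xN] := boolP (x \in ~` N); last first.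
    rewrite (_ : (fun k => _) = fun=> 0); first exact: is_cvg_cst.
    by apply/funext => k; rewrite wE (negbTE xN).
  rewrite (_ : (fun k => _) = fun k => complex.Im (h k x)); last first.
    by apply/funext => k; rewrite wE mem_set.
  apply: (cvg_part (p := @complex.Im R)) => //; last exact: gb.
  - by move=> [? ?] [? ?].
  - move=> [a b] /=; rewrite -sqrtr_sqr ler_sqrt ?addr_ge0 ?sqr_ge0//.
    by rewrite lerDr sqr_ge0.
have mw k : cmeasurable (w k).
  have [m1 m2] := L2_repM (v k); split.
    have /(measurable_restrictT _ mNC) := measurable_funS measurableT (@subsetT _ (~` N)) m1.
    congr measurable_fun; apply/funext => x; rewrite wE patchE.
    by case: ifP.
  have /(measurable_restrictT _ mNC) := measurable_funS measurableT (@subsetT _ (~` N)) m2.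
  congr measurable_fun; apply/funext => x; rewrite wE patchE.
  by case: ifP.
have mF : cmeasurable F.
  split.
    apply: (@measurable_fun_cvg _ _ _ _ (fun k x => complex.Re (w k x))) => [k|x _].
      by case: (mw k).
    exact: cvgRe.
  apply: (@measurable_fun_cvg _ _ _ _ (fun k x => complex.Im (w k x))) => [k|x _].
    by case: (mw k).
  exact: cvgIm.
have aew k : {ae mu, forall x, w k x = h k x}.
  exists N; split => // x /= wx; apply: contrapT => xN; apply: wx.
  by rewrite wE mem_set.
have wL k : w k \in L2pred mu.
  apply: (@L2pred_dom _ _ _ _ 1 _ (h k)) => //; first exact: L2_rep_pred.
  by apply: filterS (aew k) => x ->; rewrite mul1r.
have dist j k : hnorm (v j - v (j + k)%N) <= 2 * 2^-1 ^+ j - 2 * 2^-1 ^+ (j + k).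
  elim: k => [|k IH]; first by rewrite addn0 !subrr hnorm0.
  rewrite addnS; apply: le_trans (hdist_triangle _ (v (j + k)%N) _) _.
  have vS : hnorm (v (j + k)%N - v (j + k).+1) <= 2^-1 ^+ (j + k) by rewrite hdistC.
  by apply: le_trans (lerD IH vS) _; rewrite exprS; set y := 2^-1 ^+ (j + k); lra.
have key j : (sqnorm mu (fun x => F x - w j x)%R <= ((2 * 2^-1 ^+ j) ^+ 2)%:E)%E.
  pose D k x : \bar R := (normc (w k x - w j x) ^+ 2)%:E.
  have mwj k : cmeasurable (fun x => w k x - w j x).
    have := cmeasurableD (mw k) (cmeasurableM (cmeasurable_cst T (-1)) (mw j)).
    by congr cmeasurable; apply/funext => x; rewrite mulN1r.
  have Dcvg x : D ^~ x @ \oo --> (normc (F x - w j x) ^+ 2)%:E.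
    apply: cvg_EFin; first exact: nearW.
    rewrite normc_sqr.
    rewrite (_ : fine \o _ = fun k => (complex.Re (w k x) - complex.Re (w j x)) ^+ 2
        + (complex.Im (w k x) - complex.Im (w j x)) ^+ 2); last first.
      by apply/funext => k /=; rewrite normc_sqr; case: (w k x) (w j x) => [? ?] [? ?].
    rewrite (_ : complex.Re (F x - w j x) = complex.Re (F x) - complex.Re (w j x)); last first.
      by case: (F x) (w j x) => [? ?] [? ?].
    rewrite (_ : complex.Im (F x - w j x) = complex.Im (F x) - complex.Im (w j x)); last first.
      by case: (F x) (w j x) => [? ?] [? ?].
    by apply: cvgD; apply: cvgM; apply: cvgB => //; exact: cvg_cst.
  (* Fatou's lemma: the integral of the pointwise limit is at most the lower limit of the square
     norms of [v k - v j], and each tail infimum is bounded by its term of index [j + k]. *)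
  rewrite /sqnorm (eq_integral (fun x => limn_einf (D ^~ x))); last first.
    by move=> x _; rewrite (cvg_limn_einf_sup (Dcvg x)).1.
  apply: le_trans (fatou _ _ _ _) _ => //.
  - by move=> k; apply/measurable_EFinP/measurable_normc2.
  - by move=> k x _; rewrite lee_fin sqr_ge0.
  rewrite limn_einf_lim; apply: lime_le; first exact: is_cvg_einfs.
  apply: nearW => k; apply: (@le_trans _ _ (\int[mu]_x D (j + k)%N x)%E).
    by apply: ereal_inf_lbound; exists (j + k)%N => //=; exact: leq_addl.
  have -> : (\int[mu]_x D (j + k)%N x = (hnorm (v (j + k)%N - v j) ^+ 2)%:E)%E.
    rewrite -sqnorm_rep_sub; apply: ae_eq_integral => //.
    - by apply/measurable_EFinP/measurable_normc2.
    - by apply/measurable_EFinP/measurable_normc2; exact: cmeasurable_rep_sub.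
    - by apply: filterS2 (aew (j + k)%N) (aew j) => x xw xj _; rewrite /D xw xj.
  rewrite lee_fin ler_sqr_ge0 ?hnorm_ge0 ?mulr_ge0 ?exprn_ge0//.
  rewrite hdistC; apply: le_trans (dist j k) _.
  by rewrite gerBl mulr_ge0// exprn_ge0.
have FL : F \in L2pred mu.
  rewrite (_ : F = fun x => 1 * (F x - w 0%N x) + w 0%N x); last first.
    by apply/funext => x; rewrite mul1r subrK.
  apply: L2pred_linear => //; apply/L2predP; split.
    have := cmeasurableD mF (cmeasurableM (cmeasurable_cst T (-1)) (mw 0%N)).
    by congr cmeasurable; apply/funext => x; rewrite mulN1r.
  by apply: le_lt_trans (key 0%N) _; rewrite ltry.
exists (L2_class mu F) => // k.
rewrite -(@ler_sqr_ge0 R) ?hnorm_ge0 ?mulr_ge0 ?exprn_ge0//.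
rewrite -lee_fin; apply: le_trans (key k).
rewrite -sqnorm_rep_sub.
have := @le_sqnorm _ _ _ mu 1 (fun x => L2_rep (v k) x - L2_rep (L2_class mu F) x)
  (fun x => F x - w k x); rewrite expr1n mul1e; apply.
- exact: cmeasurable_rep_sub.
- have := cmeasurableD mF (cmeasurableM (cmeasurable_cst T (-1)) (mw k)).
  by congr cmeasurable; apply/funext => x; rewrite mulN1r.
- apply: filterS2 (aew k) (L2_classE FL) => x wx Fx.
  by rewrite wx -Fx mul1r -[leLHS]normcN opprB.
Qed.
End fast.

Lemma exprn_half_small (e : R) : 0 < e -> exists k, 2^-1 ^+ k < e.
Proof.
move=> e0; have : (fun k => (2^-1 : R) ^+ k) @ \oo --> 0.
  by apply: cvg_expr; rewrite ger0_norm//; lra.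
move/cvgrPdist_lt => /(_ e e0) [k _ /(_ k (leqnn _))] /=.
by rewrite sub0r normrN ger0_norm ?exprn_ge0//; exists k.
Qed.

Lemma L2_complete (u : nat -> L2 mu) :
  (forall e : R, 0 < e -> exists N, forall i j, (N <= i)%N -> (N <= j)%N ->
     hnorm (u i - u j) < e) ->
  exists l : L2 mu, forall e : R, 0 < e -> exists N, forall i, (N <= i)%N ->
     hnorm (u i - l) < e.
Proof.
move=> cu.
have /choice[N uN] : forall k, exists N, forall i j, (N <= i)%N -> (N <= j)%N ->
    hnorm (u i - u j) < 2^-1 ^+ k.
  by move=> k; apply: cu; rewrite exprn_gt0.
(* [N] need not be monotone; with partial sums both [phi k] and [phi k.+1] lie above [N k], so
   consecutive terms of the subsequence are 2^-k close. *)
pose phi k := (\sum_(i < k.+1) N i)%N.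
have phiN k : (N k <= phi k)%N by rewrite /phi big_ord_recr leq_addl.
have phiS k : (N k <= phi k.+1)%N.
  by rewrite /phi big_ord_recr/=; apply: leq_trans (phiN k) _; exact: leq_addr.
have [l ul _] := @fast_cauchy_cvg (fun k => u (phi k)) (fun k =>
  ltW (uN k _ _ (phiS k) (phiN k))).
exists l => e e0; have [k ke] := exprn_half_small (divr_gt0 e0 (ltr0n R 3)).
exists (N k) => i Ni; apply: le_lt_trans (hdist_triangle _ (u (phi k)) _) _.
have := uN k _ _ Ni (phiN k); have := ul k; lra.
Qed.
End riesz_fischer.

(** Required for L2 to be the [cr_space] of a covariant representation. *)
HB.instance Definition _ d (T : measurableType d) (R : realType)
    (mu : {measure set T -> \bar R}) :=
  PreHilbert_isComplete.Build R (L2 mu) (@L2_complete d T R mu).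

(** * Multiplication and translation operators *)

Section multiplication.
Context (R : realType) (n : nat) (mu : {measure set 'rV[R]_n -> \bar R}).
Implicit Types (w : 'rV[R]_n -> R[i]) (u v : L2 mu).

Definition bmeasurable w : Prop :=
  cmeasurable w /\ exists C : R, forall p, normc (w p) <= C.

Local Notation M w := (multiplication mu mu w).

Lemma mult_pred w u : bmeasurable w -> (fun p => w p * L2_rep u p) \in L2pred mu.
Proof.
move=> [mw [C wC]]; apply: (@L2pred_dom _ _ _ _ C _ (L2_rep u)).
- by apply: cmeasurableM => //; exact: L2_repM.
- exact: L2_rep_pred.
- by apply: aeW => p; rewrite normcM ler_wpM2r ?normc_ge0.
Qed.

Lemma mult_rep w u : bmeasurable w ->
  {ae mu, forall p, L2_rep (M w u) p = w p * L2_rep u p}.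
Proof. by move=> bw; apply: filterS (L2_classE (mult_pred u bw)) => p ->. Qed.

Lemma mult_linear w : bmeasurable w -> linear (M w).
Proof.
move=> bw a u v; apply: L2_ext.
near=> p; rewrite (near (mult_rep (a *: u + v) bw) p)//.
rewrite -(near (L2_rep_linear a (M w u) (M w v)) p)//.
rewrite -(near (L2_rep_linear a u v) p)//.
rewrite (near (mult_rep u bw) p)// (near (mult_rep v bw) p)//; ring.
Unshelve. all: by end_near. Qed.

Lemma mult_bound w (C : R) u : bmeasurable w -> 0 <= C ->
  (forall p, normc (w p) <= C) -> hnorm (M w u) <= C * hnorm u.
Proof.
move=> bw C0 wC; apply: le_hnorm => //; apply: filterS (mult_rep u bw) => p ->.
by rewrite normcM ler_wpM2r ?normc_ge0.
Qed.

Lemma mult_bounded w : bmeasurable w -> bounded_op (M w).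
Proof.
move=> bw; split; first exact: mult_linear.
have [mw [C wC]] := bw; exists C => u; apply: mult_bound => //.
by apply: le_trans (wC 0); exact: normc_ge0.
Qed.

Lemma bmeasurableM w w' : bmeasurable w -> bmeasurable w' ->
  bmeasurable (fun p => w p * w' p).
Proof.
move=> [mw [C wC]] [mw' [C' wC']]; split; first exact: cmeasurableM.
exists (C * C') => p; rewrite normcM ler_pM ?normc_ge0//.
Qed.

Lemma bmeasurableD w w' : bmeasurable w -> bmeasurable w' ->
  bmeasurable (fun p => w p + w' p).
Proof.
move=> [mw [C wC]] [mw' [C' wC']]; split; first exact: cmeasurableD.
by exists (C + C') => p; apply: le_trans (le_normcD _ _) _; exact: lerD.
Qed.

Lemma bmeasurable_cst c : bmeasurable (fun=> c).
Proof. by split; [exact: cmeasurable_cst|exists (normc c)]. Qed.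

Lemma bmeasurableZ c w : bmeasurable w -> bmeasurable (fun p => c * w p).
Proof. exact/bmeasurableM/bmeasurable_cst. Qed.

Lemma bmeasurableB w w' : bmeasurable w -> bmeasurable w' ->
  bmeasurable (fun p => w p - w' p).
Proof.
move=> bw /(bmeasurableZ (-1)) /(bmeasurableD bw).
by congr bmeasurable; apply/funext => p; rewrite mulN1r.
Qed.

Lemma bmeasurable_conj w : bmeasurable w -> bmeasurable (fun p => (w p)^*).
Proof.
move=> [mw [C wC]]; split; first exact: cmeasurable_conj.
by exists C => p; rewrite normc_conj.
Qed.

Lemma multM w w' : bmeasurable w -> bmeasurable w' ->
  M w \o M w' = M (fun p => w p * w' p).
Proof.
move=> bw bw'; apply/funext => u; apply: L2_ext; near=> p.
rewrite (near (mult_rep (M w' u) bw) p)// (near (mult_rep u bw') p)//.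
by rewrite (near (mult_rep u (bmeasurableM bw bw')) p)// mulrA.
Unshelve. all: by end_near. Qed.

Lemma mult_lin c w w' : bmeasurable w -> bmeasurable w' ->
  M (fun p => c * w p + w' p) = c *: M w + M w'.
Proof.
move=> bw bw'; apply/funext => u; rewrite [RHS](_ : _ = c *: M w u + M w' u)//.
apply: L2_ext; near=> p.
rewrite (near (mult_rep u (bmeasurableD (bmeasurableZ c bw) bw')) p)//.
rewrite -(near (L2_rep_linear c (M w u) (M w' u)) p)//.
rewrite (near (mult_rep u bw) p)// (near (mult_rep u bw') p)//; ring.
Unshelve. all: by end_near. Qed.

Lemma multD w w' : bmeasurable w -> bmeasurable w' ->
  M (fun p => w p + w' p) = M w + M w'.
Proof.
move=> bw bw'; rewrite -[M w]scale1r -mult_lin//.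
by congr (M _); apply/funext => p; rewrite mul1r.
Qed.

Lemma mult1 : M (fun=> 1) = id.
Proof.
apply/funext => u; apply: L2_ext; apply: filterS (mult_rep u (bmeasurable_cst 1)).
by move=> p ->; rewrite mul1r.
Qed.

Lemma mult_cst c : M (fun=> c) = c *: (id : L2 mu -> L2 mu).
Proof.
have := mult_lin c (bmeasurable_cst 1) (bmeasurable_cst 0).
have -> : M (fun=> 0) = 0.
  apply/funext => u; apply: L2_ext.
  apply: filterS2 (mult_rep u (bmeasurable_cst 0)) (L2_rep0 mu).
  by move=> p -> ->; rewrite mul0r.
rewrite mult1 => E; transitivity (c *: (id : L2 mu -> L2 mu) + 0); last by rewrite addr0.
by rewrite -E; congr (M _); apply/funext => p; rewrite mulr1 addr0.
Qed.

Lemma multB w w' : bmeasurable w -> bmeasurable w' ->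
  M (fun p => w p - w' p) = M w - M w'.
Proof.
move=> bw bw'; rewrite addrC -scaleN1r -mult_lin//.
by congr (M _); apply/funext => p; rewrite mulN1r addrC.
Qed.

Lemma mult_adjoint w : bmeasurable w -> is_adjoint (M w) (M (fun p => (w p)^*)).
Proof.
move=> bw u v; have bw' := bmeasurable_conj bw.
rewrite -{1}(L2_repK v) -{2}(L2_repK u) [M w u]/L2_class.
rewrite !hdot_class ?mult_pred ?L2_rep_pred//.
have E p : w p * L2_rep u p * (L2_rep v p)^* = L2_rep u p * ((w p)^* * L2_rep v p)^*.
  case: (w p) (L2_rep u p) (L2_rep v p) => [? ?] [? ?] [? ?].
  by apply/eqP; rewrite eq_complex /=; apply/andP; split; apply/eqP; ring.
by congr (_ +i* _); apply: eq_Rintegral => p _; rewrite E.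
Qed.

End multiplication.

Section translation.
Context (R : realType) (n : nat).
Local Notation mu := (lebesgue_rV R n).
Implicit Types (w : 'rV[R]_n -> R[i]) (a b : 'rV[R]_n) (u v : L2 mu).
Local Notation M w := (multiplication mu mu w).
Local Notation V a := (translation mu a).

Lemma cmeasurable_shift w a : cmeasurable w ->
  cmeasurable (fun p : 'rV[R]_n => w (p - a)).
Proof.
by move=> [m1 m2]; split; [apply: (measurableT_comp m1)|apply: (measurableT_comp m2)];
  exact: measurable_rV_addr.
Qed.

Lemma bmeasurable_shift w a : bmeasurable w -> bmeasurable (fun p => w (p - a)).
Proof. by move=> [mw [C wC]]; split; [exact: cmeasurable_shift|exists C]. Qed.

Lemma sqnorm_shift w a : cmeasurable w -> sqnorm mu (fun p => w (p - a)) = sqnorm mu w.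
Proof.
move=> mw; apply: (@ge0_integral_shift _ _ (- a) (fun p => (normc (w p) ^+ 2)%:E)).
  by apply/measurable_EFinP; exact: measurable_normc2.
by move=> p; rewrite lee_fin sqr_ge0.
Qed.

Lemma trans_pred a u : (fun p => L2_rep u (p - a)) \in L2pred mu.
Proof.
have /L2predP[mu_ fu] := L2_rep_pred u.
by apply/L2predP; split; [exact: cmeasurable_shift|rewrite sqnorm_shift].
Qed.

Lemma trans_rep a u : {ae mu, forall p, L2_rep (V a u) p = L2_rep u (p - a)}.
Proof. by apply: filterS (L2_classE (trans_pred a u)) => p ->. Qed.

Lemma trans_linear a : linear (V a).
Proof.
move=> c u v; apply: L2_ext; near=> p.
rewrite (near (trans_rep a (c *: u + v)) p)//.
rewrite -(near (L2_rep_linear c (V a u) (V a v)) p)//.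
rewrite (near (trans_rep a u) p)// (near (trans_rep a v) p)//.
by rewrite -(near (ae_shift (- a) (L2_rep_linear c u v)) p).
Unshelve. all: by end_near. Qed.

Lemma trans_hnorm a u : hnorm (V a u) = hnorm u.
Proof.
apply: (pexpIrn (n := 2)) => //; rewrite ?nnegrE ?hnorm_ge0//; apply/EFin_inj.
rewrite hnorm_class ?trans_pred// sqnorm_shift ?hnorm_rep//; exact: L2_repM.
Qed.

Lemma trans_unitary a u v : hdot (V a u) (V a v) = hdot u v.
Proof. by apply: linear_isometry_hdot; [exact: trans_linear|exact: trans_hnorm]. Qed.

Lemma transD a b : V (a + b) = V a \o V b.
Proof.
apply/funext => u; apply: L2_ext; near=> p.
rewrite (near (trans_rep (a + b) u) p)// (near (trans_rep a (V b u)) p)//.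
by rewrite (near (ae_shift (- a) (trans_rep b u)) p)// opprD addrA.
Unshelve. all: by end_near. Qed.

Lemma trans0 : V 0 = id.
Proof.
apply/funext => u; apply: L2_ext; apply: filterS (trans_rep 0 u) => p ->.
by rewrite subr0.
Qed.

Lemma trans_adjoint a : is_adjoint (V a) (V (- a)).
Proof.
move=> u v; rewrite -[in RHS](trans_unitary a).
by rewrite -[V a (V (- a) v)]/((V a \o V (- a)) v) -transD subrr trans0.
Qed.

Lemma trans_mult a w : bmeasurable w -> V a \o M w = M (fun p => w (p - a)) \o V a.
Proof.
move=> bw; apply/funext => u; apply: L2_ext; near=> p.
rewrite (near (trans_rep a (M w u)) p)//.
rewrite (near (ae_shift (- a) (mult_rep u bw)) p)//.
rewrite (near (mult_rep (V a u) (bmeasurable_shift a bw)) p)//.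
by rewrite (near (trans_rep a u) p).
Unshelve. all: by end_near. Qed.

End translation.

(** * A lattice form of the Stone-Weierstrass theorem *)

Section stone_weierstrass.
Context (R : realType) (X : ptopologicalType) (W : set (X -> R)).
Hypothesis Wcont : forall f, W f -> continuous f.
Hypothesis Wbnd : forall f, W f -> exists C : R, forall x, `|f x| <= C.
Hypothesis W1 : W (fun=> 1).
Hypothesis WD : forall f g, W f -> W g -> W (fun x => f x + g x).
Hypothesis WZ : forall (a : R) f, W f -> W (fun x => a * f x).
Hypothesis WM : forall f g, W f -> W g -> W (fun x => f x * g x).
Hypothesis Wlim : forall f : X -> R, continuous f ->
  (forall e : R, 0 < e -> exists2 g, W g & forall x, `|f x - g x| <= e) -> W f.
Hypothesis peak : forall q (U : set X), nbhs q U -> exists h,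
  [/\ W h, (forall x, 0 <= h x), h q = 0 &
      exists2 c : R, 0 < c & forall x, ~ U x -> c <= h x].

Let Wcst (a : R) : W (fun=> a).
Proof. by have := WZ a W1; congr W; apply/funext => x; rewrite mulr1. Qed.

Let WB f g : W f -> W g -> W (fun x => f x - g x).
Proof.
move=> Wf /(WZ (-1)) /(WD Wf); congr W; apply/funext => x.
by rewrite mulN1r.
Qed.

(* Polynomials in [y ^+ 2] that increase to [`|y|] for [`|y| <= 1]. *)
Fixpoint abs_approx (y : R) k : R :=
  if k is k'.+1 then abs_approx y k' + (y ^+ 2 - abs_approx y k' ^+ 2) / 2 else 0.

(** With z = |y| and a the k-th approximant, one step multiplies the error z - a by 1 - (z + a) / 2
    <= 1 - z / 2. The third bound propagates because (1 - z / 2) (1 + (k + 1) z / 2) <= 1 + k z /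
    2. *)
Lemma abs_approx_bound (y : R) k : `|y| <= 1 ->
  [/\ 0 <= abs_approx y k, abs_approx y k <= `|y| &
      (`|y| - abs_approx y k) * (1 + k%:R * (`|y| / 2)) <= `|y|].
Proof.
move=> y1; have y2 : y ^+ 2 = `|y| ^+ 2 by rewrite real_normK// num_real.
have y0 : 0 <= `|y| by [].
elim: k => [|k [a0 ay IH]] /=; first by split; rewrite // subr0 mul0r addr0 mulr1.
rewrite y2; set z := `|y| in y0 y1 a0 ay IH *; set a := abs_approx y k in a0 ay IH *.
have k0 : 0 <= k%:R :> R by [].
have E : z - (a + (z ^+ 2 - a ^+ 2) / 2) = (z - a) * (1 - (z + a) / 2) by field.
have za : 0 <= z - a by rewrite subr_ge0.
split.
- by rewrite addr_ge0// divr_ge0// subr_ge0 ler_sqr_ge0.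
- rewrite -subr_ge0 E mulr_ge0//; lra.
rewrite E; apply: le_trans IH; rewrite -mulrA ler_wpM2l//.
have -> : k.+1%:R = k%:R + 1 :> R by rewrite natr1.
apply: (@le_trans _ _ ((1 - z / 2) * (1 + (k%:R + 1) * (z / 2)))).
  rewrite ler_wpM2r//; last lra.
  by rewrite addr_ge0// mulr_ge0//; lra.
have : 0 <= (k%:R + 1) * (z ^+ 2) by rewrite mulr_ge0 ?sqr_ge0//; lra.
rewrite expr2 => H; nra.
Qed.

(** Cancelling |y| in the third bound of [abs_approx_bound] makes the rate independent of [y], as a
    uniform approximation requires. *)
Lemma abs_approx_near (y : R) k : `|y| <= 1 -> `| `|y| - abs_approx y k.+1 | <= 2 / k.+1%:R.
Proof.
move=> y1; have [a0 ay H] := abs_approx_bound k.+1 y1.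
rewrite ger0_norm ?subr_ge0//.
have [y0|y0] := eqVneq `|y| 0.
  by rewrite y0 sub0r; apply: (@le_trans _ _ 0); [rewrite oppr_le0|rewrite divr_ge0].
have yp : 0 < `|y| by rewrite lt_neqAle eq_sym y0 normr_ge0.
rewrite ler_pdivlMr ?ltr0n// -(ler_pM2r yp).
have : 0 <= `|y| - abs_approx y k.+1 by rewrite subr_ge0.
move: H; rewrite mulrDr mulr1; set z := `|y|; set a := abs_approx y k.+1; nra.
Qed.

Lemma stone_abs f : W f -> W (fun x => `|f x|).
Proof.
move=> Wf; have [C fC] := Wbnd Wf.
pose D := `|C| + 1; have D0 : 0 < D by rewrite ltr_wpDl.
have fD x : `|f x / D| <= 1.
  rewrite normrM normfV (ger0_norm (ltW D0)) ler_pdivrMr// mul1r.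
  by apply: le_trans (fC x) _; apply: le_trans (ler_norm _) _; rewrite /D lerDl.
have Wy : W (fun x => f x / D).
  by have := WZ D^-1 Wf; congr W; apply/funext => x; rewrite mulrC.
have Wa k : W (fun x => abs_approx (f x / D) k).
  elim: k => [|k IH]; first exact: Wcst.
  apply: WD => //; have := WZ 2^-1 (WB (WM Wy Wy) (WM IH IH)).
  by congr W; apply/funext => x; rewrite mulrC -!expr2.
have : W (fun x => `|f x / D|).
  apply: Wlim => [x|e e0].
    apply: (@continuous_comp _ _ _ (fun x => f x / D) (fun y : R => `|y|)).
      exact: Wcont.
    exact: norm_continuous.
  have [k ke] : exists k : nat, 2 / k.+1%:R < e.
    exists (Num.truncn (2 / e)); rewrite ltr_pdivrMr ?ltr0n// mulrC -ltr_pdivrMr//.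
    exact: truncnS_gt.
  exists (fun x => abs_approx (f x / D) k.+1) => // x.
  by apply: le_trans (abs_approx_near _ (fD x)) _; exact: ltW.
move/(WZ D); congr W; apply/funext => x.
by rewrite normrM normfV (ger0_norm (ltW D0)) mulrC divfK ?gt_eqF.
Qed.

Lemma stone_max f g : W f -> W g -> W (fun x => Num.max (f x) (g x)).
Proof.
move=> Wf Wg; have := WZ 2^-1 (WD (WD Wf Wg) (stone_abs (WB Wf Wg))).
by congr W; apply/funext => x; rewrite maxr_absE mulrC.
Qed.

(** Around each q a bump max(f q - L h, 0) built on a peak [h] stays below f + e everywhere and
    exceeds f - e near q. Finitely many bumps serve the compact set outside which f < e, and their
    maximum is within e of f. Since bumps are nonnegative, nothing has to be arranged outside that
    set. *)
Lemma stone_ge0 (f : X -> R) : continuous f -> (forall x, 0 <= f x) ->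
  (forall e : R, 0 < e -> exists2 K : set X, compact K & forall x, ~ K x -> f x < e) ->
  W f.
Proof.
move=> cf f0 fK; apply: Wlim => // e e0; have [K cK Ke] := fK e e0.
have /choice[g gP] q : exists g, [/\ W g, (forall x, 0 <= g x),
    (forall x, g x <= f x + e) & f q - e < g q].
  have /peak[h [Wh h0 hq [c c0 hc]]] : nbhs q [set x | f q < f x + e].
    have /cvgrPdist_lt /(_ e e0) := cf q; apply: filterS => x /=.
    by rewrite ltr_norml => /andP[_]; lra.
  (* This slope makes f q - L h nonpositive wherever h >= c, that is, outside the neighbourhood on
     which f q < f + e. *)
  pose L := f q / c; have L0 : 0 <= L by rewrite divr_ge0// ltW.
  exists (fun x => Num.max (f q - L * h x) 0); split.
  - by apply: stone_max => //; apply: WB => //; exact: WZ.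
  - by move=> x; rewrite le_max lexx orbT.
  - move=> x; rewrite ge_max; apply/andP; split; last by apply: addr_ge0 (f0 x) (ltW e0).
    have [xU|/hc ch] := pselect (f q < f x + e).
      by have := mulr_ge0 L0 (h0 x); lra.
    have : f q <= L * h x by rewrite -[leLHS](divfK (lt0r_neq0 c0)) ler_wpM2l.
    by have := f0 x; lra.
  - by rewrite hq mulr0 subr0 lt_max ltrBlDr ltrDl e0.
have cg q : continuous (g q) by apply: Wcont; case: (gP q).
have [D' _ KD'] : exists2 D' : {fset X}, {subset D' <= [set: X]} &
    K `<=` cover [set` D'] (fun q => [set x | f x - e < g q x]).
  move: cK; rewrite compact_cover => cK.
  apply: cK.
  - move=> q _; rewrite (_ : [set x | _] = (fun x => g q x - f x) @^-1` [set y | - e < y]).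
      apply: open_comp; last exact: open_gt.
      by move=> x _; apply: continuousB; [exact: cg|exact: cf].
    by apply/seteqP; split => x /=; lra.
  - by move=> q Kq; exists q => //=; case: (gP q).
have [G [WG G0 Gf gG]] : exists G, [/\ W G, (forall x, 0 <= G x),
    (forall x, G x <= f x + e) & forall q, q \in (D' : seq X) -> forall x, g q x <= G x].
  elim: (D' : seq X) => [|q s [G [WG G0 Gf gG]]].
    exists (fun=> 0); split => //.
    by move=> x; apply: addr_ge0 (f0 x) (ltW e0).
  have [Wg g0 gf _] := gP q.
  exists (fun x => Num.max (g q x) (G x)); split.
  - exact: stone_max.
  - by move=> x; rewrite le_max g0.
  - by move=> x; rewrite ge_max gf Gf.
  - move=> r; rewrite inE => /orP[/eqP ->|rs] x; first by rewrite le_max lexx.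
    by rewrite le_max gG ?orbT.
exists G => // x; rewrite ler_norml lerBrDl addrC -lerBrDr; apply/andP; split; last first.
  have [Kx|nKx] := pselect (K x); last by have := Ke x nKx; have := G0 x; lra.
  have [q /= qD] := KD' x Kx.
  by have := gG q qD x; lra.
by have := Gf x; lra.
Qed.
End stone_weierstrass.

(** * The algebra generated by the conjugated translations *)

Section complex_continuity.
Context (R : realType) (X : topologicalType).
Implicit Types f : X -> R[i].

Lemma normcB_le (z w : R[i]) : normc (z - w) <=
  `|complex.Re z - complex.Re w| + `|complex.Im z - complex.Im w|.
Proof.
case: z w => [a b] [c d] /=; rewrite -(@ler_sqr_ge0 R) ?sqrtr_ge0 ?addr_ge0//.
rewrite sqr_sqrtr ?addr_ge0 ?sqr_ge0// [leRHS]sqrrD !real_normK ?num_real//.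
by rewrite -addrA lerD2l lerDr mulrn_wge0// mulr_ge0.
Qed.

Lemma Re_dist_le (z w : R[i]) : `|complex.Re z - complex.Re w| <= normc (z - w).
Proof.
case: z w => [a b] [c d] /=; rewrite -sqrtr_sqr ler_sqrt ?addr_ge0 ?sqr_ge0//.
by rewrite lerDl sqr_ge0.
Qed.

Lemma Im_dist_le (z w : R[i]) : `|complex.Im z - complex.Im w| <= normc (z - w).
Proof.
case: z w => [a b] [c d] /=; rewrite -sqrtr_sqr ler_sqrt ?addr_ge0 ?sqr_ge0//.
by rewrite lerDr sqr_ge0.
Qed.

Lemma complex_continuousP f : continuous (f : X -> (R[i] : numFieldType)) <->
  (forall x (e : R), 0 < e -> \forall y \near x, normc (f x - f y) < e).
Proof.
split=> [cf x e e0|cf x].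
  have /cvgrPdist_lt /(_ e%:C) := cf x; rewrite ltcR => /(_ e0).
  by apply: filterS => y /=; rewrite ltcR.
apply/cvgrPdist_lt => /= e e0.
have eE : (complex.Re e)%:C = e by rewrite RRe_real// gtr0_real.
rewrite -eE; move: e0; rewrite -eE ltcR => e0.
by apply: filterS (cf x _ e0) => y; rewrite -ltcR.
Qed.

Lemma complex_continuous_ReIm f : continuous (f : X -> (R[i] : numFieldType)) <->
  continuous (fun x => complex.Re (f x)) /\ continuous (fun x => complex.Im (f x)).
Proof.
split=> [/complex_continuousP cf|[c1 c2]].
  split=> x; apply/cvgrPdist_lt => e e0; apply: filterS (cf x e e0) => y /=.
    exact: le_lt_trans (Re_dist_le _ _).
  exact: le_lt_trans (Im_dist_le _ _).
apply/complex_continuousP => x e e0.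
have /cvgrPdist_lt /(_ (e / 2)) H1 := c1 x; have /cvgrPdist_lt /(_ (e / 2)) H2 := c2 x.
have e2 : 0 < e / 2 by rewrite divr_gt0.
apply: filterS2 (H1 e2) (H2 e2) => y /= d1 d2.
by apply: le_lt_trans (normcB_le _ _) _; lra.
Qed.

Lemma continuous_normc f : continuous (f : X -> (R[i] : numFieldType)) ->
  continuous (fun x => normc (f x)).
Proof.
move=> /complex_continuousP cf x; apply/cvgrPdist_lt => e e0.
apply: filterS (cf x e e0) => y /=; apply: le_lt_trans.
have H (z w : R[i]) : normc z - normc w <= normc (z - w).
  by have := le_normcD (z - w) w; rewrite subrK lerBlDr.
rewrite ler_norml H andbT lerNl opprB; apply: le_trans (H _ _) _.
by rewrite -[leLHS]normcN opprB.
Qed.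

Lemma C0_setP f : C0_set f <->
  [/\ continuous (fun x => complex.Re (f x)), continuous (fun x => complex.Im (f x)) &
      forall e : R, 0 < e -> exists2 K : set X, compact K & forall x, ~ K x -> normc (f x) < e].
Proof.
split=> [[/complex_continuous_ReIm[c1 c2] vf]|[c1 c2 vf]].
  split=> // e /vf[K cK Kf]; exists K => // x /Kf; by rewrite ltcR.
split; first exact/complex_continuous_ReIm.
by move=> e /vf[K cK Kf]; exists K => // x /Kf; rewrite ltcR.
Qed.

Lemma C0_real (h : X -> R) : continuous h ->
  (forall e : R, 0 < e -> exists2 K : set X, compact K & forall x, ~ K x -> `|h x| < e) ->
  C0_set (fun x => (h x)%:C).
Proof.
move=> ch hK; apply/C0_setP; split => //; first by move=> x; exact: cvg_cst.
by move=> e /hK[K cK Kh]; exists K => // x /Kh; rewrite normc_real.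
Qed.

Lemma C0_bounded f : C0_set f -> exists C : R, forall x, normc (f x) <= C.
Proof.
move=> f0; have [cf _] := f0; have /C0_setP[_ _ /(_ 1 ltr01)[K cK Kf]] := f0.
have : compact ((fun x => normc (f x)) @` K).
  by apply: continuous_compact => //; apply: continuous_subspaceT; exact: continuous_normc.
move/compact_bounded => [M [_ KM]].
exists (Num.max (M + 1) 1) => x; rewrite le_max.
have [Kx|/Kf/ltW ->] := pselect (K x); last by rewrite orbT.
apply/orP; left; apply: le_trans (ler_norm _) _.
by apply: (KM (M + 1)); [rewrite ltrDl|exists x].
Qed.
End complex_continuity.

Section C0_rV.
Context (R : realType) (n : nat).

Lemma C0_bmeasurable (f : 'rV[R]_n -> R[i]) : C0_set f -> bmeasurable f.
Proof.
move=> f0; split; last exact: C0_bounded.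
by have /C0_setP[c1 c2 _] := f0; split; exact: continuous_measurable_rV.
Qed.

Lemma continuous_coord (i : 'I_n) : continuous (fun p : 'rV[R]_n => p ord0 i).
Proof. by move=> p; exact: coord_continuous. Qed.

Lemma rV_norm_le (p : 'rV[R]_n) (c : R) : 0 <= c -> (forall i, `|p ord0 i| <= c) -> `|p| <= c.
Proof.
move=> c0 pc; rewrite [leLHS]/Num.norm/= mx_normrE; apply: bigmax_le => // -[i j] _ /=.
by rewrite (ord1 i).
Qed.

Lemma rV_coord_le (p : 'rV[R]_n) i : `|p ord0 i| <= `|p|.
Proof.
rewrite [leRHS]/Num.norm/= mx_normrE.
exact: (@le_bigmax _ _ _ 0 (fun x : 'I_1 * 'I_n => `|p x.1 x.2|) (ord0, i)).
Qed.
End C0_rV.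

(** * The energy and the weights of the conjugated translations *)

Section energy.
Context (R : realType) (n : nat) (m : R).
Hypothesis m_gt0 : 0 < m.
Implicit Types p q a : 'rV[R]_n.

Definition sqn p : R := \sum_(i < n) p ord0 i ^+ 2.
Local Notation E := (@energy R n m).

Lemma sqn_ge0 p : 0 <= sqn p.
Proof. by apply: sumr_ge0 => i _; exact: sqr_ge0. Qed.

Lemma energy_sqr p : E p ^+ 2 = sqn p + m ^+ 2.
Proof. by rewrite sqr_sqrtr// addr_ge0 ?sqn_ge0 ?sqr_ge0. Qed.

Lemma energy_ge p : m <= E p.
Proof.
rewrite -(@ler_sqr_ge0 R) ?sqrtr_ge0 ?(ltW m_gt0)// energy_sqr lerDr; exact: sqn_ge0.
Qed.

Lemma energy_gt0 p : 0 < E p.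
Proof. exact: lt_le_trans (energy_ge p). Qed.

Lemma sqn_coord_le p i : p ord0 i ^+ 2 <= sqn p.
Proof. by rewrite /sqn (bigD1 i)//= lerDl sumr_ge0// => j _; exact: sqr_ge0. Qed.

Lemma coord_le_energy p i : `|p ord0 i| <= E p.
Proof.
rewrite -(@ler_sqr_ge0 R) ?sqrtr_ge0// energy_sqr real_normK ?num_real//.
by apply: le_trans (sqn_coord_le p i) _; rewrite lerDl sqr_ge0.
Qed.

Lemma sqnB p a : sqn (p - a) = sqn p + sqn a - 2 * \sum_(i < n) p ord0 i * a ord0 i.
Proof.
rewrite /sqn mulr_sumr -big_split/= -sumrB; apply: eq_bigr => i _.
by rewrite !mxE; ring.
Qed.

Lemma sqn_le p q : sqn p <= 2 * sqn (p - q) + 2 * sqn q.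
Proof.
rewrite /sqn !mulr_sumr -big_split/=; apply: ler_sum => i _; rewrite !mxE.
have := sqr_ge0 (p ord0 i - 2 * q ord0 i); nra.
Qed.

Lemma continuous_sqn : continuous sqn.
Proof.
apply: continuous_big => [|i _]; first exact: add_continuous.
by move=> p; apply: (@continuousM R 'rV[R]_n); exact: continuous_coord.
Qed.

Lemma continuous_energy : continuous E.
Proof.
move=> p; apply: (@continuous_comp _ _ _ (fun p => sqn p + m ^+ 2) Num.sqrt).
  by apply: (@continuousD R R 'rV[R]_n); [exact: continuous_sqn|exact: cst_continuous].
exact: sqrt_continuous.
Qed.

Lemma continuous_rV_shift a : continuous (fun p => p - a).
Proof.
move=> p; apply: (@continuousD R 'rV[R]_n 'rV[R]_n id (cst (- a))).
  exact: cvg_id.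
exact: cst_continuous.
Qed.

Lemma compact_energy (c : R) : compact [set p | E p <= c].
Proof.
apply: bounded_closed_compact; last first.
  have /continuous_closedP cE := continuous_energy.
  exact: (cE _ (@closed_le R c)).
exists `|c|; split; first exact: num_real.
move=> M cM p /= pc; apply: rV_norm_le => [|i].
  by apply: ltW; apply: le_lt_trans cM.
apply: le_trans (coord_le_energy p i) _; apply: le_trans pc _.
by apply: ltW; apply: le_lt_trans cM; exact: ler_norm.
Qed.

(* [conj_translation m a] is multiplication by [weight a] after translation by [a]. *)
Definition weight a p : R := Num.sqrt (E (p - a)) / Num.sqrt (E p).

Lemma sqrt_energy_gt0 p : 0 < Num.sqrt (E p).
Proof. by rewrite sqrtr_gt0 energy_gt0. Qed.

Lemma weight_gt0 a p : 0 < weight a p.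
Proof. by rewrite divr_gt0 ?sqrt_energy_gt0. Qed.

Lemma weight0 p : weight 0 p = 1.
Proof. by rewrite /weight subr0 divff// gt_eqF ?sqrt_energy_gt0. Qed.

(** An inverse weight is a translate of another weight, so that its convergence to 1 at infinity
    needs no estimate of its own. *)
Lemma weightV a p : (weight a p)^-1 = weight (- a) (p - a).
Proof. by rewrite /weight opprK subrK invfM invrK mulrC. Qed.

Lemma continuous_weight a : continuous (weight a).
Proof.
have cs : continuous (fun p => Num.sqrt (E p)).
  move=> p; apply: (@continuous_comp _ _ _ E Num.sqrt); first exact: continuous_energy.
  exact: sqrt_continuous.
move=> p; apply: (@continuousM R 'rV[R]_n).
  apply: (@continuous_comp 'rV[R]_n 'rV[R]_n R (fun p => p - a) (fun p => Num.sqrt (E p))).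
    exact: continuous_rV_shift.
  exact: cs.
by apply: (@continuousV R 'rV[R]_n); [rewrite gt_eqF ?sqrt_energy_gt0|exact: cs].
Qed.

Lemma weight_sqr a p : weight a p ^+ 2 = E (p - a) / E p.
Proof. by rewrite expr_div_n !sqr_sqrtr ?ltW ?energy_gt0. Qed.

Lemma weight4 a p : weight a p ^+ 2 ^+ 2 =
  1 + (sqn a - 2 * \sum_(i < n) p ord0 i * a ord0 i) / E p ^+ 2.
Proof.
have E0 : E p ^+ 2 != 0 by rewrite expf_neq0// gt_eqF ?energy_gt0.
rewrite weight_sqr expr_div_n (energy_sqr (p - a)) sqnB.
rewrite (_ : sqn p + _ - _ + _ = E p ^+ 2 + (sqn a - 2 * \sum_(i < n) p ord0 i * a ord0 i)).
  by rewrite [LHS]mulrDl divff.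
by rewrite energy_sqr; ring.
Qed.

(** Passing to fourth powers removes the roots: w^4 - 1 = (w - 1) (w + 1) (w^2 + 1) with the last
    two factors at least 1, and w^4 - 1 is the explicit fraction of [weight4]. *)
Lemma weight_dist a : exists2 C : R, 0 < C & forall p, `|weight a p - 1| <= C / E p.
Proof.
pose S := \sum_(i < n) `|a ord0 i|.
have S0 : 0 <= S by apply: sumr_ge0.
(* The first term uses E >= m on |a|^2 / E^2, the second |p.a| <= E S; the 1 only ensures
   positivity. *)
exists (sqn a / m + 2 * S + 1) => [|p].
  by rewrite ltr_wpDl// addr_ge0 ?mulr_ge0 ?invr_ge0 ?sqn_ge0 ?(ltW m_gt0).
have w0 := weight_gt0 a p; set w := weight a p in w0 *.
have E0 := energy_gt0 p; set e := E p in E0 *.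
have H1 : `|w - 1| <= `|w ^+ 2 ^+ 2 - 1|.
  rewrite (_ : w ^+ 2 ^+ 2 - 1 = (w - 1) * ((w + 1) * (w ^+ 2 + 1))); last by ring.
  rewrite normrM ler_peMr//; apply: le_trans (ler_norm _).
  by have := sqr_ge0 w; nra.
apply: le_trans H1 _; rewrite /w weight4 addrAC subrr add0r -/e.
rewrite normrM normfV (ger0_norm (sqr_ge0 e)) ler_pdivrMr ?exprn_gt0//.
rewrite (_ : _ / e * e ^+ 2 = (sqn a / m + 2 * S + 1) * e); last first.
  by field; rewrite !gt_eqF.
have H2 : `|\sum_(i < n) p ord0 i * a ord0 i| <= e * S.
  apply: le_trans (ler_norm_sum _ _ _) _; rewrite mulr_sumr; apply: ler_sum => i _.
  by rewrite normrM ler_wpM2r// coord_le_energy.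
have H3 : sqn a <= sqn a / m * e.
  rewrite -mulrA ler_peMr ?sqn_ge0// mulrC ler_pdivlMr// mul1r; exact: energy_ge.
apply: le_trans (ler_normB _ _) _.
rewrite (ger0_norm (sqn_ge0 a)) normrM (ger0_norm (ler0n _ 2)); nra.
Qed.

Lemma weight_C0 a : C0_set (fun p => (weight a p - 1)%:C).
Proof.
apply: C0_real.
  by move=> p; apply: (@continuousB R R 'rV[R]_n); [exact: continuous_weight|exact: cst_continuous].
move=> e e0; have [C C0 wC] := weight_dist a.
exists [set p | E p <= C / e]; first exact: compact_energy.
move=> p /negP; rewrite -ltNge => Ep; apply: le_lt_trans (wC p) _.
by rewrite ltr_pdivrMr ?energy_gt0// mulrC -ltr_pdivrMr.
Qed.

Lemma weightV_C0 a : C0_set (fun p => ((weight a p)^-1 - 1)%:C).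
Proof.
have := C0_shift_closed a (weight_C0 (- a)).
by congr C0_set; apply/funext => p; rewrite weightV.
Qed.

Lemma weight_bounded a : exists C : R, forall p, weight a p <= C.
Proof.
have [C C0 wC] := weight_dist a; exists (C / m + 1) => p.
have := le_trans (ler_norm _) (wC p); have : C / E p <= C / m.
  by rewrite ler_pM2l// lef_pV2 ?posrE ?energy_gt0// energy_ge.
lra.
Qed.
End energy.

Lemma real_complexB1K (R : realType) (x : R) : (x - 1)%:C + 1 = x%:C :> R[i].
Proof. by apply/eqP; rewrite eq_complex /= subrK addr0 !eqxx. Qed.

(** * Conjugated translations as weighted translations *)

Section conj_translation.
Context (R : realType) (n : nat) (m : R).
Hypothesis m_gt0 : 0 < m.
Local Notation mu := (lebesgue_rV R n).
Local Notation nu := (@dp_over_E R n m).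
Local Notation E := (@energy R n m).
Local Notation M w := (multiplication mu mu w).
Local Notation V a := (translation mu a).
Local Notation S p := (Num.sqrt (E p)).

Let nuE (A : set 'rV[R]_n) : measurable A ->
  (nu A = \int[mu]_(p in A) ((E p)^-1)%:E)%E.
Proof. by []. Qed.

Let iE_gt0 p : 0 < (E p)^-1. Proof. by rewrite invr_gt0 energy_gt0. Qed.

Lemma ae_dp_over_E (P : set 'rV[R]_n) :
  {ae nu, forall p, P p} <-> {ae mu, forall p, P p}.
Proof.
apply: (ae_density (g := fun p => (E p)^-1)) => //.
- exact: measurable_inv_energy.
- by move=> p; apply: ltW.
Qed.

Let mS : cmeasurable (fun p : 'rV[R]_n => (S p)%:C).
Proof.
apply: cmeasurable_real; apply: measurableT_comp (@measurable_energy R n m).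
exact: continuous_measurable_fun (@sqrt_continuous R).
Qed.

Let mSV : cmeasurable (fun p : 'rV[R]_n => (S p)^-1%:C).
Proof.
apply: cmeasurable_real.
rewrite (_ : (fun _ => _) = fun p => Num.sqrt ((E p)^-1)).
  apply: measurableT_comp (@measurable_inv_energy R n m).
  exact: continuous_measurable_fun (@sqrt_continuous R).
apply/funext => p; apply/eqP; rewrite -(eqrXn2 (n := 2)) ?invr_ge0 ?sqrtr_ge0//.
by rewrite exprVn !sqr_sqrtr// ltW ?energy_gt0 ?iE_gt0.
Qed.

(** Dividing by sqrt E absorbs the density 1 / E: on functions, this is the isometry behind
    [M_sqrtE_inv]. *)
Lemma L2pred_dp_over_E (f : 'rV[R]_n -> R[i]) : cmeasurable f ->
  f \in L2pred nu <-> (fun p => (S p)^-1%:C * f p) \in L2pred mu.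
Proof.
move=> mf; have E1 : sqnorm nu f = sqnorm mu (fun p => (S p)^-1%:C * f p).
  rewrite /sqnorm (ge0_integral_density (mu := mu) (g := fun p => (E p)^-1)) //.
  - apply: eq_integral => p _; congr EFin.
    rewrite normcM exprMn normc_real ger0_norm ?invr_ge0 ?sqrtr_ge0//.
    by rewrite exprVn sqr_sqrtr 1?mulrC// ltW// energy_gt0.
  - exact: measurable_inv_energy.
  - by move=> p; exact: ltW.
  - exact: measurable_normc2.
  - by move=> p; exact: sqr_ge0.
by split=> /L2predP[_ f2]; apply/L2predP; split; rewrite ?E1// -?E1//;
  exact: cmeasurableM.
Qed.

Lemma bmeasurable_weight (a : 'rV[R]_n) :
  bmeasurable (fun p => (weight m a p)%:C : R[i]).
Proof.
have := bmeasurableD (C0_bmeasurable (weight_C0 m_gt0 a)) (bmeasurable_cst n 1).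
congr bmeasurable; apply/funext => p.
by rewrite real_complexB1K.
Qed.

(** [L2_class] falls back to 0 outside L^2, so each intermediate function must be shown
    square-integrable before the three factors can be composed pointwise. For the translated
    function this is not translation invariance, which dp / E lacks, but the boundedness of the
    weight. *)
Lemma conj_translationE a :
  conj_translation m a = M (fun p => (weight m a p)%:C) \o V a.
Proof.
apply/funext => u.
have SV p (z : R[i]) : (S p)^-1%:C * ((S p)%:C * z) = z.
  by rewrite mulrA -rmorphM/= mulVf ?mul1r// gt_eqF ?sqrt_energy_gt0.
pose f1 p := (S p)%:C * L2_rep u p.
have f1L : f1 \in L2pred nu.
  apply/L2pred_dp_over_E; first by apply: cmeasurableM => //; exact: L2_repM.
  by under eq_fun do rewrite SV; exact: L2_rep_pred.
have u1E := (ae_dp_over_E _).1 (L2_classE f1L).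
set u1 := M_sqrtE m u.
pose f2 (p : 'rV[R]_n) := L2_rep u1 (p - a).
have f2E : {ae mu, forall p, f2 p = (S (p - a))%:C * L2_rep u (p - a)}.
  by apply: filterS (ae_shift (- a) u1E) => p /esym.
have wE : {ae mu, forall p, (S p)^-1%:C * f2 p =
    (weight m a p)%:C * L2_rep (V a u) p}.
  apply: filterS2 f2E (trans_rep a u) => p -> ->.
  by rewrite mulrA -rmorphM/= /weight [(S p)^-1 * _]mulrC.
have mf2 : cmeasurable f2 by apply: cmeasurable_shift; exact: L2_repM.
have f2L : f2 \in L2pred nu.
  apply/L2pred_dp_over_E => //.
  apply: (@L2pred_dom _ _ _ _ 1 _ (fun p => (weight m a p)%:C * L2_rep (V a u) p)).
  - exact: cmeasurableM.
  - by apply: mult_pred; exact: bmeasurable_weight.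
  - by apply: filterS wE => p ->; rewrite mul1r.
have u2E := (ae_dp_over_E _).1 (L2_classE f2L).
set u2 := L2_class nu f2 in u2E.
have f3L : (fun p => (S p)^-1%:C * L2_rep u2 p) \in L2pred mu.
  by apply/L2pred_dp_over_E; [exact: L2_repM|exact: L2_rep_pred].
apply: L2_ext.
have := L2_classE f3L => u3E.
have bw := bmeasurable_weight a.
near=> p.
have -> : L2_rep (conj_translation m a u) p = (S p)^-1%:C * L2_rep u2 p.
  by apply/esym; exact: (near u3E p).
rewrite /= (near (mult_rep (V a u) bw) p)// -(near wE p)//.
by rewrite -(near u2E p).
Unshelve. all: by end_near. Qed.

End conj_translation.

(** * Equality of the two generated algebras *)

Section generated_algebras.
Context (R : realType) (n : nat) (m : R).
Hypothesis (n_ge1 : (1 <= n)%N) (m_gt0 : 0 < m).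
Local Notation mu := (lebesgue_rV R n).
Local Notation E := (@energy R n m).
Local Notation M w := (multiplication mu mu w).
Local Notation V a := (translation mu a).
Implicit Types p q a : 'rV[R]_n.

Variable A : set (L2 mu -> L2 mu).
Hypothesis algA : cstar_subalgebra A.

Lemma cstar_subalgebra_conj_translation :
  (forall a, A (V a)) -> (forall f, C0_set f -> A (M f)) ->
  forall a, A (conj_translation m a).
Proof.
move=> AV AM a; rewrite conj_translationE//.
apply: cstarM => //.
(* The weight tends to 1 at infinity, so it is a function in C_0 plus the identity, and the identity
   is the translation by 0. *)
have -> : M (fun p => (weight m a p)%:C) = M (fun p => (weight m a p - 1)%:C) + V 0.
  rewrite trans0 -mult1 -multD; first last.
  - exact: bmeasurable_cst.
  - exact/C0_bmeasurable/weight_C0.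
  by congr (M _); apply/funext => p; rewrite real_complexB1K.
by apply: cstarD => //; apply: AM; exact: weight_C0.
Qed.

Hypothesis AT : forall a, A (conj_translation m a).

Let bw a : bmeasurable (fun p => (weight m a p)%:C : R[i]).
Proof. exact: bmeasurable_weight. Qed.

Let A_weight2 a : A (M (fun p => (weight m a p ^+ 2)%:C)).
Proof.
have adj : is_adjoint (conj_translation m a) (V (- a) \o M (fun p => (weight m a p)%:C)).
  rewrite conj_translationE//; apply: is_adjoint_comp; last exact: trans_adjoint.
  have := @mult_adjoint _ _ mu _ (bw a); congr is_adjoint; congr (M _).
  by apply/funext => p; rewrite conjc_real.
have := cstarM algA (AT a) (cstar_adjoint algA (AT a) adj).
congr A; rewrite conj_translationE//.
rewrite -[LHS]/(M (fun p => (weight m a p)%:C) \o (V a \o V (- a)) \o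
  M (fun p => (weight m a p)%:C)).
rewrite -transD subrr trans0 -[LHS]/(_ \o M _) multM//.
by congr (M _); apply/funext => p; rewrite -rmorphM/= expr2.
Qed.

Let Aid : A id.
Proof.
have := AT 0; rewrite conj_translationE// trans0.
rewrite (_ : (fun p => _) = fun=> 1) ?mult1//.
by apply/funext => p; rewrite weight0.
Qed.

(** The real multipliers of [A], the lattice to which Stone-Weierstrass is applied; its uniform
    closedness comes from the norm-closedness of [A]. *)
Let W (f : 'rV[R]_n -> R) := [/\ continuous f, (exists C : R, forall p, `|f p| <= C) &
  A (M (fun p => (f p)%:C))].

Let W_bm f : W f -> bmeasurable (fun p => (f p)%:C : R[i]).
Proof.
move=> [cf [C fC] _]; split.
  by apply: cmeasurable_real; exact: continuous_measurable_rV.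
by exists C => p; rewrite normc_real.
Qed.

Let WD f g : W f -> W g -> W (fun p => f p + g p).
Proof.
move=> Wf Wg; have bf := W_bm Wf; have bg := W_bm Wg.
have [cf [C fC] Af] := Wf; have [cg [D gD] Ag] := Wg; split.
- by move=> p; apply: (@continuousD R R 'rV[R]_n); [exact: cf|exact: cg].
- by exists (C + D) => p; apply: le_trans (ler_normD _ _) _; exact: lerD.
- have := cstarD algA Af Ag; rewrite -multD//; congr A.
  by congr (M _); apply/funext => p; rewrite -rmorphD.
Qed.

Let WM f g : W f -> W g -> W (fun p => f p * g p).
Proof.
move=> Wf Wg; have bf := W_bm Wf; have bg := W_bm Wg.
have [cf [C fC] Af] := Wf; have [cg [D gD] Ag] := Wg; split.
- by move=> p; apply: (@continuousM R 'rV[R]_n); [exact: cf|exact: cg].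
- by exists (C * D) => p; rewrite normrM ler_pM.
- have := cstarM algA Af Ag; rewrite multM//; congr A.
  by congr (M _); apply/funext => p; rewrite -rmorphM.
Qed.

Let Wcst (c : R) : W (fun=> c).
Proof.
split; first exact: cst_continuous.
  by exists `|c|.
by rewrite mult_cst; exact: cstarZ.
Qed.

Let WZ (c : R) f : W f -> W (fun p => c * f p).
Proof. exact/WM/Wcst. Qed.

Let Wlim (f : 'rV[R]_n -> R) : continuous f ->
  (forall e : R, 0 < e -> exists2 g, W g & forall p, `|f p - g p| <= e) -> W f.
Proof.
move=> cf fW.
have fb : exists C : R, forall p, `|f p| <= C.
  have [g [_ [C gC] _] fg] := fW 1 ltr01; exists (1 + C) => p.
  rewrite -[f p](subrK (g p)); apply: le_trans (ler_normD _ _) _.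
  exact: lerD (fg p) (gC p).
have bf : bmeasurable (fun p => (f p)%:C : R[i]).
  split; first by apply: cmeasurable_real; exact: continuous_measurable_rV.
  by have [C fC] := fb; exists C => p; rewrite normc_real.
split => //; apply: cstar_closed => //; first exact: mult_bounded.
move=> e e0; have [g Wg fg] := fW e e0; exists (M (fun p => (g p)%:C)).
  by case: Wg.
have bg := W_bm Wg.
apply/opnorm_leP; [|exact: ltW|].
  by apply: linearB_op; exact: mult_linear.
move=> u; rewrite -multB//; apply: mult_bound; [exact: bmeasurableB|exact: ltW|].
by move=> p; rewrite -rmorphB normc_real.
Qed.

Let W_weight4 a : W (fun p => weight m a p ^+ 2 ^+ 2).
Proof.
suff : W (fun p => weight m a p ^+ 2) by move=> Ww; have := WM Ww Ww.
split; last exact: A_weight2.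
  by move=> p; apply: (@continuousM R 'rV[R]_n); exact: continuous_weight.
have [C wC] := weight_bounded m_gt0 a; exists (C ^+ 2) => p.
rewrite ger0_norm ?sqr_ge0// ler_sqr_ge0 ?(ltW (weight_gt0 m_gt0 _ _))//.
by apply: le_trans (wC 0); exact/ltW/weight_gt0.
Qed.

Let W_inv_energy2 : W (fun p => (E p ^+ 2)^-1).
Proof.
(* Any nonzero vector would do; here |a|^2 = n, hence w_a^4 + w_(-a)^4 - 2 = 2 n / E^2, and n must
   be invertible. *)
pose a : 'rV[R]_n := const_mx 1.
have a0 : sqn a = n%:R.
  by rewrite /sqn (eq_bigr (fun=> 1)) ?sumr_const ?card_ord// => i _; rewrite mxE expr1n.
have nn : n%:R != 0 :> R by rewrite pnatr_eq0 -lt0n.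
have := WZ (2 * n%:R)^-1 (WD (WD (W_weight4 a) (W_weight4 (- a))) (Wcst (- 2))).
congr W; apply/funext => p; rewrite !weight4//.
have -> : sqn (- a) = n%:R.
  by rewrite -a0; apply: eq_bigr => i _; rewrite !mxE sqrrN.
have -> : \sum_(i < n) p ord0 i * (- a) ord0 i = - \sum_(i < n) p ord0 i * a ord0 i.
  by rewrite -sumrN; apply: eq_bigr => i _; rewrite !mxE mulrN.
rewrite a0; set e := E p; set s := \sum_(i < n) _.
by field; rewrite nn /= gt_eqF// energy_gt0.
Qed.

Let W_sqn q : W (fun p => sqn (p - q) / E p ^+ 2).
Proof.
have := WD (W_weight4 q) (WZ (- m ^+ 2) W_inv_energy2).
congr W; apply/funext => p; rewrite weight_sqr// expr_div_n !energy_sqr//.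
by rewrite mulNr -mulrBl addrK.
Qed.

Let W_peak q (U : set 'rV[R]_n) : nbhs q U -> exists h,
  [/\ W h, (forall p, 0 <= h p), h q = 0 &
      exists2 c : R, 0 < c & forall p, ~ U p -> c <= h p].
Proof.
move=> /nbhs_ballP[d /= d0 qU]; exists (fun p => sqn (p - q) / E p ^+ 2).
split; first exact: W_sqn.
- by move=> p; rewrite divr_ge0 ?sqr_ge0 ?sqn_ge0.
- by rewrite subrr /sqn big1 ?mul0r// => i _; rewrite mxE expr0n.
(* With t = |p - q|^2, E(p)^2 <= 2 t + K, and t / (2 t + K) increases with t. Outside the ball some
   coordinate gives t >= d^2, whence the constant below. *)
pose K := 2 * sqn q + m ^+ 2.
have K0 : 0 < K by rewrite ltr_wpDl ?mulr_ge0 ?sqn_ge0// exprn_gt0.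
have d2 : 0 < d ^+ 2 by rewrite exprn_gt0.
exists (d ^+ 2 / (2 * d ^+ 2 + K)).
  by rewrite divr_gt0// addr_gt0// mulr_gt0.
move=> p pU.
have [i di] : exists i, d <= `|p ord0 i - q ord0 i|.
  apply: contrapT => /forallNP H; apply: pU; apply: qU.
  rewrite -ball_normE /=; apply: (@le_lt_trans _ _ (\big[Num.max/0]_(i < n) `|p ord0 i - q ord0 i|)).
    apply: rV_norm_le; first by apply/bigmax_geP; left.
    move=> i; rewrite !mxE distrC.
    exact: (@le_bigmax _ _ _ 0 (fun i : 'I_n => `|p ord0 i - q ord0 i|)).
  by apply/bigmax_ltP; split => // i _; rewrite ltNge; apply/negP; exact: H.
have t0 : d ^+ 2 <= sqn (p - q).
  apply: le_trans (sqn_coord_le (p - q) i); rewrite !mxE.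
  rewrite -[leRHS]real_normK ?num_real// ler_sqr_ge0//; exact: ltW.
have le := sqn_le p q; set t := sqn (p - q) in t0 le *.
rewrite energy_sqr// ler_pdivlMr; last first.
  by rewrite ltr_wpDl ?sqn_ge0// exprn_gt0.
rewrite mulrAC ler_pdivrMr; last by rewrite addr_gt0// mulr_gt0.
have : sqn p + m ^+ 2 <= 2 * t + K by rewrite /K; lra.
move: (sqn p + m ^+ 2) => z zt.
apply: (@le_trans _ _ (d ^+ 2 * (2 * t + K))); first by rewrite ler_wpM2l// ltW.
by have := ler_wpM2l (ltW K0) t0; move: (d ^+ 2) => x; nra.
Qed.

Let W_C0_ge0 (f : 'rV[R]_n -> R) : continuous f -> (forall p, 0 <= f p) ->
  (forall e : R, 0 < e -> exists2 K : set 'rV[R]_n, compact K &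
    forall p, ~ K p -> f p < e) -> W f.
Proof.
apply: (@stone_ge0 R 'rV[R]_n W) => //.
- by move=> g [].
- by move=> g [].
Qed.

Let W_C0 (f : 'rV[R]_n -> R) : continuous f ->
  (forall e : R, 0 < e -> exists2 K : set 'rV[R]_n, compact K &
    forall p, ~ K p -> `|f p| < e) -> W f.
Proof.
move=> cf fK.
have cabs : continuous (fun p => `|f p|).
  move=> p; apply: (@continuous_comp 'rV[R]_n R R f (fun x => `|x|)); first exact: cf.
  exact: norm_continuous.
have Wa : W (fun p => `|f p|) by apply: W_C0_ge0.
(* f is the difference of the nonnegative functions |f| + f and |f|; the former is at most 2 |f|,
   which explains e / 2. *)
have Wp : W (fun p => `|f p| + f p).
  apply: W_C0_ge0.
  - by move=> p; apply: (@continuousD R R 'rV[R]_n); [exact: cabs|exact: cf].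
  - by move=> p; have := ler_normr (- f p) (- f p); have := ler_norm (- f p); rewrite normrN; lra.
  - move=> e e0; have [K cK Kf] := fK (e / 2) (divr_gt0 e0 (ltr0n _ 2)).
    by exists K => // p /Kf; have := ler_norm (f p); lra.
have := WD Wp (WZ (-1) Wa); congr W; apply/funext => p.
by rewrite mulN1r addrAC subrr add0r.
Qed.

Lemma cstar_subalgebra_C0 f : C0_set f -> A (M f).
Proof.
move=> f0; have [c1 c2 fK] := (C0_setP f).1 f0.
have W1f : W (fun p => complex.Re (f p)).
  apply: W_C0 => // e /fK[K cK Kf]; exists K => // p /Kf; apply: le_lt_trans.
  by have := Re_dist_le (f p) 0; rewrite !subr0.
have W2f : W (fun p => complex.Im (f p)).
  apply: W_C0 => // e /fK[K cK Kf]; exists K => // p /Kf; apply: le_lt_trans.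
  by have := Im_dist_le (f p) 0; rewrite !subr0.
have := cstarD algA (cstarZ algA 'i (let: And3 _ _ A2 := W2f in A2))
  (let: And3 _ _ A1 := W1f in A1).
rewrite -mult_lin; [|exact: W_bm|exact: W_bm].
congr A; congr (M _); apply/funext => p.
by case: (f p) => a b /=; simpc.
Qed.

Lemma cstar_subalgebra_translation a : A (V a).
Proof.
have bV : bmeasurable (fun p => ((weight m a p)^-1 - 1)%:C : R[i]).
  by apply: C0_bmeasurable; exact: weightV_C0.
have AwV : A (M (fun p => ((weight m a p)^-1)%:C)).
  have := cstarD algA (cstar_subalgebra_C0 (weightV_C0 m_gt0 a)) Aid.
  rewrite -mult1 -multD//; last exact: bmeasurable_cst.
  by congr A; congr (M _); apply/funext => p; rewrite real_complexB1K.
have := cstarM algA AwV (AT a); rewrite conj_translationE//.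
rewrite -[X in A X]/((M _ \o M _) \o V a) multM//.
  congr A; rewrite (_ : (fun p => _) = fun=> 1) ?mult1//.
  by apply/funext => p; rewrite -rmorphM/= mulVf// gt_eqF// weight_gt0.
have := bmeasurableD bV (bmeasurable_cst n 1); congr bmeasurable.
by apply/funext => p; rewrite real_complexB1K.
Qed.

End generated_algebras.

Lemma cstar_gen_conj_translation (R : realType) (n : nat) (m : R) :
  (1 <= n)%N -> 0 < m -> let mu := lebesgue_rV R n in
  cstar_gen (range (@conj_translation R n m)) =
  cstar_gen (range (translation mu) `|`
    [set multiplication mu mu f | f in @C0_set R 'rV[R]_n]).
Proof.
move=> n1 m0 mu; apply/seteqP; split => T TA A [algA XA].
  apply: TA; split => // _ [a _ <-]; apply: cstar_subalgebra_conj_translation => //.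
    by move=> b; apply: XA; left; exists b.
  by move=> f f0; apply: XA; right; exists f.
have AT a : A (conj_translation m a) by apply: XA; exists a.
apply: TA; split => // _ [[a _ <-]|[f f0 <-]].
  exact: (@cstar_subalgebra_translation R n m).
exact: (@cstar_subalgebra_C0 R n m).
Qed.

(** * Positive matrices over the unitization *)

Lemma continuous_lipschitz (R : realType) (X : topologicalType) (r : X -> R)
  (phi : R -> R) (L k : R) : 0 < L -> continuous r ->
  (forall x y, `|phi (r x) - phi (r y)| <= L * `|r x - r y|) ->
  continuous (fun x => phi (r x) - k).
Proof.
move=> L0 cr Lphi x; apply/cvgrPdist_lt => d d0.
have /cvgrPdist_lt /(_ (d / L) (divr_gt0 d0 L0)) := cr x.
apply: filterS => y /=; rewrite ltr_pdivlMr// => xy.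
rewrite opprB addrA subrK; apply: le_lt_trans (Lphi x y) _.
by rewrite mulrC.
Qed.

(** * Pointwise calculus in the unitization *)

Section evaluation.
Context (R : realType) (n : nat).
Local Notation A := (C0plus R 'rV[R]_n).
Implicit Types (a b : A) (p : 'rV[R]_n).

Definition ev a p : R[i] := a.1 p + a.2.

Lemma evD a b p : ev (a + b) p = ev a p + ev b p.
Proof. by rewrite /ev addrACA. Qed.
Lemma evZ c a p : ev (c *: a) p = c * ev a p.
Proof. by rewrite /ev mulrDr. Qed.
Lemma ev0 p : ev 0 p = 0.
Proof. by rewrite /ev addr0. Qed.
Lemma ev1 p : ev 1 p = 1.
Proof. by rewrite /ev add0r. Qed.
Lemma evM a b p : ev (a * b) p = ev a p * ev b p.
Proof.
rewrite /ev [LHS](_ : _ = a.1 p * b.1 p + a.2 * b.1 p + b.2 * a.1 p + a.2 * b.2)//.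
ring.
Qed.
Lemma ev_star a p : ev (star a) p = (ev a p)^*.
Proof. by rewrite /ev rmorphD. Qed.
Lemma ev_shift s a p : ev (translation_action R n s a) p = ev a (p - s).
Proof. by []. Qed.

Lemma C0_valP_set (f : C0 R 'rV[R]_n) : C0_set f.
Proof. exact: set_mem (C0_valP f). Qed.

Hypothesis n_ge1 : (1 <= n)%N.

Lemma C0_small (f : 'rV[R]_n -> R[i]) (e : R) : C0_set f -> 0 < e ->
  exists p, normc (f p) < e.
Proof.
move=> /C0_setP[_ _ fK] /fK[K cK Kf].
have [M [_ KM]] := compact_bounded cK.
pose p : 'rV[R]_n := const_mx (`|M| + 2).
exists p; apply: Kf => Kp.
have M1 : M < `|M| + 1 by apply: le_lt_trans (ler_norm M) _; rewrite ltrDl.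
have /= := KM _ M1 p Kp; apply/negP; rewrite -ltNge.
apply: lt_le_trans (rV_coord_le p (Ordinal n_ge1)).
by rewrite mxE [ltRHS]ger0_norm; [lra|rewrite addr_ge0].
Qed.

(** Equal values make [a.1 - b.1] constant, and on a noncompact space a constant vanishing at
    infinity is 0. On R^0 the constant 1 lies in C_0, and injectivity fails. *)
Lemma ev_inj a b : (forall p, ev a p = ev b p) -> a = b.
Proof.
move=> ab.
have H p : a.1 p - b.1 p = b.2 - a.2.
  by have := ab p; rewrite /ev => E;
    transitivity (a.1 p + a.2 - (b.1 p + a.2)); [ring|rewrite E; ring].
have f0 : C0_set (a.1 - b.1 : C0 R _) by exact: C0_valP_set.
have c0 : b.2 = a.2.
  apply/eqP; rewrite -subr_eq0; apply/eqP/eq0_normc/eqP.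
  rewrite eq_le normc_ge0 andbT; apply/ler_addgt0Pl => e e0; rewrite addr0.
  have [p] := C0_small f0 e0.
  by rewrite [(a.1 - b.1 : C0 R _) p](_ : _ = a.1 p - b.1 p)// H => /ltW.
case: a b {ab f0} H c0 => [f c] [g d] /= H c0; congr (_, _) => //.
by apply: C0_eqP => p; apply/eqP; rewrite -subr_eq0 H c0 subrr.
Qed.

Lemma ev_ge (e : R) a : (forall p, e%:C <= ev a p) -> e <= complex.Re a.2.
Proof.
move=> ea; apply/ler_addgt0Pl => d d0.
have [p pd] := C0_small (C0_valP_set a.1) d0.
have := ea p; rewrite lecE => /andP[_ /=]; have := Re_dist_le (a.1 p) 0.
rewrite !subr0 /ev => H; have := ler_norm (complex.Re (a.1 p)).
case: (a.1 p) (a.2) H pd => [x y] [z w] /=; lra.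
Qed.

(** A substitute for functional calculus: the Lipschitz bound transfers both continuity and
    vanishing at infinity from r - c to phi(r) - phi(c), where c is the value at infinity. The lower
    bound [e] keeps inversion (constant 1 / e^2) and the square root (constant 1 / sqrt e)
    Lipschitz. *)
Lemma C0plus_lipschitz (e L : R) (phi : R -> R) a : (forall p, e%:C <= ev a p) ->
  (forall x y, e <= x -> e <= y -> `|phi x - phi y| <= L * `|x - y|) ->
  exists b : A, forall p, ev b p = (phi (complex.Re (ev a p)))%:C.
Proof.
move=> ea Lphi; pose c := complex.Re a.2; pose r p := complex.Re (ev a p).
have er p : e <= r p by have := ea p; rewrite lecE => /andP[].
have ec : e <= c by exact: ev_ge.
have L0 : 0 <= `|L| + 1 by rewrite addr_ge0.
have L1 : 0 < `|L| + 1 by rewrite ltr_wpDl.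
have Lip x y : e <= x -> e <= y -> `|phi x - phi y| <= (`|L| + 1) * `|x - y|.
  move=> ex ey; apply: le_trans (Lphi x y ex ey) _; rewrite ler_wpM2r//.
  by apply: le_trans (ler_norm L) _; rewrite lerDl.
have rE p : r p = complex.Re (a.1 p) + c.
  by rewrite /r /c /ev; case: (a.1 p) (a.2) => [? ?] [? ?].
have [c1 _ vf] := (C0_setP _).1 (C0_valP_set a.1).
have f0 : C0_set (fun p => (phi (r p) - phi c)%:C).
  apply: C0_real.
    apply: (@continuous_lipschitz R _ r _ (`|L| + 1)) => //.
      rewrite (_ : r = fun p => complex.Re (a.1 p) + c); last exact/funext.
      by move=> p; apply: (@continuousD R R 'rV[R]_n); [exact: c1|exact: cst_continuous].
    by move=> p q; exact: Lip.
  move=> d d0; have [K cK Kf] := vf (d / (`|L| + 1)) (divr_gt0 d0 L1).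
  exists K => // p /Kf; rewrite ltr_pdivlMr// => pd.
  apply: le_lt_trans (Lip _ _ (er p) ec) _; apply: le_lt_trans pd.
  rewrite rE addrK mulrC ler_wpM2r//.
  by have := Re_dist_le (a.1 p) 0; rewrite !subr0.
exists (MkC0 (mem_set f0), (phi c)%:C) => p.
by rewrite /ev /= -rmorphD subrK.
Qed.

Lemma C0plus_inv (e : R) a : 0 < e -> (forall p, e%:C <= ev a p) ->
  exists b : A, b * a = 1 /\ a * b = 1.
Proof.
move=> e0 ea; have [|b bE] := @C0plus_lipschitz e (e ^+ 2)^-1 (fun x => x^-1) a ea.
  move=> x y ex ey; have x0 := lt_le_trans e0 ex; have y0 := lt_le_trans e0 ey.
  rewrite (_ : x^-1 - y^-1 = (x * y)^-1 * (y - x)); last by field; rewrite !gt_eqF.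
  have xy0 : 0 < x * y by rewrite mulr_gt0.
  rewrite normrM distrC ler_wpM2r// ger0_norm; last by rewrite invr_ge0 ltW.
  rewrite lef_pV2 ?posrE ?exprn_gt0// expr2.
  by apply: ler_pM => //; exact: ltW.
have ba p : ev b p * ev a p = 1.
  have := ea p; rewrite bE lecE; case: (ev a p) => x y /= /andP[/eqP -> ex].
  have x0 := lt_le_trans e0 ex.
  by rewrite -[x +i* 0]/(x%:C) -rmorphM/= mulVf ?gt_eqF.
exists b; split; apply: ev_inj => p; rewrite evM ev1 ?ba//.
by rewrite mulrC ba.
Qed.

Lemma C0plus_sqrt (e : R) a : 0 < e -> (forall p, e%:C <= ev a p) ->
  exists b : A, star b * b = a.
Proof.
move=> e0 ea; have [|b bE] := @C0plus_lipschitz e (Num.sqrt e)^-1 Num.sqrt a ea.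
  move=> x y ex ey; have x0 := lt_le_trans e0 ex; have y0 := lt_le_trans e0 ey.
  have se : 0 < Num.sqrt e by rewrite sqrtr_gt0.
  rewrite mulrC ler_pdivlMr//.
  rewrite -[x in leRHS](sqr_sqrtr (ltW x0)) -[y in leRHS](sqr_sqrtr (ltW y0)).
  rewrite subr_sqr normrM ler_wpM2l// ger0_norm ?addr_ge0 ?sqrtr_ge0//.
  by apply: le_trans (_ : Num.sqrt x <= _); [rewrite ler_sqrt// ltW|rewrite lerDl sqrtr_ge0].
exists b; apply: ev_inj => p; rewrite evM ev_star bE.
have := ea p; rewrite lecE; case: (ev a p) => x y /= /andP[/eqP -> ex].
have x0 := lt_le_trans e0 ex.
rewrite oppr0 -[_ +i* 0]/((Num.sqrt x)%:C) -rmorphM/= -expr2 sqr_sqrtr//; exact: ltW.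
Qed.
End evaluation.

Section star_algebra.
Context (R : realType) (A : starAlgType R).
Implicit Types a b : A.

Lemma star1 : star (1 : A) = 1.
Proof. by rewrite -[LHS]mulr1 -[X in _ * X]starK -starM mulr1 starK. Qed.

Lemma star0 : star (0 : A) = 0.
Proof. by apply: (addrI (star (0 : A))); rewrite -starD !addr0. Qed.

Lemma starN a : star (- a) = - star a.
Proof. by apply: (addrI (star a)); rewrite -starD !subrr star0. Qed.

Lemma starB a b : star (a - b) = star a - star b.
Proof. by rewrite starD starN. Qed.

Lemma star_sum I (r : seq I) (P : pred I) (F : I -> A) :
  star (\sum_(i <- r | P i) F i) = \sum_(i <- r | P i) star (F i).
Proof. by rewrite (big_morph _ (@starD R A) star0). Qed.
End star_algebra.

(* For [q a u v = hdot (pi a u) v], and for [q a u v = a(p) u conj(v)] at a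
   point p, splitting off the first variable of the quadratic form of a
   hermitian matrix leaves the quadratic form of its Schur complement. *)
Section schur.
Context (R : realType) (A : starAlgType R) (V : zmodType).
Variables (act : A -> V -> V) (q : A -> V -> V -> R[i]).
Hypothesis qDa : forall a b u v, q (a + b) u v = q a u v + q b u v.
Hypothesis qDl : forall a u u' v, q a (u + u') v = q a u v + q a u' v.
Hypothesis qDr : forall a u v v', q a u (v + v') = q a u v + q a u v'.
Hypothesis qMl : forall a b u v, q a (act b u) v = q (a * b) u v.
Hypothesis qMr : forall a b u v, q a u (act b v) = q (star b * a) u v.

Definition qform N (G : 'I_N -> 'I_N -> A) (x : 'I_N -> V) : R[i] :=
  \sum_i \sum_j q (G i j) (x j) (x i).

Definition schur N (G : 'I_N.+1 -> 'I_N.+1 -> A) (b : A) (i j : 'I_N) : A :=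
  G (lift ord0 i) (lift ord0 j) -
  G (lift ord0 i) ord0 * (b * G ord0 (lift ord0 j)).

Let q0l a v : q a 0 v = 0.
Proof. by apply: (addrI (q a 0 v)); rewrite -qDl !addr0. Qed.
Let q0r a v : q a v 0 = 0.
Proof. by apply: (addrI (q a v 0)); rewrite -qDr !addr0. Qed.
Let q0a u v : q 0 u v = 0.
Proof. by apply: (addrI (q 0 u v)); rewrite -qDa !addr0. Qed.
Let qNa a u v : q (- a) u v = - q a u v.
Proof. by apply: (addrI (q a u v)); rewrite -qDa !subrr. Qed.
Let q_suml I (r : seq I) (F : I -> V) a v :
  q a (\sum_(i <- r) F i) v = \sum_(i <- r) q a (F i) v.
Proof. by rewrite (big_morph (q a ^~ v) (fun x y => qDl a x y v) (q0l a v)). Qed.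
Let q_sumr I (r : seq I) (F : I -> V) a v :
  q a v (\sum_(i <- r) F i) = \sum_(i <- r) q a v (F i).
Proof. by rewrite (big_morph (q a v) (qDr a v) (q0r a v)). Qed.

(** Completing the square: [x0] absorbs all cross terms with the first variable, and the square
    terms it adds are those subtracted in [schur]. The cross terms match because [b], inverse of a
    self-adjoint pivot, is self-adjoint. *)
Lemma qform_schur N (G : 'I_N.+1 -> 'I_N.+1 -> A) (b : A) (x : 'I_N.+1 -> V) :
  (forall i j, star (G i j) = G j i) -> b * G ord0 ord0 = 1 -> G ord0 ord0 * b = 1 ->
  let x0 := x ord0 + \sum_j act (b * G ord0 (lift ord0 j)) (x (lift ord0 j)) in
  qform G x = q (G ord0 ord0) x0 x0 + qform (schur G b) (fun i => x (lift ord0 i)).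
Proof.
move=> herm bg gb x0; set g := G ord0 ord0 in bg gb *.
have sg : star g = g by rewrite /g herm.
have sb : star b = b.
  by rewrite -[LHS]mulr1 -gb mulrA -{1}sg -starM gb star1 mul1r.
rewrite /qform 2!big_ord_recl -/g.
under [in X in _ + X]eq_bigr do rewrite big_ord_recl.
rewrite big_split/= qDl !qDr !q_sumr !q_suml.
have -> : \sum_j q g (act (b * G ord0 (lift ord0 j)) (x (lift ord0 j))) (x ord0) =
    \sum_j q (G ord0 (lift ord0 j)) (x (lift ord0 j)) (x ord0).
  by apply: eq_bigr => j _; rewrite qMl mulrA gb mul1r.
have -> : \sum_i q g (x ord0) (act (b * G ord0 (lift ord0 i)) (x (lift ord0 i))) =
    \sum_i q (G (lift ord0 i) ord0) (x ord0) (x (lift ord0 i)).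
  by apply: eq_bigr => i _; rewrite qMr starM sb herm -mulrA bg mulr1.
rewrite -!addrA; congr (_ + _); rewrite addrCA; congr (_ + _); congr (_ + _).
rewrite -big_split/=; apply: eq_bigr => i _.
rewrite q_suml -big_split/=; apply: eq_bigr => j _.
rewrite qMl qMr starM sb herm qDa qNa -/g.
have -> : G (lift ord0 i) ord0 * b * (g * (b * G ord0 (lift ord0 j))) =
    G (lift ord0 i) ord0 * (b * G ord0 (lift ord0 j)).
  by rewrite mulrA -(mulrA _ b g) bg mulr1.
by rewrite addrCA addrN addr0.
Qed.
Hypothesis qZa : forall z a u v, q (z *: a) u v = z * q a u v.

(** Translates between positivity of z - B^* B and a norm bound on B. At a point p it is read from
    the bound to positivity, in a representation from positivity to the bound. *)
Lemma qform_gram N (I : Type) (r : seq I) (B : I -> 'I_N -> A) (z : R[i])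
    (x : 'I_N -> V) (y := fun a => \sum_j act (B a j) (x j)) :
  qform (fun i j => (if i == j then z *: 1 else 0) -
    \sum_(a <- r) star (B a i) * B a j) x =
  z * (\sum_i q 1 (x i) (x i)) - \sum_(a <- r) q 1 (y a) (y a).
Proof.
have q_suma (F : I -> A) u v : q (\sum_(a <- r) F a) u v = \sum_(a <- r) q (F a) u v.
  by rewrite (big_morph (fun a => q a u v) (fun a b => qDa a b u v) (q0a u v)).
rewrite /qform.
under eq_bigr => i _.
  under eq_bigr do rewrite qDa qNa q_suma.
  rewrite sumrB (bigD1 i)//= eqxx big1 ?addr0; last first.
    by move=> j ji; rewrite eq_sym (negbTE ji) q0a.
  rewrite qZa exchange_big/=; over.
rewrite sumrB -mulr_sumr; congr (_ - _); rewrite exchange_big/=.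
apply: eq_bigr => a _; rewrite /y q_sumr; apply: eq_bigr => i _.
by rewrite q_suml; apply: eq_bigr => j _; rewrite qMl qMr mul1r.
Qed.
End schur.

Section positive_matrices.
Context (R : realType) (n : nat).
Hypothesis n_ge1 : (1 <= n)%N.
Local Notation A := (C0plus R 'rV[R]_n).
Context (H : preHilbertType R) (pi : A -> H -> H).
Hypothesis pi_bounded : forall a, bounded_op (pi a).
Hypothesis pi_linear : linear pi.
Hypothesis piM : forall a b, pi (a * b) = pi a \o pi b.
Hypothesis pi_star : forall a, is_adjoint (pi a) (pi (star a)).

Let piD a b u : pi (a + b) u = pi a u + pi b u.
Proof. by have := pi_linear 1 a b; rewrite !scale1r => ->. Qed.

Let qpi a u v := hdot (pi a u) v.
Let qev p (a : A) (u v : R[i]) := ev a p * u * v^*.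

Let Re_sum_le0 (e : R) N (c : 'I_N.+1 -> R[i]) : 0 < e ->
  e * \sum_(i < N) normc (c (lift ord0 i)) ^+ 2 <= e * \sum_(i < N.+1) normc (c i) ^+ 2.
Proof.
by move=> e0; rewrite ler_wpM2l ?(ltW e0)// [leRHS]big_ord_recl lerDr sqr_ge0.
Qed.

(** Induction on the size. The margin [e] makes the pivot g at least e at every point, hence
    invertible and of the form s^* s; its contribution in the representation is |pi(s) x0|^2 >= 0.
    The Schur complement keeps the same margin, so the induction goes on. *)
Lemma positive_matrix (e : R) N (G : 'I_N -> 'I_N -> A) (xi : 'I_N -> H) : 0 < e ->
  (forall i j, star (G i j) = G j i) ->
  (forall p (c : 'I_N -> R[i]), e * \sum_(i < N) normc (c i) ^+ 2 <=
     complex.Re (\sum_i \sum_j ev (G i j) p * c j * (c i)^*)) ->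
  0 <= complex.Re (\sum_i \sum_j hdot (pi (G i j) (xi j)) (xi i)).
Proof.
move=> e0; elim: N G xi => [|N IH] G xi herm pos; first by rewrite big_ord0.
set g := G ord0 ord0.
have eg p : e%:C <= ev g p.
  (* The first basis vector isolates the pivot. *)
  have := pos p (fun i => (i == ord0)%:R); rewrite !big_ord_recl/=.
  rewrite !big1; first last.
  - by move=> i _; rewrite expr0n/= addr0 sqrtr0 expr0n.
  - by move=> i _; rewrite mulr0 mul0r.
  - by move=> i _; rewrite big1// => j _; rewrite [X in _ * X](conjc_nat R 0) mulr0.
  rewrite expr0n/= !addr0 [X in complex.Re (_ * X)](conjc_nat R 1).
  rewrite expr1n sqrtr1 expr1n !mulr1 lecE => ->; rewrite andbT.
  have : ev g p = (ev g p)^* by rewrite -ev_star herm.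
  case: (ev g p) => x y [/eqP]; rewrite -addr_eq0 -mulr2n mulrn_eq0 /= => /eqP ->.
  by rewrite eqxx.
have [b [bg gb]] := C0plus_inv n_ge1 e0 eg.
have [s sg] := C0plus_sqrt n_ge1 e0 eg.
have star_b : star b = b.
  by rewrite -[LHS]mulr1 -gb mulrA -[X in _ * X * _](herm ord0 ord0) -starM gb star1 mul1r.
have k1 a c u v : qpi (a + c) u v = qpi a u v + qpi c u v by rewrite /qpi piD hdotDl.
have k2 a u u' v : qpi a (u + u') v = qpi a u v + qpi a u' v.
  by rewrite /qpi (linear_opD (pi_bounded a).1) hdotDl.
have k3 a u v v' : qpi a u (v + v') = qpi a u v + qpi a u v' by rewrite /qpi hdotDr.
have k4 a c u v : qpi a (pi c u) v = qpi (a * c) u v by rewrite /qpi piM.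
have k5 a c u v : qpi a u (pi c v) = qpi (star c * a) u v.
  by rewrite /qpi piM /= (is_adjointC (pi_star c)).
have Epi := @qform_schur R A H pi qpi k1 k2 k3 k4 k5 N G b xi herm bg gb.
rewrite -[X in complex.Re X]/(qform qpi G xi) Epi.
have ReD (x y : R[i]) : complex.Re (x + y) = complex.Re x + complex.Re y.
  by case: x y => [? ?] [? ?].
rewrite ReD addr_ge0//.
  rewrite /qpi -/g -sg piM /= (is_adjointC (pi_star _)) hdotE/=; exact: sqr_ge0.
apply: IH => [i j|p c].
  by rewrite /schur starD starN !starM !herm star_b mulrA.
(* With this first entry the completed square vanishes at p, so the form of [G] at the extended
   vector is that of the Schur complement at [c]. *)
pose c0 : R[i] := - \sum_j ev (b * G ord0 (lift ord0 j)) p * c j.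
pose c' (i : 'I_N.+1) : R[i] := if unlift ord0 i is Some j then c j else c0.
have c'0 : c' ord0 = c0 by rewrite /c' unlift_none.
have c'S i : c' (lift ord0 i) = c i by rewrite /c' liftK.
have := @qform_schur R A R[i] (fun a u => ev a p * u) (qev p) _ _ _ _ _ N G b c' herm bg gb.
have h1 a c1 u v : qev p (a + c1) u v = qev p a u v + qev p c1 u v.
  by rewrite /qev evD; ring.
have h2 a u u' v : qev p a (u + u') v = qev p a u v + qev p a u' v.
  by rewrite /qev; ring.
have h3 a u v v' : qev p a u (v + v') = qev p a u v + qev p a u v'.
  by rewrite /qev rmorphD/=; ring.
have h4 a c1 u v : qev p a (ev c1 p * u) v = qev p (a * c1) u v.
  by rewrite /qev evM; ring.
have h5 a c1 u v : qev p a u (ev c1 p * v) = qev p (star c1 * a) u v.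
  by rewrite /qev rmorphM/= evM ev_star; ring.
move=> /(_ h1 h2 h3 h4 h5) /=; rewrite c'0.
under [X in c0 + X]eq_bigr do rewrite c'S.
rewrite addNr {2}/qev mulr0 mul0r add0r.
have -> : (fun i => c' (lift ord0 i)) = c by apply/funext => i; exact: c'S.
rewrite /qform /qev => Q.
have := pos p c'; rewrite Q; apply: le_trans.
apply: le_trans (Re_sum_le0 c' e0).
by rewrite ler_wpM2l ?(ltW e0)// ler_sum// => i _; rewrite c'S.
Qed.
End positive_matrices.

(** * The norm of an integrated form dominates all covariant representations *)

Lemma common_radius (R : realType) (I : eqType) (s : seq I) (P : I -> R -> Prop) :
  (forall i, i \in s -> exists2 d0 : R, 0 < d0 & forall d, 0 < d <= d0 -> P i d) ->
  exists2 d0 : R, 0 < d0 & forall d, 0 < d <= d0 -> forall i, i \in s -> P i d.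
Proof.
elim: s => [|i s IH] H; first by exists 1.
have [d1 d10 P1] := H i (mem_head _ _).
have [|d2 d20 P2] := IH; first by move=> j js; apply: H; rewrite inE js orbT.
exists (Num.min d1 d2) => [|d /andP[d0]]; first by rewrite lt_min d10.
rewrite le_min => /andP[dd1 dd2] j; rewrite inE => /orP[/eqP ->|js].
  by apply: P1; rewrite d0.
by apply: P2 => //; rewrite d0.
Qed.

(** * Small disjoint cubes as test functions *)

Section cubes.
Context (R : realType) (n : nat).
Implicit Types (p x y s : 'rV[R]_n) (d : R).

Lemma cube_shift y s d p : cube y d (p - s) <-> cube (y + s) d p.
Proof.
split=> H i; have := H i; rewrite !mxE => /andP[? ?]; apply/andP; split; lra.
Qed.

Lemma cube_separated (P : seq 'rV[R]_n) : exists2 d0 : R, 0 < d0 &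
  forall d, 0 < d <= d0 -> forall x y, x \in P -> y \in P ->
    forall p, cube x d p -> cube y d p -> x = y.
Proof.
have [|d0 d00 H] := @common_radius R _ [seq (x, y) | x <- P, y <- P]
    (fun xy d => forall p, cube xy.1 d p -> cube xy.2 d p -> xy.1 = xy.2).
  move=> [x y] _ /=; have [->|xy] := eqVneq x y; first by exists 1.
  have [i xyi] : exists i, x ord0 i != y ord0 i.
    apply: contrapT => /forallNP H; move/eqP: xy; apply; apply/rowP => i.
    by apply/eqP; have := H i; move/negP; rewrite negbK.
  exists `|x ord0 i - y ord0 i|; first by rewrite normr_gt0 subr_eq0.
  move=> d /andP[_ dxy] p /(_ i) /andP[? ?] /(_ i) /andP[? ?].
  by move: dxy; rewrite leNgt ltr_norml => /negP; case; apply/andP; split; lra.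
exists d0 => // d dd x y xP yP p; apply: (H d dd (x, y)).
by apply/allpairsP; exists (x, y).
Qed.

Local Notation mu := (lebesgue_rV R n).

Lemma integral_cubes (I : eqType) (r : seq I) (m : I -> R) (x : I -> 'rV[R]_n) d :
  0 < d -> (forall i, 0 <= m i) ->
  (\int[mu]_p (\sum_(i <- r) m i * \1_(cube (x i) d) p)%:E =
   ((\sum_(i <- r) m i) * d ^+ n)%:E)%E.
Proof.
move=> d0 m0; under eq_integral do rewrite -sumEFin.
rewrite ge0_integral_sum//.
- rewrite mulr_suml -sumEFin; apply: eq_bigr => i _.
  under eq_integral do rewrite EFinM.
  rewrite ge0_integralZl//; last by rewrite lee_fin.
    by rewrite integral_indic ?setIT ?lebesgue_rV_cube//; exact: measurable_cube.
  apply/measurable_EFinP; apply: measurable_indic; exact: measurable_cube.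
- move=> i; apply/measurable_EFinP; apply: measurable_funM => //.
  by apply: measurable_indic; exact: measurable_cube.
- by move=> i p _; rewrite lee_fin mulr_ge0.
Qed.

(** For disjoint supports a sum has at most one nonzero term. The ring is left general so that a
    complex sum can be compared with the real sum of its squared moduli. *)
Lemma indic_uniq_sum (I : eqType) (V : pzSemiRingType) (r : seq I) (F : I -> V)
    (b : I -> bool) : uniq r ->
  (forall i j, i \in r -> j \in r -> b i -> b j -> i = j) ->
  (exists2 i, i \in r /\ b i & \sum_(j <- r) F j * (b j)%:R = F i) \/
  ((forall i, i \in r -> b i = false) /\ \sum_(j <- r) F j * (b j)%:R = 0).
Proof.
move=> ur br; have [/hasP[i ir bi]|/hasPn nb] := boolP (has b r).
  left; exists i => //; rewrite (bigD1_seq i)//= bi mulr1 big1_seq ?addr0//.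
  move=> j /andP[ji jr]; case bj : (b j); last by rewrite mulr0.
  by move: ji; rewrite (br j i) ?eqxx.
right; split=> [i /nb /negbTE //|].
by rewrite big1_seq// => j /andP[_ /nb /negbTE ->]; rewrite mulr0.
Qed.
End cubes.

(** * From an operator bound to a bound on matrices at a point *)

Section weighted_translations.
Context (R : realType) (n : nat).
Local Notation mu := (lebesgue_rV R n).
Local Notation M w := (multiplication mu mu w).
Local Notation V a := (translation mu a).
Context (S : seq 'rV[R]_n) (w : 'rV[R]_n -> 'rV[R]_n -> R[i]).
Hypothesis S_uniq : uniq S.
Hypothesis w_supp : forall s p, s \notin S -> w s p = 0.
Hypothesis w_cont : forall s, continuous (w s : 'rV[R]_n -> (R[i] : numFieldType)).
Hypothesis w_meas : forall s, bmeasurable (w s).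
Variable C : R.
Hypothesis C_bound : forall u : L2 mu,
  hnorm (\sum_(s <- S) M (w s) (V s u)) <= C * hnorm u.

Lemma rep_sum_mult_trans (s : seq 'rV[R]_n) (u : L2 mu) :
  {ae mu, forall p, L2_rep (\sum_(a <- s) M (w a) (V a u)) p =
    \sum_(a <- s) w a p * L2_rep u (p - a)}.
Proof.
elim: s => [|a s IH].
  rewrite big_nil; apply: filterS (L2_rep0 mu) => p ->; by rewrite big_nil.
rewrite big_cons -[M _ _]scale1r; near=> p.
rewrite -(near (L2_rep_linear 1 (M (w a) (V a u)) (\sum_(a <- s) M (w a) (V a u))) p)//.
rewrite (near IH p)// mul1r big_cons; congr (_ + _).
by rewrite (near (mult_rep (V a u) (w_meas a)) p)// (near (trans_rep a u) p).
Unshelve. all: by end_near. Qed.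

Context (N : nat) (t : 'I_N -> 'rV[R]_n) (c : 'I_N -> R[i]) (r : seq 'rV[R]_n).
Hypothesis t_inj : injective t.
Hypothesis r_uniq : uniq r.

Let h a p : R[i] := \sum_j w (a - t j) p * c j.

Let h_near (x a : 'rV[R]_n) (e : R) : 0 < e -> exists2 d0 : R, 0 < d0 &
  forall d, 0 < d <= d0 -> forall p, cube (x + a) d p ->
    normc (h a (x + a)) ^+ 2 - e <= normc (h a p) ^+ 2.
Proof.
move=> e0.
have ch : continuous (h a : 'rV[R]_n -> (R[i] : numFieldType)).
  apply: continuous_big => [|j _]; first exact: add_continuous.
  move=> p; apply: (@continuousM R[i] 'rV[R]_n); first exact: w_cont.
  exact: cst_continuous.
have c2 : continuous (fun p => normc (h a p) ^+ 2).
  by move=> p; apply: (@continuousM R 'rV[R]_n); exact: continuous_normc.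
have /cvgrPdist_lt /(_ e e0) := c2 (x + a).
move=> /nbhs_ballP[d /= d0 H]; exists (d / 2); first by rewrite divr_gt0.
move=> d' /andP[d'0 d'd] p pc.
have /H /= : ball (x + a) d p.
  rewrite -ball_normE /=; apply: (@le_lt_trans _ _ d'); last by lra.
  apply: rV_norm_le => [|i]; first exact: ltW.
  have := pc i; rewrite !mxE => /andP[? ?].
  by rewrite ler_norml; apply/andP; split; lra.
by rewrite ltr_norml => /andP[_]; lra.
Qed.

(* Test [C_bound] on the combination with coefficients [c] of the indicators of
   small cubes centred at the points [x + t j]. *)
Lemma discrete_bound (x : 'rV[R]_n) :
  \sum_(a <- r) normc (\sum_j w (a - t j) (x + a) * c j) ^+ 2 <=
  C ^+ 2 * \sum_j normc (c j) ^+ 2.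
Proof.
have C0 u : 0 <= C * hnorm u := le_trans (hnorm_ge0 _) (C_bound u).
apply/ler_addgt0Pr => e0 e0_gt0.
(* The loss [e] occurs once for each element of [r]; the successor covers an empty [r]. *)
pose e := e0 / (size r).+1%:R; have e_gt0 : 0 < e by rewrite divr_gt0 ?ltr0n.
(* The points where the output is read, those that carry the test function, and the latter moved by
   [S]. Once these are separated, a translated cube either coincides with a cube of output or misses
   it. *)
pose pts := [seq x + a | a <- r] ++ [seq x + t j | j <- enum 'I_N] ++
  [seq x + t j + s | j <- enum 'I_N, s <- S].
have [d1 d10 sep] := cube_separated pts.
have [|d2 d20 low] := @common_radius R _ r (fun a d => forall p, cube (x + a) d p ->
    normc (h a (x + a)) ^+ 2 - e <= normc (h a p) ^+ 2).
  by move=> a _; exact: h_near.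
pose d := Num.min d1 d2; have d0 : 0 < d by rewrite lt_min d10.
have {}sep := sep d (ltac:(by rewrite d0 ge_min lexx)).
have {}low := low d (ltac:(by rewrite d0 ge_min lexx orbT)).
have pts_r a : a \in r -> x + a \in pts by move=> ar; rewrite mem_cat map_f.
have pts_t j : x + t j \in pts.
  by rewrite !mem_cat (map_f (fun j => x + t j)) ?mem_enum ?orbT.
have pts_ts j s : s \in S -> x + t j + s \in pts.
  move=> sS; rewrite !mem_cat; apply/orP; right; apply/orP; right.
  by apply/allpairsP; exists (j, s); rewrite mem_enum.
have dn0 : 0 < d ^+ n by rewrite exprn_gt0.
pose v (p : 'rV[R]_n) : R[i] := \sum_j c j * (p \in cube (x + t j) d)%:R.
have v_sqr p : normc (v p) ^+ 2 = \sum_j normc (c j) ^+ 2 * \1_(cube (x + t j) d) p.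
  have b_uniq i j : p \in cube (x + t i) d -> p \in cube (x + t j) d -> i = j.
    by move=> /set_mem pi /set_mem pj; apply: t_inj; apply: (addrI x); exact: sep pi pj.
  rewrite /v -[index_enum _]enumT.
  have indC := @indic_uniq_sum _ R[i] (enum 'I_N) c (fun j => p \in cube (x + t j) d)
    (enum_uniq _) (fun i j _ _ => b_uniq i j).
  have indR := @indic_uniq_sum _ R (enum 'I_N) (fun j => normc (c j) ^+ 2)
    (fun j => p \in cube (x + t j) d) (enum_uniq _) (fun i j _ _ => b_uniq i j).
  rewrite [in RHS](eq_bigr (fun j => normc (c j) ^+ 2 * (p \in cube (x + t j) d)%:R)); last first.
    by move=> j _; rewrite indicE.
  move: indR indC.
  case=> [[i [_ bi] ->]|[nb ->]]; case=> [[j [_ bj] ->]|[nb' ->]].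
  - by rewrite (b_uniq i j).
  - by move: bi; rewrite nb' ?mem_enum.
  - by move: bj; rewrite nb ?mem_enum.
  - by rewrite normc0 expr0n.
have mv : cmeasurable v.
  have H (s : seq 'I_N) : cmeasurable (fun p => \sum_(j <- s) c j * (p \in cube (x + t j) d)%:R : R[i]).
    elim: s => [|j s IH]; first by under eq_fun do rewrite big_nil; exact: cmeasurable_cst.
    under eq_fun do rewrite big_cons.
    apply: cmeasurableD => //; apply: cmeasurableM; first exact: cmeasurable_cst.
    have mI : measurable_fun setT (\1_(cube (x + t j) d) : 'rV[R]_n -> R).
      by apply: measurable_indic; exact: measurable_cube.
    have := cmeasurable_real mI; congr cmeasurable.
    by apply/funext => p; rewrite indicE; case: (p \in _).
  exact: H.
have sqv : sqnorm mu v = ((\sum_j normc (c j) ^+ 2) * d ^+ n)%:E.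
  rewrite -(integral_cubes _ (fun j => x + t j) d0 (fun j => sqr_ge0 (normc (c j)))).
  by apply: eq_integral => p _; rewrite v_sqr.
have vL : v \in L2pred mu by apply/L2predP; split; rewrite // sqv ltry.
pose u := L2_class mu v.
have hu : hnorm u ^+ 2 = (\sum_j normc (c j) ^+ 2) * d ^+ n.
  by apply/EFin_inj; rewrite hnorm_class.
pose Fu := \sum_(s <- S) M (w s) (V s u).
have repF : {ae mu, forall p, L2_rep Fu p = \sum_(s <- S) w s p * v (p - s)}.
  have vs : {ae mu, forall p, forall s, s \in S -> L2_rep u (p - s) = v (p - s)}.
    elim: S => [|s S' IH]; first exact: aeW.
    apply: filterS2 IH (ae_shift (- s) (L2_classE vL)) => p H1 H2 s'.
    by rewrite inE => /orP[/eqP ->|/H1].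
  apply: filterS2 (rep_sum_mult_trans S u) vs => p -> H.
  by apply: eq_big_seq => s sS; rewrite H.
(* Truncated at 0 to integrate a nonnegative function. *)
pose m a := Num.max (normc (h a (x + a)) ^+ 2 - e) 0.
have m0 a : 0 <= m a by rewrite le_max lexx orbT.
(* On the cube at x + a the only translate of the cube at x + t j present is the one by s = a - t j;
   if this is not in [S], the coefficient [w s] is 0 anyway. *)
have Fh a p : a \in r -> cube (x + a) d p -> \sum_(s <- S) w s p * v (p - s) = h a p.
  move=> ar pa; rewrite /h /v.
  under eq_bigr do rewrite mulr_sumr.
  rewrite exchange_big/=; apply: eq_bigr => j _.
  have E s : s \in S -> (p - s \in cube (x + t j) d) = (s == a - t j).
    move=> sS; apply/idP/eqP => [/set_mem/cube_shift ps|->].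
      have := sep _ _ (pts_ts j s sS) (pts_r a ar) _ ps pa.
      by rewrite -addrA => /addrI <-; rewrite addrAC subrr add0r.
    by apply/mem_set/cube_shift; rewrite -addrA [t j + _]addrC subrK.
  have [aS|aS] := boolP (a - t j \in S).
    rewrite (bigD1_seq (a - t j))//= E// eqxx mulr1 big1_seq ?addr0//.
    by move=> s /andP[sa sS]; rewrite E// (negbTE sa) !mulr0.
  rewrite w_supp// mul0r big1_seq// => s /andP[_ sS]; rewrite E//.
  by case: eqP => [sa|_]; [by rewrite -sa sS in aS|rewrite !mulr0].
have lower p : \sum_(a <- r) m a * \1_(cube (x + a) d) p <=
    normc (\sum_(s <- S) w s p * v (p - s)) ^+ 2.
  under eq_bigr do rewrite indicE.
  have := @indic_uniq_sum _ R r m (fun a => p \in cube (x + a) d) r_uniq.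
  case=> [a b ar br /set_mem pa /set_mem pb| [a [ar /set_mem pa] ->]|[_ ->]].
  - by apply: (addrI x); apply: sep pa pb; exact: pts_r.
  - by rewrite (Fh a)// ge_max low// sqr_ge0.
  - exact: sqr_ge0.
have key : (\sum_(a <- r) m a) * d ^+ n <= C ^+ 2 * ((\sum_j normc (c j) ^+ 2) * d ^+ n).
  rewrite -hu -exprMn -lee_fin -(integral_cubes r (fun a => x + a) d0 m0).
  apply: (@le_trans _ _ (hnorm Fu ^+ 2)%:E); last first.
    by rewrite lee_fin ler_sqr_ge0 ?hnorm_ge0// C_bound.
  rewrite hnorm_rep /sqnorm; apply: ae_ge0_le_integral => //.
  - by move=> p _; rewrite lee_fin sumr_ge0// => a _; rewrite mulr_ge0.
  - apply/measurable_EFinP; apply: measurable_sum => a; apply: measurable_funM => //.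
    by apply: measurable_indic; exact: measurable_cube.
  - by move=> p _; rewrite lee_fin sqr_ge0.
  - by apply/measurable_EFinP/measurable_normc2; exact: L2_repM.
  - by apply: filterS repF => p -> _; rewrite lee_fin lower.
move: key; rewrite mulrA ler_pM2r// => key.
apply: (@le_trans _ _ (\sum_(a <- r) (m a + e))).
  by apply: ler_sum => a _; rewrite -lerBlDr le_max lexx.
rewrite big_split/= lerD// big_const_seq count_predT iter_addr_0.
rewrite -mulr_natr /e mulrAC ler_pdivrMr ?ltr0n// ler_pM2l// ler_nat.
exact: leqnSn.
Qed.
End weighted_translations.

(** Bernoulli's inequality, squared so that a quadratic beats a linear term, then raised to the
    power K + 1. *)
Lemma exp_beats_poly (R : realType) (q : R) K : 1 < q ->
  exists N, (N.+1%:R) ^+ K < q ^+ N.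
Proof.
move=> q1; pose d := q - 1; have d0 : 0 < d by rewrite subr_gt0.
have bern M : 1 + M%:R * d <= q ^+ M.
  elim: M => [|M IH]; first by rewrite mul0r addr0 expr0.
  rewrite exprS -natr1 (_ : q = 1 + d); last by rewrite /d addrC subrK.
  rewrite (_ : 1 + d = q) in IH *; last by rewrite /d addrC subrK.
  apply: (@le_trans _ _ (q * (1 + M%:R * d))); last by rewrite ler_wpM2l//; lra.
  have : 0 <= M%:R * d * d by rewrite !mulr_ge0// ltW.
  rewrite /d; lra.
(* With N = L (M + 1), q^N = ((q^(M+1))^2)^(K+1), and the choice of M yields (M + 1)^2 d^2 > (L + 1)
   (M + 1) > N. The exponent K + 1 keeps the comparison strict for K = 0. *)
pose L := (2 * K.+1)%N.
have [M HM] : exists M : nat, L.+1%:R / d ^+ 2 < M.+1%:R.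
  by exists (Num.truncn (L.+1%:R / d ^+ 2)); exact: truncnS_gt.
exists (L * M.+1)%N.
apply: (@le_lt_trans _ _ (((L * M.+1).+1%:R) ^+ K.+1)).
  by rewrite ler_weXn2l// ler1n.
rewrite /L mulnAC exprM ltr_pXn2r ?nnegrE ?exprn_ge0//; last by lra.
apply: (@lt_le_trans _ _ ((1 + M.+1%:R * d) ^+ 2)); last first.
  rewrite mulnC exprM ler_sqr_ge0//; first by rewrite addr_ge0// mulr_ge0// ltW.
  by rewrite exprn_ge0//; lra.
move: HM; rewrite ltr_pdivrMr ?exprn_gt0// => HM.
have M1 : 1 <= M.+1%:R :> R by rewrite ler1n.
apply: (@le_lt_trans _ _ (L.+1%:R * M.+1%:R)).
  rewrite -natrM ler_nat /L.
  have -> : (2 * M.+1 * K.+1 = 2 * K.+1 * M.+1)%N by rewrite mulnAC.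
  by rewrite ltn_pmul2r.
have H : L.+1%:R * M.+1%:R < (M.+1%:R * d ^+ 2) * M.+1%:R.
  by rewrite ltr_pM2r ?ltr0n.
apply: lt_le_trans H _; rewrite (_ : _ * _ * _ = (M.+1%:R * d) ^+ 2); last by ring.
by rewrite ler_sqr_ge0 ?lerDr// ?addr_ge0 ?mulr_ge0// ltW.
Qed.

(** * Polynomial growth in a finitely generated abelian group *)

Section folner.
Context (R : realType) (G : zmodType) (S : seq G).

(* Folner sets: the minus signs make [a - s] land in the next set. *)
Definition box N : seq G := undup
  [seq - \sum_(i < size S) nth 0 S i *+ (k i) | k : {ffun 'I_(size S) -> 'I_N.+1}].

Lemma box_uniq N : uniq (box N). Proof. exact: undup_uniq. Qed.

Lemma size_box N : (size (box N) <= N.+1 ^ size S)%N.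
Proof.
apply: leq_trans (size_undup _) _.
by rewrite size_map -cardE card_ffun !card_ord.
Qed.

Lemma size_box_gt0 N : (0 < size (box N))%N.
Proof.
suff : 0 \in box N by case: (box N).
rewrite mem_undup; apply/mapP; exists [ffun=> ord0]; first by rewrite mem_enum.
by rewrite big1 ?oppr0// => i _; rewrite ffunE mulr0n.
Qed.

Lemma box_sub N a s : a \in box N -> s \in S -> a - s \in box N.+1.
Proof.
rewrite !mem_undup => /mapP[k _ ->] sS; apply/mapP.
have is_ : (index s S < size S)%N by rewrite index_mem.
pose i0 := Ordinal is_.
exists [ffun i => inord (k i + (i == i0))]; first by rewrite mem_enum.
rewrite -opprD; congr (- _).
have -> : s = \sum_(i < size S) nth 0 S i *+ (i == i0).
  rewrite (bigD1 i0)//= eqxx mulr1n nth_index// big1 ?addr0// => i /negbTE ->.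
  by rewrite mulr0n.
rewrite -big_split/=; apply: eq_bigr => i _.
rewrite ffunE inordK ?mulrnDr//.
by rewrite ltnS (leq_trans (leq_add (leq_ord _) (leq_b1 _)))// addn1.
Qed.

(** Amenability in the only form used: if W > B > 0, the boxes would grow at least like (W / B)^N,
    against the polynomial bound [size_box]. No limit of quotients of sizes is taken. *)
Lemma folner_le (W B : R) : 0 <= B ->
  (forall N, (size (box N))%:R * W <= (size (box N.+1))%:R * B) -> W <= B.
Proof.
move=> B0 H; rewrite leNgt; apply/negP => BW.
have [B00|Bn0] := eqVneq B 0.
  have := H 0%N; rewrite B00 mulr0 leNgt mulr_gt0// ?ltr0n ?size_box_gt0//.
  by rewrite -B00.
have Bp : 0 < B by rewrite lt_neqAle eq_sym Bn0.
pose q := W / B; have q1 : 1 < q by rewrite ltr_pdivlMr// mul1r.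
have q0 : 0 <= q by rewrite ltW// (lt_trans ltr01).
have low N : q ^+ N <= (size (box N))%:R.
  elim: N => [|N IH]; first by rewrite expr0 ler1n size_box_gt0.
  rewrite exprS; apply: le_trans (ler_wpM2l q0 IH) _.
  by rewrite /q mulrAC ler_pdivrMr// mulrC H.
have [N NK] := exp_beats_poly (size S) q1.
have : (size (box N))%:R < q ^+ N.
  by apply: le_lt_trans NK; rewrite -natrX ler_nat size_box.
by move/(le_lt_trans (low N)); rewrite ltxx.
Qed.
End folner.

(** * Domination by the representation on L2 *)

Section key_inequality.
Context (R : realType) (n : nat).
Hypothesis n_ge1 : (1 <= n)%N.
Local Notation A := (C0plus R 'rV[R]_n).
Local Notation mu := (lebesgue_rV R n).
Local Notation M w := (multiplication mu mu w).
Local Notation V a := (translation mu a).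
Local Notation alpha := (translation_action R n).

Lemma bmeasurable_ev (a : A) : bmeasurable (ev a).
Proof.
apply: bmeasurableD; last exact: bmeasurable_cst.
by apply: C0_bmeasurable; exact: C0_valP_set.
Qed.

Lemma continuous_ev (a : A) : continuous (ev a : 'rV[R]_n -> (R[i] : numFieldType)).
Proof.
move=> p; apply: (@continuousD R[i] R[i]^o 'rV[R]_n); last exact: cst_continuous.
by have [c _] := C0_valP_set a.1; exact: c.
Qed.

Variables (f : {fsfun 'rV[R]_n -> A with 0}) (C : R).
Hypothesis C_ge0 : 0 <= C.
Hypothesis C_bound : forall u : L2 mu,
  hnorm (\sum_(s <- finsupp f) M (ev (f s)) (V s u)) <= C * hnorm u.
Variable rho : covariant_rep alpha.
Local Notation pi := (@cr_pi _ _ _ _ rho).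
Local Notation U := (@cr_U _ _ _ _ rho).

(** Covariance gives U_(-a) pi(f (a - t)) U_(a - t) = pi(B a t) U_(-t): these are the coefficients
    left once all unitaries are moved to the right. *)
Let B (a t : 'rV[R]_n) : A := alpha (- a) (f (a - t)).

(* [(C ^+ 2 + e) 1 - B^* B] is a positive matrix over the unitization, because
   it is so at every point by [discrete_bound]. *)
Lemma matrix_bound N (t : 'I_N -> 'rV[R]_n) (r : seq 'rV[R]_n)
    (xi : 'I_N -> cr_space rho) : injective t -> uniq r ->
  \sum_(a <- r) hnorm (\sum_j pi (B a (t j)) (xi j)) ^+ 2 <=
  C ^+ 2 * \sum_j hnorm (xi j) ^+ 2.
Proof.
move=> t_inj r_uniq.
have CE0 : 0 <= \sum_j hnorm (xi j) ^+ 2 by apply: sumr_ge0 => j _; exact: sqr_ge0.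
(* [positive_matrix] needs a strict margin; it is removed at the end with e / (X + 1), X being the
   sum of the |xi j|^2. *)
suff H (e : R) : 0 < e -> \sum_(a <- r) hnorm (\sum_j pi (B a (t j)) (xi j)) ^+ 2 <=
    (C ^+ 2 + e) * \sum_j hnorm (xi j) ^+ 2.
  apply/ler_addgt0Pr => e e0; set X := \sum_j _ in CE0 H *.
  have X1 : 0 < X + 1 by rewrite ltr_wpDl.
  apply: le_trans (H (e / (X + 1)) (divr_gt0 e0 X1)) _.
  rewrite mulrDl lerD2l mulrAC ler_pdivrMr// ler_pM2l// lerDl//.
move=> e0; pose G (i j : 'I_N) : A := (if i == j then (C ^+ 2 + e)%:C *: 1 else 0) -
  \sum_(a <- r) star (B a (t i)) * B a (t j).
have ReS I (s : seq I) (F : I -> R) : complex.Re (\sum_(i <- s) (F i)%:C) = \sum_(i <- s) F i.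
  by rewrite -rmorph_sum.
have ReB (x y : R[i]) : complex.Re (x - y) = complex.Re x - complex.Re y.
  by case: x y => [? ?] [? ?].
have ReM (x : R) (y : R[i]) : complex.Re (x%:C * y) = x * complex.Re y.
  by case: y => [y z] /=; rewrite mul0r subr0.
have := @positive_matrix R n n_ge1 _ pi (@cr_pi_bounded _ _ _ _ rho)
  (@cr_pi_linear _ _ _ _ rho) (@cr_piM _ _ _ _ rho) (@cr_pi_star _ _ _ _ rho)
  e N G xi e0.
have piD a b u : pi (a + b) u = pi a u + pi b u.
  by have := @cr_pi_linear _ _ _ _ rho 1 a b; rewrite !scale1r => ->.
have piZ z a u : pi (z *: a) u = z *: pi a u.
  have := @cr_pi_linear _ _ _ _ rho z a 0; rewrite addr0 => ->.
  have -> : pi 0 = 0.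
    by have := @cr_pi_linear _ _ _ _ rho (-1) 0 0; rewrite scaler0 addr0 scaleN1r addNr.
  by rewrite addr0.
have pi0 : pi 0 = 0.
  by have := @cr_pi_linear _ _ _ _ rho (-1) 0 0; rewrite scaler0 addr0 scaleN1r addNr.
have herm i j : star (G i j) = G j i.
  rewrite /G starB star_sum; congr (_ - _).
    rewrite eq_sym; case: (j == i); last exact: star0.
    by rewrite starZ star1; congr (_ *: _); exact: conjc_real.
  by apply: eq_bigr => a _; rewrite starM starK.
have scal p (c : 'I_N -> R[i]) : e * \sum_(i < N) normc (c i) ^+ 2 <=
     complex.Re (\sum_i \sum_j ev (G i j) p * c j * (c i)^*).
  pose qev (a : A) (u v : R[i]) := ev a p * u * v^*.
  have := @qform_gram R A R[i] (fun a u => ev a p * u) qev _ _ _ _ _ _ N _ r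
    (fun a j => B a (t j)) (C ^+ 2 + e)%:C c.
  have h1 a c1 u v : qev (a + c1) u v = qev a u v + qev c1 u v.
    by rewrite /qev evD; ring.
  have h2 a u u' v : qev a (u + u') v = qev a u v + qev a u' v.
    by rewrite /qev; ring.
  have h3 a u v v' : qev a u (v + v') = qev a u v + qev a u v'.
    by rewrite /qev rmorphD/=; ring.
  have h4 a c1 u v : qev a (ev c1 p * u) v = qev (a * c1) u v.
    by rewrite /qev evM; ring.
  have h5 a c1 u v : qev a u (ev c1 p * v) = qev (star c1 * a) u v.
    by rewrite /qev rmorphM/= evM ev_star; ring.
  have h6 z a u v : qev (z *: a) u v = z * qev a u v.
    by rewrite /qev evZ; ring.
  move=> /(_ h1 h2 h3 h4 h5 h6); rewrite {1}/qform /qev => ->.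
  have E (x : R[i]) : ev 1 p * x * x^* = (normc x ^+ 2)%:C.
    rewrite ev1 mul1r normc_sqr; case: x => x y.
    by apply/eqP; rewrite eq_complex/=; apply/andP; split; apply/eqP; ring.
  rewrite (eq_bigr _ (fun i _ => E (c i))) (eq_bigr _ (fun a _ => E _)).
  rewrite ReB -rmorph_sum ReM ReS/= mulrDl addrAC lerDr subr_ge0.
  have := @discrete_bound R n (finsupp f) (fun s => ev (f s)) (fset_uniq _) _ _ _ C C_bound
    N t c r t_inj r_uniq p.
  move=> H; apply: (le_trans _ (H _ _ _)) => [|s q sf|s|s].
  - rewrite le_eqVlt; apply/orP; left; apply/eqP; apply: eq_bigr => a _.
    by congr (normc _ ^+ 2); apply: eq_bigr => j _; rewrite /B ev_shift opprK.
  - by rewrite fsfun_dflt// ev0.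
  - exact: continuous_ev.
  - exact: bmeasurable_ev.
move=> /(_ herm scal).
pose qpi a u v := hdot (pi a u) v.
have k1 a c u v : qpi (a + c) u v = qpi a u v + qpi c u v by rewrite /qpi piD hdotDl.
have k2 a u u' v : qpi a (u + u') v = qpi a u v + qpi a u' v.
  by rewrite /qpi (linear_opD (@cr_pi_bounded _ _ _ _ rho a).1) hdotDl.
have k3 a u v v' : qpi a u (v + v') = qpi a u v + qpi a u v' by rewrite /qpi hdotDr.
have k4 a c u v : qpi a (pi c u) v = qpi (a * c) u v by rewrite /qpi cr_piM.
have k5 a c u v : qpi a u (pi c v) = qpi (star c * a) u v.
  by rewrite /qpi cr_piM /= (is_adjointC (@cr_pi_star _ _ _ _ rho c)).
have k6 z a u v : qpi (z *: a) u v = z * qpi a u v by rewrite /qpi piZ hdotZl.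
have := @qform_gram R A _ pi qpi k1 k2 k3 k4 k5 k6 N _ r
    (fun a j => B a (t j)) (C ^+ 2 + e)%:C xi.
rewrite {1}/qform => ->.
have E x : qpi 1 x x = (hnorm x ^+ 2)%:C by rewrite /qpi cr_pi1 hdotE.
rewrite (eq_bigr _ (fun i _ => E (xi i))) (eq_bigr _ (fun a _ => E _)).
by rewrite ReB -rmorph_sum ReM ReS/= subr_ge0.
Qed.

(** Rows a in [box N], columns t in [box N.+1] and vectors U_(-t) u: every row sum equals U_(-a)
    applied to the integrated form at u, so all have the same norm. [matrix_bound] then compares the
    sizes of two consecutive boxes, as [folner_le] expects. *)
Lemma universal_rep_bound (u : cr_space rho) :
  hnorm (universal_rep f u) <= C * hnorm u.
Proof.
have U_hnorm s v : hnorm (U s v) = hnorm v.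
  exact: (isometry_hnorm (@cr_U_unitary _ _ _ _ rho s)).
have pi0 v : pi 0 v = 0.
  suff -> : pi 0 = 0 by [].
  by have := @cr_pi_linear _ _ _ _ rho (-1) 0 0; rewrite scaler0 addr0 scaleN1r addNr.
pose F s := pi (f s) (U s u).
(* As t runs over the larger box, a - t takes each value of the support exactly once; other values
   contribute 0. *)
have sumF N a : a \in box (finsupp f) N ->
    \sum_(t <- box (finsupp f) N.+1) F (a - t) = universal_rep f u.
  move=> aN; have F0 s : s \notin finsupp f -> F s = 0.
    by move=> sf; rewrite /F fsfun_dflt// pi0.
  rewrite -(big_map (fun t => a - t) predT F) (bigID (mem (finsupp f)))/=.
  rewrite [X in _ + X]big1 ?addr0//; rewrite -big_filter.
  apply: perm_big; apply: uniq_perm; rewrite ?fset_uniq//.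
    rewrite filter_uniq// map_inj_uniq ?box_uniq//.
    by move=> x y /addrI/oppr_inj.
  move=> s; rewrite mem_filter andb_idr// => sf.
  by apply/mapP; exists (a - s); [exact: box_sub|rewrite opprB addrC subrK].
suff : hnorm (universal_rep f u) ^+ 2 <= C ^+ 2 * hnorm u ^+ 2.
  by rewrite -exprMn ler_sqr_ge0 ?hnorm_ge0 ?mulr_ge0 ?hnorm_ge0.
apply: (@folner_le _ _ (finsupp f)) => [|N]; first by rewrite mulr_ge0 ?sqr_ge0.
pose T := in_tuple (box (finsupp f) N.+1).
have t_inj : injective (tnth T) by apply/tuple_uniqP; exact: box_uniq.
have := @matrix_bound _ (tnth T) (box (finsupp f) N) (fun j => U (- tnth T j) u)
  t_inj (box_uniq _ _).
under [in leRHS]eq_bigr do rewrite U_hnorm.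
rewrite sumr_const card_ord -[_ *+ size _]mulr_natl mulrCA; apply: le_trans.
rewrite mulr_natl -iter_addr_0 -[X in iter X]count_predT -big_const_seq.
rewrite big_seq [leRHS]big_seq ler_sum// => a aN.
rewrite -(sumF N a aN) -[in leLHS](U_hnorm (- a)) le_eqVlt; apply/orP; left; apply/eqP.
congr (hnorm _ ^+ 2).
rewrite (big_morph (U (- a)) (linear_opD (@cr_U_linear _ _ _ _ rho (- a)))
  (linear_op0 (@cr_U_linear _ _ _ _ rho (- a)))).
rewrite big_tnth; apply: eq_bigr => j _; set t := tnth _ _.
rewrite /F -[LHS]/((U (- a) \o pi (f (a - t))) _) cr_covariant /=.
by rewrite -[U (- a) (U (a - t) u)]/((U (- a) \o U (a - t)) u) -cr_UD addKr.
Qed.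
End key_inequality.

(** * The crossed product *)

Lemma le0_half_powers (R : realType) (x c : R) :
  (forall k, x <= 2^-1 ^+ k * c) -> x <= 0.
Proof.
move=> xc; apply/ler_addgt0Pr => e e0; rewrite add0r.
have c1 : 0 < `|c| + 1 by rewrite ltr_wpDl.
have [k ke] := exprn_half_small (divr_gt0 e0 c1).
apply: le_trans (xc k) _; rewrite ltr_pdivlMr// in ke.
apply: le_trans (ltW ke); rewrite ler_wpM2l ?exprn_ge0 ?invr_ge0//.
by apply: le_trans (ler_norm c) _; rewrite lerDl.
Qed.

(** * Integrated forms and their uniform limits *)

Section integrated_forms.
Context (R : realType) (G : zmodType) (A : starAlgType R) (alpha : star_action G A).
Implicit Types (f g : {fsfun G -> A with 0}) (S : {fset G}) (c : R[i]).

Section representation.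
Variable rho : covariant_rep alpha.
Local Notation pi := (@cr_pi _ _ _ _ rho).
Local Notation U := (@cr_U _ _ _ _ rho).
Local Notation I f := (@universal_rep _ _ _ _ f rho).
Implicit Types u v : cr_space rho.

Lemma cr_pi_lin c a b u : pi (c *: a + b) u = c *: pi a u + pi b u.
Proof. by rewrite cr_pi_linear. Qed.

Lemma cr_pi0 u : pi 0 u = 0.
Proof. by have := cr_pi_lin (-1) 0 0 u; rewrite scaler0 addr0 scaleN1r addNr. Qed.

Lemma cr_U_hnorm s u : hnorm (U s u) = hnorm u.
Proof. exact: (isometry_hnorm (@cr_U_unitary _ _ _ _ rho s)). Qed.

Lemma cr_U_bounded s : bounded_op (U s).
Proof.
by split; [exact: cr_U_linear|exists 1 => u; rewrite cr_U_hnorm mul1r].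
Qed.

Lemma universal_rep_supp S f u : (finsupp f `<=` S)%fset ->
  I f u = \sum_(s <- S) pi (f s) (U s u).
Proof.
move=> fS; rewrite /universal_rep; apply: big_fset_incl => // s _ sf.
by rewrite fsfun_dflt// cr_pi0.
Qed.

Definition fsfun_lin c f g : {fsfun G -> A with 0} :=
  [fsfun s in (finsupp f `|` finsupp g)%fset => c *: f s + g s].

Lemma universal_rep_lin c f g u :
  I (fsfun_lin c f g) u = c *: I f u + I g u.
Proof.
pose S := (finsupp f `|` finsupp g)%fset.
rewrite !(@universal_rep_supp S) ?fsubsetUl ?fsubsetUr//; last first.
  exact: finsupp_sub.
rewrite scaler_sumr -big_split/= big_seq [RHS]big_seq; apply: eq_bigr => s sS.
by rewrite fsfunE sS cr_pi_lin.
Qed.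

Definition integrated_forms : set (cr_space rho -> cr_space rho) :=
  range (fun f => I f).

Lemma universal_repE f : I f = \sum_(s <- finsupp f) (pi (f s) \o U s).
Proof. by apply/funext => u; rewrite /universal_rep fct_sumE. Qed.

Lemma universal_rep_bounded f : bounded_op (I f).
Proof.
rewrite universal_repE; elim/big_ind: _ => [|? ?|s _]; [exact: bounded_op0|exact: bounded_opD|].
by apply: bounded_op_comp; [exact: cr_pi_bounded|exact: cr_U_bounded].
Qed.

Lemma integrated_forms_lin c T T' : integrated_forms T -> integrated_forms T' ->
  integrated_forms (c *: T + T').
Proof.
move=> [f _ <-] [g _ <-]; exists (fsfun_lin c f g) => //.
by apply/funext => u; rewrite universal_rep_lin.
Qed.

Lemma integrated_forms0 : integrated_forms 0.
Proof.
by exists [fsfun] => //; apply/funext => u; rewrite /universal_rep finsupp0 big_seq_fset0.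
Qed.

Lemma integrated_forms_sum J (r : seq J) (F : J -> cr_space rho -> cr_space rho) :
  (forall j, integrated_forms (F j)) -> integrated_forms (\sum_(j <- r) F j).
Proof.
move=> FI; elim/big_ind: _ => [|T T' iT iT'|//]; first exact: integrated_forms0.
by rewrite -[T]scale1r; exact: integrated_forms_lin.
Qed.

Lemma integrated_forms1 a s : integrated_forms (pi a \o U s).
Proof.
exists [fsfun x in [fset s]%fset => a] => //; apply/funext => u.
rewrite (@universal_rep_supp [fset s]%fset) ?finsupp_sub// big_seq_fset1.
by rewrite fsfunE inE eqxx.
Qed.

(** Covariance gives pi(a) U_s pi(b) U_t = pi(a alpha_s(b)) U_(s+t). Working on these elementary
    operators spares a convolution product on finitely supported functions. *)
Lemma integrated_formsM T T' : integrated_forms T -> integrated_forms T' ->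
  integrated_forms (T \o T').
Proof.
move=> [f _ <-] [g _ <-].
rewrite (_ : _ \o _ = \sum_(s <- finsupp f) \sum_(t <- finsupp g)
    (pi (f s * alpha s (g t)) \o U (s + t))).
  by do 2!apply: integrated_forms_sum => ?; exact: integrated_forms1.
apply/funext => u; rewrite /= fct_sumE; apply: eq_bigr => s _.
rewrite fct_sumE /universal_rep.
rewrite (big_morph (U s) (linear_opD (@cr_U_linear _ _ _ _ rho s))
  (linear_op0 (@cr_U_linear _ _ _ _ rho s))).
have [lp _] := @cr_pi_bounded _ _ _ _ rho (f s).
rewrite (big_morph _ (linear_opD lp) (linear_op0 lp)); apply: eq_bigr => t _ /=.
rewrite cr_piM cr_UD /=; congr (pi (f s) _).
by rewrite -[LHS]/((U s \o pi (g t)) (U t u)) cr_covariant.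
Qed.

Lemma integrated_forms_adjoint T : integrated_forms T ->
  exists2 T', integrated_forms T' & is_adjoint T T'.
Proof.
move=> [f _ <-].
exists (\sum_(s <- finsupp f) (pi (alpha (- s) (star (f s))) \o U (- s))).
  by apply: integrated_forms_sum => s; exact: integrated_forms1.
move=> u v; rewrite fct_sumE hdot_suml hdot_sumr; apply: eq_bigr => s _.
rewrite cr_pi_star -(@cr_covariant _ _ _ _ rho (- s)) /=.
rewrite -(@cr_U_unitary _ _ _ _ rho (- s)).
by rewrite -[U (- s) (U s u)]/((U (- s) \o U s) u) -cr_UD addNr cr_U0.
Qed.
End representation.

Lemma universal_norm_leP (x : op_family alpha) (c : R) : 0 <= c ->
  (forall rho, linear (x rho)) ->
  (universal_norm x <= c%:E)%E <-> forall rho u, hnorm (x rho u) <= c * hnorm u.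
Proof.
move=> c0 lx; split => [xc rho|xc].
  apply: (opnormP (lx rho)); apply: le_trans xc; apply: ereal_sup_ubound.
  by exists rho.
apply: ge_ereal_sup => _ [rho ->]; by apply/(opnorm_leP (lx rho) c0)/(xc rho).
Qed.

Lemma crossed_product_approx (x : op_family alpha) (e : R) : crossed_product x -> 0 < e ->
  exists f, forall rho (u : cr_space rho),
    hnorm (x rho u - universal_rep f u) <= e * hnorm u.
Proof.
move=> [bx xf] e0; have [f] := xf e e0.
move/(universal_norm_leP (ltW e0)) => H; exists f; apply: H => rho.
by apply: linearB_op; [exact: (bx rho).1|exact: (@universal_rep_bounded rho f).1].
Qed.

(** Boundedness of each component comes for free, from an approximation within 1. *)
Lemma crossed_productI (x : op_family alpha) : (forall rho, linear (x rho)) ->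
  (forall e : R, 0 < e -> exists f, forall rho (u : cr_space rho),
    hnorm (x rho u - universal_rep f u) <= e * hnorm u) ->
  crossed_product x.
Proof.
move=> lx xf; have bx rho : bounded_op (x rho).
  have [f xf1] := xf 1 ltr01; have [_ [c fc]] := @universal_rep_bounded rho f.
  split; [exact: lx|exists (1 + c) => u].
  rewrite -[x rho u](subrK (universal_rep f u)) mulrDl.
  by apply: le_trans (ler_hnormD _ _) (lerD (xf1 rho u) (fc u)).
split=> // e e0; have [f xfe] := xf e e0; exists f.
apply/universal_norm_leP; rewrite ?(ltW e0)// => rho.
by apply: linearB_op; [exact: lx|exact: (@universal_rep_bounded rho f).1].
Qed.
End integrated_forms.

(** * Evaluation at a dominating representation *)

Section faithful_representation.
Context (R : realType) (G : zmodType) (A : starAlgType R) (alpha : star_action G A).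
Variable rho0 : covariant_rep alpha.
Local Notation H := (cr_space rho0).
Implicit Types (f g : {fsfun G -> A with 0}).

(** The norm closure of the integrated forms in the single representation [rho0], destined to be the
    image of the evaluation. *)
Definition approximable : set (H -> H) := [set T | bounded_op T /\
  forall e : R, 0 < e -> exists f, forall u, hnorm (T u - universal_rep f u) <= e * hnorm u].

Lemma approximableP T : approximable T <-> bounded_op T /\
  forall e : R, 0 < e -> exists2 F, @integrated_forms _ _ _ _ rho0 F &
    forall u, hnorm (T u - F u) <= e * hnorm u.
Proof.
split=> -[bT Tf]; split=> // e /Tf.
  by move=> [f fT]; exists (@universal_rep _ _ _ _ f rho0) => //; exists f.
by move=> [_ [f _ <-] fT]; exists f.
Qed.

Lemma integrated_forms_bounded (rho : covariant_rep alpha) (F : cr_space rho -> cr_space rho) :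
  integrated_forms F -> bounded_op F.
Proof. by move=> [f _ <-]; exact: universal_rep_bounded. Qed.

Lemma approximable_integrated_forms F : integrated_forms F -> approximable F.
Proof.
move=> iF; apply/approximableP; split; first exact: integrated_forms_bounded.
move=> e e0; exists F => // u; rewrite subrr hnorm0.
by rewrite mulr_ge0 ?(ltW e0) ?hnorm_ge0.
Qed.

Lemma approximable_subalgebra : cstar_subalgebra approximable.
Proof.
split.
- by move=> T [].
- exact/approximable_integrated_forms/integrated_forms0.
- move=> T S /approximableP[bT Tf] /approximableP[bS Sf]; apply/approximableP.
  split; first exact: bounded_opD.
  move=> e e0; have e2 : 0 < e / 2 by lra.
  have [F iF TF] := Tf _ e2; have [F' iF' SF'] := Sf _ e2.
  exists (F + F'); first by rewrite -[F]scale1r; exact: integrated_forms_lin.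
  move=> u; rewrite !fctE opprD addrACA.
  apply: le_trans (ler_hnormD _ _) _.
  have := TF u; have := SF' u; lra.
- move=> c T /approximableP[bT Tf]; apply/approximableP.
  split; first exact: bounded_op_scale.
  move=> e e0; have c1 : 0 < normc c + 1 by rewrite ltr_wpDl ?normc_ge0.
  have [F iF TF] := Tf _ (divr_gt0 e0 c1).
  exists (c *: F).
    by rewrite -[_ *: _]addr0; apply: integrated_forms_lin => //; exact: integrated_forms0.
  move=> u; rewrite [_ - _](_ : _ = c *: (T u - F u)); last by rewrite scalerBr.
  rewrite hnormZ; apply: le_trans (ler_wpM2l (normc_ge0 c) (TF u)) _.
  rewrite mulrA ler_wpM2r ?hnorm_ge0// mulrCA -[leRHS]mulr1 ler_wpM2l ?(ltW e0)//.
  by rewrite ler_pdivrMr// mul1r lerDl.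
- move=> T S /approximableP[bT Tf] /approximableP[bS Sf]; apply/approximableP.
  split; first exact: bounded_op_comp.
  have [c c0 Tc] := bounded_opP bT; have [d d0 Sd] := bounded_opP bS.
  (* The second entry controls T (S - F'); the first gives |F'| <= d + 1, which enters the bound for
     (T - F) F'. *)
  move=> e e0; pose e1 := Num.min 1 (e / 2 / c).
  have e10 : 0 < e1 by rewrite lt_min ltr01 !divr_gt0.
  have d1 : 0 < d + 1 by lra.
  have e20 : 0 < e / 2 / (d + 1) by rewrite !divr_gt0.
  have [F iF TF] := Tf _ e20; have [F' iF' SF'] := Sf _ e10.
  exists (F \o F'); first exact: integrated_formsM.
  move=> u /=; apply: le_trans (hdist_triangle _ (T (F' u)) _) _.
  rewrite -(linear_opB bT.1).
  have uge := hnorm_ge0 u.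
  have p1 : hnorm (T (S u - F' u)) <= e / 2 * hnorm u.
    apply: le_trans (Tc _) _; apply: le_trans (ler_wpM2l (ltW c0) (SF' u)) _.
    rewrite mulrA ler_wpM2r// mulrC -ler_pdivlMr//.
    by rewrite /e1 ge_min lexx orbT.
  have p2 : hnorm (F' u) <= (d + 1) * hnorm u.
    have := ler_hnormB (S u) (S u - F' u); rewrite subKr => /le_trans; apply.
    rewrite mulrDl; apply: lerD => //; apply: le_trans (SF' u) _.
    by rewrite ler_wpM2r// /e1 ge_min lexx.
  have p3 : hnorm (T (F' u) - F (F' u)) <= e / 2 * hnorm u.
    apply: le_trans (TF _) _; apply: le_trans (ler_wpM2l (ltW e20) p2) _.
    by rewrite mulrA mulfVK// gt_eqF.
  have := lerD p1 p3; lra.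
- move=> T S /approximableP[bT Tf] TS; apply/approximableP.
  have [c c0 Tc] := bounded_opP bT.
  split; first by have [lS Sc] := adjoint_bound bT.1 Tc TS; split=> //; exists c.
  move=> e e0; have [F iF TF] := Tf _ e0.
  have [F' iF' FF'] := integrated_forms_adjoint iF; exists F' => //.
  have bF := integrated_forms_bounded iF.
  have aTF : is_adjoint (T - F) (S - F').
    by move=> u v; rewrite !fctE hdotBl hdotBr TS FF'.
  by have [_] := adjoint_bound (linearB_op bT.1 bF.1) TF aTF.
- move=> T bT H1; apply/approximableP; split=> // e e0.
  have e2 : 0 < e / 2 by lra.
  have [S /approximableP[bS Sf] TS] := H1 _ e2.
  have [F iF SF] := Sf _ e2; exists F => // u.
  apply: le_trans (hdist_triangle _ (S u) _) _.
  have := opnormP (linearB_op bT.1 bS.1) TS u; rewrite !fctE.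
  have := SF u; lra.
Qed.

Hypothesis rho0_dominates : forall (f : {fsfun G -> A with 0}) (C : R), 0 <= C ->
  (forall u : H, hnorm (universal_rep f u) <= C * hnorm u) ->
  forall (rho : covariant_rep alpha) (u : cr_space rho),
    hnorm (universal_rep f u) <= C * hnorm u.

Lemma rho0_dominatesB f g (C : R) : 0 <= C ->
  (forall u : H, hnorm (universal_rep f u - universal_rep g u) <= C * hnorm u) ->
  forall (rho : covariant_rep alpha) (u : cr_space rho),
    hnorm (universal_rep f u - universal_rep g u) <= C * hnorm u.
Proof.
move=> C0 fg rho u; have E rho' (v : cr_space rho') :
    universal_rep f v - universal_rep g v = universal_rep (fsfun_lin (-1) g f) v.
  by rewrite universal_rep_lin scaleN1r addrC.
by rewrite E; apply: rho0_dominates => // v; rewrite -E.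
Qed.

(** If x and y agree at [rho0], approximants f and g within e are 2 e close there, hence in every
    representation by domination. So x and y are within 4 e of each other everywhere. *)
Lemma crossed_product_inj (x y : op_family alpha) : crossed_product x ->
  crossed_product y -> x rho0 = y rho0 -> x = y.
Proof.
move=> cx cy xy; apply: functional_extensionality_dep => rho.
apply/funext => u; apply/subr0_eq/hnorm0_eq0/eqP.
rewrite eq_le hnorm_ge0 andbT; apply: (@le0_half_powers _ _ (4 * hnorm u)) => k.
set e := 2^-1 ^+ k; have e0 : 0 < e by rewrite exprn_gt0// invr_gt0.
have [f xf] := crossed_product_approx cx e0.
have [g yg] := crossed_product_approx cy e0.
have fg : hnorm (universal_rep f u - universal_rep g u) <= (e + e) * hnorm u.
  apply: rho0_dominatesB => [|v]; first by rewrite addr_ge0// ltW.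
  rewrite mulrDl; apply: le_trans (hdist_triangle _ (x rho0 v) _) _.
  by apply: lerD; [rewrite hdistC|rewrite xy].
apply: le_trans (hdist_triangle _ (universal_rep f u) _) _.
have := hdist_triangle (universal_rep f u) (universal_rep g u) (y rho u).
have := yg rho u; rewrite (hdistC (y rho u)); have := xf rho u; lra.
Qed.

(** Approximants [f k] of [T] within 2^-k form, by domination, a Cauchy sequence at the same rate in
    all representations; completeness of each [cr_space] provides the component of the lift.
    Uniqueness of limits makes it linear and equal to [T] at [rho0]. *)
Lemma approximable_crossed_product T : approximable T ->
  exists2 x : op_family alpha, crossed_product x & x rho0 = T.
Proof.
move=> [bT Tf]; pose e k : R := 2^-1 ^+ k.
have e0 k : 0 < e k by rewrite exprn_gt0// invr_gt0.
have eS j k : (k <= j)%N -> e j <= e k.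
  by move=> kj; rewrite /e ler_wiXn2l// ?invr_ge0// invf_le1// ler1n.
have [f Tfk] := choice (fun k => Tf _ (e0 k)).
have near (rho : covariant_rep alpha) (u : cr_space rho) i k : (k <= i)%N ->
    hnorm (universal_rep (f i) u - universal_rep (f k) u) <= 2 * e k * hnorm u.
  move=> ki; apply: rho0_dominatesB => [|v]; first by rewrite mulr_ge0// ltW.
  apply: le_trans (hdist_triangle _ (T v) _) _.
  have := Tfk i v; rewrite (hdistC (T v) (universal_rep (f i) v)); have := Tfk k v.
  have : e i * hnorm v <= e k * hnorm v by rewrite ler_wpM2r ?hnorm_ge0 ?eS.
  lra.
have lim (rho : covariant_rep alpha) (u : cr_space rho) : exists l, forall k,
    hnorm (l - universal_rep (f k) u) <= 2 * e k * hnorm u.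
  have [|l ul] := @hilbert_complete _ _ (fun k => universal_rep (f k) u).
    move=> d d0; have h1 : 0 < hnorm u + 1 by rewrite ltr_wpDl ?hnorm_ge0.
    have [k ke] := exprn_half_small (divr_gt0 (divr_gt0 d0 (ltr0n R 4)) h1).
    rewrite ltr_pdivlMr// -/(e k) in ke.
    exists k => i j ki kj.
    apply: le_lt_trans (hdist_triangle _ (universal_rep (f k) u) _) _.
    have := near rho u i k ki; have := near rho u j k kj.
    rewrite (hdistC (universal_rep (f j) u)).
    have := e0 k; lra.
  exists l => k; apply/ler_addgt0Pr => d d0; have [N lN] := ul d d0.
  apply: le_trans (hdist_triangle _ (universal_rep (f (maxn N k)) u) _) _.
  rewrite addrC; apply: lerD; first by apply: near; rewrite leq_maxr.
  by rewrite hdistC ltW// lN// leq_maxl.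
pose x : op_family alpha := fun rho u => projT1 (cid (lim rho u)).
have xf rho (u : cr_space rho) k :
    hnorm (x rho u - universal_rep (f k) u) <= 2 * e k * hnorm u.
  by rewrite /x; case: cid => l /=.
exists x.
  apply: crossed_productI => [rho c u v|d d0].
    apply/subr0_eq/hnorm0_eq0/eqP; rewrite eq_le hnorm_ge0 andbT.
    pose K := 2 * (hnorm (c *: u + v) + (normc c * hnorm u + hnorm v)).
    apply: (@le0_half_powers _ _ K) => k.
    pose F := @universal_rep _ _ _ _ (f k) rho.
    have lF : linear F := (@universal_rep_bounded _ _ _ _ rho (f k)).1.
    apply: le_trans (hdist_triangle _ (F (c *: u + v)) _) _.
    have -> : F (c *: u + v) - (c *: x rho u + x rho v) =
        - (c *: (x rho u - F u) + (x rho v - F v)).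
      by rewrite lF scalerBr addrACA -opprD opprB.
    rewrite hnorm_opp; have := ler_hnormD (c *: (x rho u - F u)) (x rho v - F v).
    rewrite hnormZ; have := ler_wpM2l (normc_ge0 c) (xf rho u k).
    have := xf rho v k; have := xf rho (c *: u + v) k; rewrite /K -/(e k) -/F.
    lra.
  have [k kd] := exprn_half_small (divr_gt0 d0 (ltr0n R 2)).
  exists (f k) => rho u; apply: le_trans (xf rho u k) _.
  rewrite ler_wpM2r ?hnorm_ge0//; rewrite /e; lra.
apply/funext => u; apply/subr0_eq/hnorm0_eq0/eqP; rewrite eq_le hnorm_ge0 andbT.
apply: (@le0_half_powers _ _ (3 * hnorm u)) => k.
apply: le_trans (hdist_triangle _ (universal_rep (f k) u) _) _.
have := xf rho0 u k; have := Tfk k u; rewrite (hdistC (T u)) -/(e k); lra.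
Qed.
End faithful_representation.

(** * The covariant representation on L2 *)

Section L2_representation.
Context (R : realType) (n : nat).
Local Notation mu := (lebesgue_rV R n).
Local Notation A := (C0plus R 'rV[R]_n).
Local Notation M w := (multiplication mu mu w).
Local Notation V a := (translation mu a).

Let M1 : M (ev (1 : A)) = id.
Proof. by rewrite -mult1; congr (M _); apply/funext => p; exact: ev1. Qed.

Let Mlin : linear (fun a : A => M (ev a)).
Proof.
move=> c a b; rewrite -mult_lin; try exact: bmeasurable_ev.
by congr (M _); apply/funext => p; rewrite evD evZ.
Qed.

Let MM (a b : A) : M (ev (a * b)) = M (ev a) \o M (ev b).
Proof.
rewrite multM; try exact: bmeasurable_ev.
by congr (M _); apply/funext => p; exact: evM.
Qed.

Let Mstar (a : A) : is_adjoint (M (ev a)) (M (ev (star a))).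
Proof.
have := mult_adjoint (mu := mu) (bmeasurable_ev a); congr (is_adjoint _ (M _)).
by apply/funext => p; rewrite ev_star.
Qed.

Let Vcov s (a : A) : V s \o M (ev a) = M (ev (translation_action R n s a)) \o V s.
Proof. by rewrite trans_mult//; exact: bmeasurable_ev. Qed.

Definition L2_covariant_rep : covariant_rep (translation_action R n) :=
  @CovariantRep R 'rV[R]_n A (translation_action R n) (L2 mu)
    (fun a => M (ev a)) (fun a => mult_bounded mu (bmeasurable_ev a))
    Mlin M1 MM Mstar (fun s => V s) (@trans_linear R n) (@trans_unitary R n)
    (@trans0 R n) (@transD R n) Vcov.

Lemma L2_covariant_rep_dominates : (1 <= n)%N ->
  forall (f : {fsfun 'rV[R]_n -> A with 0}) (C : R), 0 <= C ->
  (forall u : cr_space L2_covariant_rep, hnorm (universal_rep f u) <= C * hnorm u) ->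
  forall (rho : covariant_rep (translation_action R n)) (u : cr_space rho),
    hnorm (universal_rep f u) <= C * hnorm u.
Proof. by move=> n1 f C C0 fC rho u; exact: universal_rep_bound fC _ _. Qed.

(** Both kinds of generators are elementary integrated forms: a translation is pi(1) U_a, a
    multiplier is pi((f, 0)) U_0. *)
Lemma cstar_gen_approximable (T : L2 mu -> L2 mu) :
  cstar_gen (range (translation mu) `|`
    [set multiplication mu mu f | f in @C0_set R 'rV[R]_n]) T ->
  @approximable _ _ _ _ L2_covariant_rep T.
Proof.
move/(_ (@approximable _ _ _ _ L2_covariant_rep)); apply; split.
  exact: (approximable_subalgebra L2_covariant_rep).
move=> _ [[a _ <-]|[f f0 <-]]; apply: approximable_integrated_forms.
  have := @integrated_forms1 _ _ _ _ L2_covariant_rep 1 a.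
  by rewrite /= M1.
have := @integrated_forms1 _ _ _ _ L2_covariant_rep (MkC0 (mem_set f0), 0) 0.
rewrite /= trans0; congr (@integrated_forms _ _ _ _ L2_covariant_rep (multiplication mu mu _)).
by apply/funext => p; rewrite /ev/= addr0.
Qed.

(** Each term pi(f s) U_s lies in the algebra, since pi(f s) is a C_0 multiplier plus a scalar
    multiple of the translation by 0; norm-closedness does the rest. *)
Lemma approximable_cstar_gen (x : op_family (translation_action R n)) :
  crossed_product x ->
  cstar_gen (range (translation mu) `|`
    [set multiplication mu mu f | f in @C0_set R 'rV[R]_n]) (x L2_covariant_rep).
Proof.
move=> cx B [algB XB]; have [bx _] := cx.
apply: (cstar_closed algB (bx L2_covariant_rep)) => e e0.
have [f xf] := crossed_product_approx cx e0.
exists (@universal_rep _ _ _ _ f L2_covariant_rep); last first.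
  apply/(opnorm_leP _ (ltW e0)); last exact: (xf L2_covariant_rep).
  by apply: linearB_op; [exact: (bx L2_covariant_rep).1|
    exact: (@universal_rep_bounded _ _ _ _ L2_covariant_rep f).1].
rewrite universal_repE; elim/big_ind: _ => [|T S|s _].
- exact: cstar0 algB.
- exact: cstarD algB _ _.
have BV a : B (V a) by apply: XB; left; exists a.
apply: (cstarM algB) (BV s) => /=.
have bf := C0_bmeasurable (C0_valP_set (f s).1).
rewrite /ev multD ?mult_cst -?trans0//; last exact: bmeasurable_cst.
apply: (cstarD algB) (cstarZ algB _ (BV 0)).
by apply: XB; right; exists (f s).1 => //; exact: C0_valP_set.
Qed.
End L2_representation.

Theorem theorem11 (R : realType) (n : nat) (m : R) (n_ge1 : (1 <= n)%N) (m_gt0 : 0 < m) :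
  let mu := lebesgue_rV R n in
  let B : set (L2 mu -> L2 mu) := cstar_gen (range (@conj_translation R n m)) in
  B = cstar_gen (range (translation mu) `|`
                 [set multiplication mu mu f | f in @C0_set R 'rV[R]_n]) /\
  star_isomorphic_crossed_product (translation_action R n) B.
Proof.
move=> mu B; have BE := cstar_gen_conj_translation n_ge1 m_gt0.
split; first exact: BE.
have dom := @L2_covariant_rep_dominates R n n_ge1.
(* Operations on families are componentwise, so evaluation respects sums, scalars and products by
   definition. *)
exists (fun x => x (L2_covariant_rep R n)); split; split => //.
- by move=> x cx; rewrite /B BE; exact: approximable_cstar_gen.
- by move=> x y cx cy; apply: (crossed_product_inj dom).
- move=> T; rewrite /B BE => /cstar_gen_approximable.
  exact: approximable_crossed_product dom T.
- by move=> x y _ _ xy; exact: (xy (L2_covariant_rep R n)).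
Qed.
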